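(* Let $A$ and $B$ be two finite dimensional $k$-algebras. Assume that either $A$ or $B$ is Gorenstein. Then $(A\otimes_k B)\text{-}\mathsf{Gproj}=\mathsf{Mon}(B, A\text{-}\mathsf{Gproj})$ if and only if $B$ is CM-free.
   Context: $k$ is a fixed field; all algebras are nonzero finite dimensional $k$-algebras; $\otimes=\otimes_k$; modules are finitely generated left modules unless stated otherwise. $D=\mathrm{Hom}_k(-,k)$. Put $\Lambda:=A\otimes B$. Subcategories are full and closed under isomorphism. An algebra $\Gamma$ is Gorenstein if ${}_\Gamma\Gamma$ and $\Gamma_\Gamma$ both have finite injective dimension. A $\Gamma$-module $G$ is Gorenstein projective if there is an exact complex $P^\bullet=(\cdots\to P^{i}\xrightarrow{d^i}P^{i+1}\to\cdots)$ of finitely generated projective $\Gamma$-modules with $G=\mathrm{Ker}\,d^1$ such that $\mathrm{Hom}_\Gamma(P^\bullet,{}_\Gamma\Gamma)$ is exact. $\Gamma\text{-}\mathsf{Gproj}$ is the full subcategory of $\Gamma\text{-mod}$ of Gorenstein projective modules, and $\Gamma\text{-proj}$ that of projective modules. $\Gamma$ is CM-free if $\Gamma\text{-}\mathsf{Gproj}=\Gamma\text{-proj}$. The monomorphism category $\mathsf{Mon}(B,A)$ is the full subcategory of $\Lambda\text{-mod}$ consisting of the modules $X$ with $\mathrm{Tor}_i^{\Lambda}(A\otimes D(S),X)=0$ for all $i\ge 1$ and all simple left $B$-modules $S$. For a full additive subcategory $\mathscr{L}$ of $A\text{-mod}$, $\mathsf{Mon}(B,\mathscr{L})$ is the full subcategory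 of those $X\in\mathsf{Mon}(B,A)$ such that the left $A$-module $(A\otimes V)\otimes_\Lambda X$ lies in $\mathscr{L}$ for every finitely generated right $B$-module $V$ (here $A\otimes V$ is viewed as an $A$-$\Lambda$-bimodule). *)

(* Defs.v *)
From HB Require Import structures.
From mathcomp Require Import all_boot all_order all_algebra all_field.

Set Implicit Arguments.
Unset Strict Implicit.
Unset Printing Implicit Defensive.

Import Order.TTheory GRing.Theory Num.Theory.
Local Open Scope ring_scope.

(* The entry [t i j] is the coefficient of [e_i (x) f_j], for the bases
   [vbasis {:V}] and [vbasis {:W}]. *)
Definition tensor (k : fieldType) (V W : vectType k) : Type :=
  'M[k]_(\dim {:V}, \dim {:W}).

HB.instance Definition _ (k : fieldType) (V W : vectType k) :=
  Vector.copy (tensor V W) 'M[k]_(\dim {:V}, \dim {:W}).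

Section Tensor.
Variable k : fieldType.
Implicit Types V W U : vectType k.

Definition tens V W (v : V) (w : W) : tensor V W :=
  \matrix_(i, j) (coord (vbasis {:V}) i v * coord (vbasis {:W}) j w).

Definition bilinear_fun V W U (b : V -> W -> U) :=
  (forall w, linear (fun v => b v w)) /\ (forall v, linear (b v)).

Definition tlift_fun V W U (b : V -> W -> U) (t : tensor V W) : U :=
  \sum_i \sum_j (t : 'M_(_, _)) i j *: b (vbasis {:V})`_i (vbasis {:W})`_j.

Lemma tlift_fun_linear V W U (b : V -> W -> U) : linear (tlift_fun b).
Proof.
move=> c s t; rewrite /tlift_fun scaler_sumr -big_split /=; apply: eq_bigr => i _.
rewrite scaler_sumr -big_split /=; apply: eq_bigr => j _.
by rewrite !mxE scalerDl scalerA.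
Qed.
HB.instance Definition _ V W U (b : V -> W -> U) :=
  GRing.isSemilinear.Build k (tensor V W) U _ (tlift_fun b)
    (GRing.semilinear_linear (tlift_fun_linear b)).

(* When [b] is bilinear, [tlift b] is the linear map [v (x) w |-> b v w]. *)
Definition tlift V W U (b : V -> W -> U) : 'Hom(tensor V W, U) :=
  linfun (tlift_fun b).

Definition tmap V W V' W' (f : 'Hom(V, V')) (g : 'Hom(W, W')) :
    'Hom(tensor V W, tensor V' W') :=
  tlift (fun v w => tens (f v) (g w)).

Lemma tens_bilinear V W : bilinear_fun (@tens V W).
Proof.
split=> [w c v v'|v c w w']; apply/matrixP => i j; rewrite !mxE linearP /=.
  by rewrite mulrDl mulrA.
by rewrite mulrDr mulrCA.
Qed.

Lemma linear_sum_fun V U (f : V -> U) n (c : 'I_n -> k) (x : 'I_n -> V) :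
  linear f -> f (\sum_i c i *: x i) = \sum_i c i *: f (x i).
Proof.
move=> fl.
pose L := GRing.isSemilinear.Build k V U _ f (GRing.semilinear_linear fl).
pose F : {linear V -> U} := HB.pack f L.
rewrite -[f _]/(F _) linear_sum; apply: eq_bigr => i _.
by rewrite linearZ.
Qed.

Lemma tliftE V W U (b : V -> W -> U) v w :
  bilinear_fun b -> tlift b (tens v w) = b v w.
Proof.
case=> bl br; rewrite lfunE /= /tlift_fun.
rewrite [in RHS](coord_vbasis (memvf v)) [in RHS](coord_vbasis (memvf w)).
rewrite (linear_sum_fun _ _ (bl _)); apply: eq_bigr => i _.
rewrite (linear_sum_fun _ _ (br _)) scaler_sumr; apply: eq_bigr => j _.
by rewrite scalerA mxE.
Qed.

Lemma tens_basis V W (t : tensor V W) :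
  t = \sum_i \sum_j (t : 'M_(_, _)) i j *:
        tens (vbasis {:V})`_i (vbasis {:W})`_j.
Proof.
have fV := basis_free (vbasisP {:V}); have fW := basis_free (vbasisP {:W}).
rewrite {1}[t](matrix_sum_delta (t : 'M_(_, _))).
apply: eq_bigr => i _; apply: eq_bigr => j _; congr (_ *: _).
apply/matrixP => i' j'; rewrite !mxE !coord_free //.
by rewrite -natrM mulnb (eq_sym i') (eq_sym j').
Qed.

Lemma tens_ext V W U (f g : 'Hom(tensor V W, U)) :
  (forall v w, f (tens v w) = g (tens v w)) -> f = g.
Proof.
move=> fg; apply/lfunP => t; rewrite (tens_basis t) !linear_sum.
apply: eq_bigr => i _; rewrite !linear_sum; apply: eq_bigr => j _.
by rewrite !linearZ /= fg.
Qed.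

Lemma tmap_bilinear V W V' W' (f : 'Hom(V, V')) (g : 'Hom(W, W')) :
  bilinear_fun (fun v w => tens (f v) (g w)).
Proof.
have [tl tr] := @tens_bilinear V' W'.
by split=> [w c v v'|v c w w']; rewrite linearP ?tl ?tr.
Qed.

Lemma tmapE V W V' W' (f : 'Hom(V, V')) (g : 'Hom(W, W')) v w :
  tmap f g (tens v w) = tens (f v) (g w).
Proof. exact: tliftE (tmap_bilinear f g). Qed.

Lemma tmap_comp V W V' W' V'' W'' (f : 'Hom(V, V')) (g : 'Hom(W, W'))
    (f' : 'Hom(V', V'')) (g' : 'Hom(W', W'')) :
  (tmap f' g' \o tmap f g)%VF = tmap (f' \o f)%VF (g' \o g)%VF.
Proof. by apply: tens_ext => v w; rewrite comp_lfunE !tmapE !comp_lfunE. Qed.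

Lemma tmap1 V W : tmap (\1%VF : 'End(V)) (\1%VF : 'End(W)) = \1%VF.
Proof. by apply: tens_ext => v w; rewrite tmapE !id_lfunE. Qed.

Lemma tmap_hom_bilinear V W V' W' : bilinear_fun (@tmap V W V' W').
Proof.
have [tl tr] := @tens_bilinear V' W'.
split=> [g c f f'|f c g g']; apply: tens_ext => v w;
  by rewrite add_lfunE scale_lfunE !tmapE add_lfunE scale_lfunE ?tl ?tr.
Qed.

Definition incl V (U : {vspace V}) : 'Hom(subvs_of U, V) := linfun vsval.

(* [V / U], realised on the complement [U^C] of [U]. *)
Definition quot V (U : {vspace V}) : vectType k := subvs_of (U^C)%VS.
Definition qproj V (U : {vspace V}) : 'Hom(V, quot U) :=
  (linfun (vsproj (U^C)%VS) \o daddv_pi (U^C)%VS U)%VF.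
Definition qsec V (U : {vspace V}) : 'Hom(quot U, V) := incl (U^C)%VS.

(* The map [V / U -> V' / U'] induced by [f], meaningful if [f] maps [U]
   into [U']. *)
Definition qmap V V' (U : {vspace V}) (U' : {vspace V'}) (f : 'Hom(V, V')) :
    'Hom(quot U, quot U') :=
  (qproj U' \o f \o qsec U)%VF.

Lemma qprojK V (U : {vspace V}) v : v - qsec U (qproj U v) \in U.
Proof.
rewrite comp_lfunE !lfunE /= vsprojK ?memv_pi //.
have := @daddv_pi_add _ _ (U^C)%VS U v; rewrite addvC capvC capv_compl addv_complf.
move=> /(_ erefl (memvf v)) {1}<-.
by rewrite addrC addKr memv_pi.
Qed.

Lemma qsecK V (U : {vspace V}) (x : quot U) : qproj U (qsec U x) = x.
Proof.
rewrite comp_lfunE !lfunE /= daddv_pi_id ?vsvalK ?subvsP //.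
by rewrite capvC capv_compl.
Qed.

Lemma qproj0 V (U : {vspace V}) v : v \in U -> qproj U v = 0.
Proof.
move=> Uv; rewrite comp_lfunE.
suff -> : daddv_pi (U^C)%VS U v = 0 by rewrite linear0.
have := @daddv_pi_add _ _ (U^C)%VS U v; rewrite addvC capvC capv_compl addv_complf.
move=> /(_ erefl (memvf v)).
rewrite (@daddv_pi_id _ _ U (U^C)%VS) ?capv_compl //.
by move/eqP; rewrite -subr_eq0 addrK => /eqP.
Qed.

Lemma qproj_sur V (U : {vspace V}) : limg (qproj U) = fullv.
Proof.
apply/eqP; rewrite eqEsubv subvf; apply/subvP => x _.
by rewrite -[x]qsecK memv_img ?memvf.
Qed.

Lemma qmapE V V' (U : {vspace V}) (U' : {vspace V'}) (f : 'Hom(V, V')) v :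
  (f @: U <= U')%VS -> qmap U U' f (qproj U v) = qproj U' (f v).
Proof.
move=> /subvP fU; rewrite [LHS]comp_lfunE [X in X = _]comp_lfunE.
apply/esym/eqP; rewrite -subr_eq0 -linearB /= -linearB /=.
by apply/eqP/qproj0/fU; rewrite memv_img ?qprojK.
Qed.

Lemma quot_ext V (U : {vspace V}) W (f g : 'Hom(quot U, W)) :
  (forall v, f (qproj U v) = g (qproj U v)) -> f = g.
Proof. by move=> fg; apply/lfunP => x; rewrite -[x]qsecK fg. Qed.

(* [lker g / limg f]; when [g \o f] is not zero, [limg f] is replaced by its
   intersection with [lker g]. *)
Definition homology U V W (f : 'Hom(U, V)) (g : 'Hom(V, W)) : vectType k :=
  quot (incl (lker g) @^-1: limg f)%VS.

End Tensor.

(* The converse ring [G^c] of the library carries no algebra structure. *)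
Definition opalg (k : fieldType) (G : falgType k) : Type := G.

HB.instance Definition _ (k : fieldType) (G : falgType k) :=
  Vector.copy (opalg G) (G : vectType k).

Section Opposite.
Variables (k : fieldType) (G : falgType k).
Local Notation Gop := (opalg G).

Definition opmul (x y : Gop) : Gop := ((y : G) * (x : G) : G).

Lemma opmulA : associative opmul.
Proof. by move=> x y z; rewrite /opmul mulrA. Qed.
Lemma opmul1 : left_id (1 : G) opmul. Proof. exact: mulr1. Qed.
Lemma op1mul : right_id (1 : G) opmul. Proof. exact: mul1r. Qed.
Lemma opmulDl : left_distributive opmul +%R.
Proof. by move=> x y z; apply: mulrDr. Qed.
Lemma opmulDr : right_distributive opmul +%R.
Proof. by move=> x y z; apply: mulrDl. Qed.
Lemma op1_neq0 : (1 : G) != 0 :> Gop. Proof. exact: oner_neq0. Qed.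
HB.instance Definition _ := GRing.Zmodule_isNzRing.Build Gop
  opmulA opmul1 op1mul opmulDl opmulDr op1_neq0.

Lemma op_scalerAl (a : k) (x y : Gop) : a *: (x * y : Gop) = (a *: x : Gop) * y.
Proof.
change (a *: ((y : G) * (x : G) : G) = (y : G) * (a *: (x : G))).
by rewrite scalerAr.
Qed.
HB.instance Definition _ := GRing.Lmodule_isLalgebra.Build k Gop op_scalerAl.
Lemma op_scalerAr (a : k) (x y : Gop) : a *: (x * y : Gop) = x * (a *: y : Gop).
Proof.
change (a *: ((y : G) * (x : G) : G) = (a *: (y : G)) * (x : G)).
by rewrite scalerAl.
Qed.
HB.instance Definition _ := GRing.Lalgebra_isAlgebra.Build k Gop op_scalerAr.
HB.instance Definition _ := Algebra_isFalgebra.Build k Gop.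
End Opposite.

(* [A (x) B], with [(a (x) b) (a' (x) b') = a a' (x) b b'], see [talgM]. *)
Definition talg (k : fieldType) (A B : falgType k) : Type := tensor A B.

HB.instance Definition _ (k : fieldType) (A B : falgType k) :=
  Vector.copy (talg A B) (tensor A B).

Section TensorAlgebra.
Variables (k : fieldType) (A B : falgType k).
Local Notation L := (talg A B).

Definition tmul_op (x : L) : 'End(tensor A B) :=
  tlift (fun (a : A) (b : B) => tmap (amull a) (amull b)) x.
Definition tmul (x y : L) : L := tmul_op x y.
Definition tone : L := tens (1 : A) (1 : B).

Lemma amull_tmap_bilinear :
  bilinear_fun (fun (a : A) (b : B) => tmap (amull a) (amull b)).
Proof.
have [tl tr] := @tmap_hom_bilinear k A B A B.
by split=> [b c a a'|a c b b']; rewrite linearP ?tl ?tr.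
Qed.

Lemma tmul_tens (a a' : A) (b b' : B) :
  tmul (tens a b) (tens a' b') = tens (a * a') (b * b').
Proof.
by rewrite /tmul /tmul_op tliftE ?tmapE ?lfunE //; apply: amull_tmap_bilinear.
Qed.

Lemma tmulDl : left_distributive tmul +%R.
Proof. by move=> x y z; rewrite /tmul /tmul_op linearD add_lfunE. Qed.
Lemma tmulDr : right_distributive tmul +%R.
Proof. by move=> x y z; rewrite /tmul linearD. Qed.
Lemma tscalerAl (c : k) (x y : L) : c *: tmul x y = tmul (c *: x) y.
Proof. by rewrite /tmul /tmul_op linearZ scale_lfunE. Qed.
Lemma tscalerAr (c : k) (x y : L) : c *: tmul x y = tmul x (c *: y).
Proof. by rewrite /tmul linearZ. Qed.

Lemma tensor_ind (P : L -> Prop) :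
  P 0 -> (forall x y, P x -> P y -> P (x + y)) ->
  (forall c x, P x -> P (c *: x)) -> (forall a b, P (tens a b)) ->
  forall x, P x.
Proof.
move=> P0 PD PZ Pt x; rewrite [x]tens_basis.
by elim/big_ind: _ => // i _; elim/big_ind: _ => // j _; apply/PZ/Pt.
Qed.

Lemma tmulA : associative tmul.
Proof.
have m0r x : tmul x 0 = 0 by rewrite /tmul linear0.
have m0l x : tmul 0 x = 0 by rewrite /tmul /tmul_op linear0 zero_lfunE.
move=> x y z; elim/tensor_ind: x => [|x x' IH IH'|c x IH|a b].
- by rewrite !m0l.
- by rewrite !tmulDl IH IH'.
- by rewrite -!tscalerAl IH.
elim/tensor_ind: y => [|x x' IH IH'|c x IH|a' b'].
- by rewrite m0l !m0r m0l.
- by rewrite tmulDl !tmulDr tmulDl IH IH'.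
- by rewrite -tscalerAl -!tscalerAr -tscalerAl IH.
elim/tensor_ind: z => [|x x' IH IH'|c x IH|a'' b''].
- by rewrite !m0r.
- by rewrite !tmulDr IH IH'.
- by rewrite -!tscalerAr IH.
by rewrite !tmul_tens !mulrA.
Qed.

Lemma tmul1 : left_id tone tmul.
Proof.
elim/tensor_ind => [|x x' IH IH'|c x IH|a b]; rewrite /tone.
- by rewrite /tmul linear0.
- by rewrite tmulDr IH IH'.
- by rewrite -tscalerAr IH.
by rewrite tmul_tens !mul1r.
Qed.

Lemma t1mul : right_id tone tmul.
Proof.
elim/tensor_ind => [|x x' IH IH'|c x IH|a b]; rewrite /tone.
- by rewrite /tmul /tmul_op linear0 zero_lfunE.
- by rewrite tmulDl IH IH'.
- by rewrite -tscalerAl IH.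
by rewrite tmul_tens !mulr1.
Qed.

Lemma tone_neq0 : tone != 0.
Proof.
have coord1 (G : falgType k) : exists i, coord (vbasis {:G}) i 1 != 0.
  apply/existsP; rewrite -negb_forall; apply/forallP => c0.
  have /eqP := coord_vbasis (memvf (1 : G)); rewrite big1 ?oner_eq0 // => i _.
  by rewrite (eqP (c0 i)) scale0r.
have [[i ci] [j cj]] := (coord1 A, coord1 B).
apply/eqP => /matrixP/(_ i j)/eqP; rewrite !mxE mulf_eq0.
by rewrite (negbTE ci) (negbTE cj).
Qed.

HB.instance Definition _ := GRing.Zmodule_isNzRing.Build L
  tmulA tmul1 t1mul tmulDl tmulDr tone_neq0.
HB.instance Definition _ := GRing.Lmodule_isLalgebra.Build k L tscalerAl.
HB.instance Definition _ := GRing.Lalgebra_isAlgebra.Build k L tscalerAr.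
HB.instance Definition _ := Algebra_isFalgebra.Build k L.

Definition atens (a : A) (b : B) : L := tens a b.

Lemma talgM a a' b b' :
  atens a b * atens a' b' = atens (a * a') (b * b').
Proof. exact: tmul_tens. Qed.
Lemma talg1 : 1 = atens 1 1. Proof. by []. Qed.
End TensorAlgebra.

Lemma linfunEl (k : fieldType) (V W : vectType k) (f : V -> W) :
  linear f -> linfun f =1 f.
Proof.
move=> fl v.
pose L := GRing.isSemilinear.Build k V W _ f (GRing.semilinear_linear fl).
pose F : {linear V -> W} := HB.pack f L.
exact: (lfunE F).
Qed.

(* Over a finite dimensional algebra, a module is finitely generated if and
   only if it is finite dimensional over [k].  Linearity of [mact] says that
   the [k]-structures of [mcar] and of [G] agree.  Right [G]-modules are the
   modules over [opalg G]. *)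
Record fdmod (k : fieldType) (G : falgType k) := FDMod {
  mcar :> vectType k;
  mact : 'Hom(G, 'End(mcar));
  mact1 : mact 1 = \1%VF;
  mactM : forall g h : G, mact (g * h) = (mact g \o mact h)%VF }.

Notation rfdmod G := (fdmod (opalg G)).

Section Modules.
Variables (k : fieldType) (G : falgType k).
Implicit Types (M N P X : fdmod G) (V : vectType k).

Definition ishom M N (f : 'Hom(M, N)) := forall g m, f (mact M g m) = mact N g (f m).

Definition injective_hom M N (f : 'Hom(M, N)) := ishom f /\ lker f = 0%VS.
Definition surjective_hom M N (f : 'Hom(M, N)) := ishom f /\ limg f = fullv.

Definition zero_mod M := forall m : M, m = 0.

Definition simple_mod M :=
  ~ zero_mod M /\
  forall U : {vspace M}, (forall g, (mact M g @: U <= U)%VS) ->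
    U = 0%VS \/ U = fullv.

Definition projective_mod P :=
  forall M N (p : 'Hom(M, N)) (f : 'Hom(P, N)), surjective_hom p -> ishom f ->
    exists2 h : 'Hom(P, M), ishom h & f = (p \o h)%VF.

Definition injective_mod (I : fdmod G) :=
  forall M N (i : 'Hom(M, N)) (f : 'Hom(M, I)), injective_hom i -> ishom f ->
    exists2 h : 'Hom(N, I), ishom h & f = (h \o i)%VF.

(* There is an exact sequence [0 -> M -> I 0 -> ... -> I n -> 0] with all the
   [I i] injective. *)
Definition finite_injdim M :=
  exists n (I : nat -> fdmod G) (e : 'Hom(M, I 0))
         (d : forall i, 'Hom(I i, I i.+1)),
    [/\ (forall i, injective_mod (I i)) /\ (forall i, (n < i)%N -> zero_mod (I i)),
        injective_hom e, forall i, ishom (d i),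
        limg e = lker (d 0) & forall i, limg (d i) = lker (d i.+1)].

Lemma amull_linear : linear (@amull k G).
Proof. by move=> c g h; rewrite linearP. Qed.
Lemma amull_hom1 : linfun (@amull k G) 1 = \1%VF.
Proof. by rewrite (linfunEl amull_linear) amull1. Qed.
Lemma amull_homM (g h : G) :
  linfun (@amull k G) (g * h) = (linfun (@amull k G) g \o linfun (@amull k G) h)%VF.
Proof.
by apply/lfunP=> x; rewrite comp_lfunE !(linfunEl amull_linear) !lfunE /= mulrA.
Qed.
Definition regmod : fdmod G := FDMod amull_hom1 amull_homM.

(* The third condition is the exactness of [Hom_G(P, G)], the last one that
   [M] is isomorphic, via [e], to the kernel of [d 1]. *)
Definition Gproj M :=
  exists (P : int -> fdmod G) (d : forall i : int, 'Hom(P i, P (i + 1))),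
    [/\ forall i, projective_mod (P i),
        forall i, ishom (d i) /\ limg (d i) = lker (d (i + 1)),
        (forall i (f : 'Hom(P (i + 1), regmod)), ishom f ->
           (f \o d i = 0)%VF <->
           exists2 h : 'Hom(P (i + 1 + 1), regmod),
             ishom h & f = (h \o d (i + 1))%VF) &
        exists2 e : 'Hom(M, P 1), injective_hom e & limg e = lker (d 1)].

Definition CMfree := forall M, Gproj M <-> projective_mod M.

Record proj_resolution X := ProjRes {
  resm : nat -> fdmod G;
  resd : forall n, 'Hom(resm n.+1, resm n);
  rese : 'Hom(resm 0, X);
  resm_proj : forall n, projective_mod (resm n);
  resd_hom : forall n, ishom (resd n);
  rese_sur : surjective_hom rese;
  res_exact0 : limg (resd 0) = lker rese;
  res_exact : forall n, limg (resd n.+1) = lker (resd n) }.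

Section Submodule.
Variables (M : fdmod G) (U : {vspace M}).
Hypothesis stabU : forall g, (mact M g @: U <= U)%VS.

Definition sub_act g : 'End(subvs_of U) :=
  (linfun (vsproj U) \o mact M g \o incl U)%VF.
Lemma sub_actE g u : vsval (sub_act g u) = mact M g (vsval u).
Proof.
rewrite !comp_lfunE lfunE /= vsprojK ?lfunE //.
by apply: (subvP (stabU g)); rewrite memv_img ?subvsP.
Qed.
Lemma sub_act_linear : linear sub_act.
Proof.
move=> c g h; apply/lfunP => u; apply: val_inj.
rewrite [LHS]sub_actE linearP add_lfunE scale_lfunE.
by rewrite add_lfunE scale_lfunE linearP /= !sub_actE.
Qed.
Lemma sub_act1 : linfun sub_act 1 = \1%VF.
Proof.
apply/lfunP => u; apply: val_inj; rewrite (linfunEl sub_act_linear).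
by rewrite [LHS]sub_actE mact1 !id_lfunE.
Qed.
Lemma sub_actM g h :
  linfun sub_act (g * h) = (linfun sub_act g \o linfun sub_act h)%VF.
Proof.
apply/lfunP => u; apply: val_inj; rewrite comp_lfunE !(linfunEl sub_act_linear).
by rewrite [LHS]sub_actE [RHS]sub_actE sub_actE mactM comp_lfunE.
Qed.
Definition submod : fdmod G := FDMod sub_act1 sub_actM.

Lemma incl_hom : @ishom submod M (incl U).
Proof.
move=> g m; have inclE u : incl U u = vsval u by rewrite lfunE.
by rewrite [mact _ g](linfunEl sub_act_linear) !inclE sub_actE.
Qed.
End Submodule.

Section Free.
Variable V : vectType k.

Definition free_act (g : G) : 'End(tensor G V) := tmap (amull g) \1%VF.
Lemma free_act_linear : linear free_act.
Proof.
move=> c g h; rewrite /free_act linearP.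
by have [tl _] := @tmap_hom_bilinear k G V G V; apply: tl.
Qed.
Lemma free_act1 : linfun free_act 1 = \1%VF.
Proof. by rewrite (linfunEl free_act_linear) /free_act amull1 tmap1. Qed.
Lemma free_actM g h :
  linfun free_act (g * h) = (linfun free_act g \o linfun free_act h)%VF.
Proof.
apply: tens_ext => v w; rewrite comp_lfunE !(linfunEl free_act_linear).
by rewrite /free_act !tmapE !lfunE /= mulrA.
Qed.

(* The free module [G (x) V], of rank [\dim V]. *)
Definition free_mod : fdmod G := FDMod free_act1 free_actM.

Lemma free_modE g h v : mact free_mod g (tens h v) = tens (g * h) v.
Proof.
by rewrite [mact _ g](linfunEl free_act_linear) tmapE !lfunE.
Qed.
End Free.

Lemma act_bilinear M : bilinear_fun (fun g m => mact M g m).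
Proof.
split=> [m c g h|g c m n]; last by rewrite linearP.
by rewrite linearP add_lfunE scale_lfunE.
Qed.

(* Freeness: a linear map [u : V -> M] extends to [g (x) v |-> g (u v)]. *)
Definition free_lift (V : vectType k) M (u : 'Hom(V, M)) : 'Hom(free_mod V, M) :=
  tlift (fun g v => mact M g (u v)).

Lemma free_liftE V M (u : 'Hom(V, M)) g v :
  free_lift u (tens g v) = mact M g (u v).
Proof.
apply: tliftE; have [al ar] := act_bilinear M.
split=> [w c x y|x c w w']; first exact: al.
by rewrite linearP ar.
Qed.

Lemma free_lift_hom V M (u : 'Hom(V, M)) : ishom (free_lift u).
Proof.
move=> g m.
suff : (free_lift u \o mact (free_mod V) g = mact M g \o free_lift u)%VF.
  by move/lfunP/(_ m); rewrite !comp_lfunE.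
apply: tens_ext => h v.
by rewrite !comp_lfunE free_modE !free_liftE mactM comp_lfunE.
Qed.

Lemma free_proj V : projective_mod (free_mod V).
Proof.
move=> M N p f [hp sp] hf.
pose u : 'Hom(V, M) := (p^-1 \o linfun (fun v => f (tens 1 v)))%VF.
have ul : linear (fun v : V => f (tens 1 v)).
  move=> c v w; have [_ tr] := @tens_bilinear k G V.
  by rewrite tr linearP.
exists (free_lift u); first exact: free_lift_hom.
apply: tens_ext => g v; rewrite comp_lfunE free_liftE hp /u comp_lfunE.
rewrite limg_lfunVK ?sp ?memvf // (linfunEl ul) -hf free_modE.
by rewrite mulr1.
Qed.

Definition free_cover M : 'Hom(free_mod M, M) := free_lift \1%VF.

Lemma free_cover_sur M : surjective_hom (free_cover M).
Proof.
split; first exact: free_lift_hom.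
apply/eqP; rewrite eqEsubv subvf; apply/subvP => m _.
have <- : free_cover M (tens 1 m) = m by rewrite free_liftE mact1 !id_lfunE.
by rewrite memv_img ?memvf.
Qed.

Lemma ker_stab M N (f : 'Hom(M, N)) :
  ishom f -> forall g, (mact M g @: lker f <= lker f)%VS.
Proof.
move=> hf g; apply/subvP => _ /memv_imgP[m /[!memv_ker]/eqP fm ->].
by rewrite hf fm linear0.
Qed.
Definition ker_mod M N (f : 'Hom(M, N)) (hf : ishom f) : fdmod G :=
  submod (ker_stab hf).

Fixpoint syzygy X n : fdmod G :=
  if n is n'.+1 then ker_mod (free_lift_hom (\1%VF : 'End(syzygy X n'))) else X.

Definition free_resd X n :
    'Hom(free_mod (syzygy X n.+1), free_mod (syzygy X n)) :=
  (incl (lker (free_cover (syzygy X n))) \o free_cover (syzygy X n.+1))%VF.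

Lemma free_resd_hom X n : ishom (free_resd X n).
Proof.
move=> g m; rewrite /free_resd !comp_lfunE.
have [-> _] := free_cover_sur (syzygy X n.+1).
exact: incl_hom.
Qed.

Lemma limg_incl (V : vectType k) (U : {vspace V}) : limg (incl U) = U.
Proof.
apply/vspaceP => v; apply/memv_imgP/idP => [[u _ ->]|Uv].
  by rewrite lfunE subvsP.
by exists (Subvs Uv); rewrite ?memvf // lfunE.
Qed.

Lemma lker_incl (V : vectType k) (U : {vspace V}) : lker (incl U) = 0%VS.
Proof.
by apply/eqP/lker0P => u v; rewrite !lfunE; apply: val_inj.
Qed.

Lemma limg_free_resd X n : limg (free_resd X n) = lker (free_cover (syzygy X n)).
Proof.
rewrite limg_comp; have [_ ->] := free_cover_sur (syzygy X n.+1).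
exact: limg_incl.
Qed.

Lemma free_res_exact X n : limg (free_resd X n.+1) = lker (free_resd X n).
Proof.
rewrite limg_free_resd; apply/vspaceP => v; rewrite !memv_ker comp_lfunE.
apply/eqP/eqP => [->|]; first by rewrite linear0.
have /eqP/lker0P inj := lker_incl (lker (free_cover (syzygy X n))).
by rewrite -[RHS](linear0 (incl (lker (free_cover (syzygy X n))))) => /inj.
Qed.

Definition free_resolution X : proj_resolution X :=
  @ProjRes X (fun n => free_mod (syzygy X n)) (free_resd X) (free_cover X)
    (fun n => @free_proj (syzygy X n)) (@free_resd_hom X) (free_cover_sur X)
    (limg_free_resd X 0) (free_res_exact X).

End Modules.

Section TensorOver.
Variables (k : fieldType) (G : falgType k).
Implicit Types (M : rfdmod G) (X Y : fdmod G).

Definition tens_rel M X : {vspace tensor M X} :=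
  (\sum_(i < \dim {:G}) let g := (vbasis {:G})`_i in
     limg (tmap (mact M g) \1 - tmap \1 (mact X g)))%VS.

Definition mtens M X : vectType k := quot (tens_rel M X).

Lemma tens_relP M X (g : G) m x :
  tens (mact M g m) x - tens m (mact X g x) \in tens_rel M X.
Proof.
pose F (h : G) : 'Hom(tensor M X, tensor M X) :=
  tmap (mact M h) \1%VF - tmap \1%VF (mact X h).
have Fl : linear F.
  have [tl tr] := @tmap_hom_bilinear k M X M X.
  move=> c h h'; rewrite /F.
  have -> : mact M (c *: h + h') = c *: mact M h + mact M h' by exact: linearP.
  rewrite linearP tl tr scalerBr opprD !addrA; congr (_ - _).
  by rewrite -!addrA; congr (_ + _); rewrite addrC.
have -> : tens (mact M g m) x - tens m (mact X g x) = F g (tens m x).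
  by rewrite add_lfunE opp_lfunE !tmapE !id_lfunE.
rewrite (coord_vbasis (memvf g)) (linear_sum_fun _ _ Fl) sum_lfunE.
apply: memv_suml => i _; rewrite scale_lfunE memvZ //.
apply: subvP (memv_img _ (memvf _)).
exact: (sumv_sup i).
Qed.

(* The map [M (x)_G X -> M' (x)_G Y] induced by homomorphisms [f] and [h]. *)
Definition mtens_map M M' X Y (f : 'Hom(M, M')) (h : 'Hom(X, Y)) :
    'Hom(mtens M X, mtens M' Y) :=
  qmap (tens_rel M X) (tens_rel M' Y) (tmap f h).

Lemma tens_rel_stab M M' X Y (f : 'Hom(M, M')) (h : 'Hom(X, Y)) :
  @ishom k (opalg G) M M' f -> ishom h ->
  (tmap f h @: tens_rel M X <= tens_rel M' Y)%VS.
Proof.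
move=> hf hh; rewrite limg_sum; apply/subv_sumP => i _ /=.
apply: (sumv_sup i) => //=.
set g := _`_i.
rewrite -limg_comp; have -> :
   (tmap f h \o (tmap (mact M g) \1 - tmap \1 (mact X g)) =
    (tmap (mact M' g) \1 - tmap \1 (mact Y g)) \o tmap f h)%VF.
  apply: tens_ext => m x; rewrite !comp_lfunE !add_lfunE !opp_lfunE !tmapE.
  by rewrite linearB /= !tmapE !id_lfunE hf hh.
by rewrite limg_comp limgS ?subvf.
Qed.

Lemma mtens_mapE M M' X Y (f : 'Hom(M, M')) (h : 'Hom(X, Y)) m x :
  @ishom k (opalg G) M M' f -> ishom h ->
  mtens_map f h (qproj (tens_rel M X) (tens m x)) =
  qproj (tens_rel M' Y) (tens (f m) (h x)).
Proof. by move=> hf hh; rewrite /mtens_map qmapE ?tens_rel_stab ?tmapE. Qed.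

(* [H_n(M (x)_G P)] for a projective resolution [P -> X]. *)
Definition Tor_res M X (P : proj_resolution X) (n : nat) : vectType k :=
  let d n := mtens_map (\1%VF : 'End(M)) (resd P n) in
  if n is n'.+1 then homology (d n'.+1) (d n')
  else homology (d 0) (0 : 'End(mtens M (resm P 0))).

(* The choice of resolution only matters up to isomorphism. *)
Definition Tor (n : nat) M X : vectType k := Tor_res M (free_resolution X) n.

End TensorOver.

(* [A]-[G]-bimodules, [k] acting centrally. *)
Record bimod (k : fieldType) (A G : falgType k) := BiMod {
  bimod_r :> rfdmod G;
  lact : 'Hom(A, 'End(bimod_r));
  lact1 : lact 1 = \1%VF;
  lactM : forall a b : A, lact (a * b) = (lact a \o lact b)%VF;
  lact_comm : forall a : A, @ishom k (opalg G) bimod_r bimod_r (lact a) }.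

Section BimoduleTensor.
Variables (k : fieldType) (A G : falgType k) (M : bimod A G) (X : fdmod G).

Definition btens_act (a : A) : 'End(mtens M X) := mtens_map (lact M a) \1%VF.

Lemma id_hom (H : falgType k) (Y : fdmod H) : @ishom k H Y Y \1%VF.
Proof. by move=> g y; rewrite !id_lfunE. Qed.

Lemma mtens_ext (V : vectType k) (f g : 'Hom(mtens M X, V)) :
  (forall m x, f (qproj (tens_rel M X) (tens m x)) =
               g (qproj (tens_rel M X) (tens m x))) -> f = g.
Proof.
move=> fg; apply: quot_ext => t.
have /lfunP/(_ t) : (f \o qproj (tens_rel M X) = g \o qproj (tens_rel M X))%VF.
  by apply: tens_ext => m x; rewrite [LHS]comp_lfunE [RHS]comp_lfunE fg.
by rewrite [X in X = _]comp_lfunE [X in _ = X]comp_lfunE.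
Qed.

Lemma btens_actE a m x :
  btens_act a (qproj (tens_rel M X) (tens m x)) =
  qproj (tens_rel M X) (tens (lact M a m) x).
Proof.
by rewrite mtens_mapE ?id_lfunE //; [exact: lact_comm | exact: id_hom].
Qed.

Lemma btens_act_linear : linear btens_act.
Proof.
move=> c a b; apply: mtens_ext => m x.
rewrite add_lfunE scale_lfunE !btens_actE -linearP; congr (qproj _ _).
rewrite linearP add_lfunE scale_lfunE.
by have [tl _] := @tens_bilinear k M X; apply: tl.
Qed.
Lemma btens_act1 : linfun btens_act 1 = \1%VF.
Proof.
apply: mtens_ext => m x.
by rewrite (linfunEl btens_act_linear) btens_actE lact1 !id_lfunE.
Qed.
Lemma btens_actM a b :
  linfun btens_act (a * b) = (linfun btens_act a \o linfun btens_act b)%VF.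
Proof.
apply: mtens_ext => m x.
rewrite !(linfunEl btens_act_linear) [RHS]comp_lfunE.
by rewrite btens_actE [in RHS]btens_actE btens_actE lactM comp_lfunE.
Qed.

(* The left [A]-module [M (x)_G X]. *)
Definition btens : fdmod A := FDMod btens_act1 btens_actM.
End BimoduleTensor.

Section Dual.
Variables (k : fieldType) (B : falgType k) (S : fdmod B).

Definition dual_act (b : opalg B) : 'End('Hom(S, k^o)) :=
  linfun (fun f : 'Hom(S, k^o) => f \o mact S b)%VF.

Lemma dual_actE b f s : dual_act b f s = f (mact S b s).
Proof.
rewrite linfunEl ?comp_lfunE // => c g h.
by rewrite comp_lfunDl comp_lfunZl.
Qed.
Lemma dual_act_linear : linear dual_act.
Proof.
move=> c b b'; apply/lfunP => f; apply/lfunP => s.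
rewrite !(add_lfunE, scale_lfunE) !dual_actE.
have -> : mact S (c *: b + b') = c *: mact S b + mact S b' by exact: linearP.
by rewrite add_lfunE scale_lfunE linearP.
Qed.
Lemma dual_act1 : linfun dual_act 1 = \1%VF.
Proof.
apply/lfunP => f; apply/lfunP => s.
rewrite (linfunEl dual_act_linear) dual_actE id_lfunE.
have -> : mact S (1 : opalg B) = \1%VF by exact: mact1.
by rewrite id_lfunE.
Qed.
Lemma dual_actM b b' :
  linfun dual_act (b * b') = (linfun dual_act b \o linfun dual_act b')%VF.
Proof.
apply/lfunP => f; apply/lfunP => s.
rewrite comp_lfunE !(linfunEl dual_act_linear) !dual_actE.
have -> : mact S (b * b' : opalg B) = (mact S b' \o mact S b)%VF by exact: mactM.
by rewrite comp_lfunE.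
Qed.

(* [D(S) = Hom_k(S, k)], with [(f b) s = f (b s)]. *)
Definition dual : rfdmod B := FDMod dual_act1 dual_actM.
End Dual.

Section Induced.
Variables (k : fieldType) (A B : falgType k) (V : rfdmod B).
Local Notation L := (talg A B).

Definition ind_op (a : A) (b : B) : 'End(tensor A V) := tmap (amulr a) (mact V b).
Definition ind_ract (x : opalg L) : 'End(tensor A V) :=
  tlift ind_op (x : tensor A B).

Lemma ind_op_bilinear : bilinear_fun ind_op.
Proof.
have [tl tr] := @tmap_hom_bilinear k A V A V.
split=> [b c a a'|a c b b']; rewrite /ind_op.
  by rewrite linearP tl.
have -> : mact V (c *: b + b') = c *: mact V b + mact V b' by exact: linearP.
by rewrite tr.
Qed.
Lemma ind_ract_tens a b a' v :
  ind_ract (atens a b) (tens a' v) = tens (a' * a) (mact V b v).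
Proof. by rewrite /ind_ract tliftE ?tmapE ?lfunE //; apply: ind_op_bilinear. Qed.
Lemma ind_ract_linear : linear ind_ract.
Proof. by move=> c x y; rewrite /ind_ract -linearP. Qed.
Lemma ind_ract1 : linfun ind_ract 1 = \1%VF.
Proof.
rewrite (linfunEl ind_ract_linear); apply: tens_ext => a v.
rewrite ind_ract_tens mulr1 id_lfunE.
have -> : mact V (1 : opalg B) = \1%VF by exact: mact1.
by rewrite id_lfunE.
Qed.
Lemma ind_ractM x y :
  linfun ind_ract (x * y) = (linfun ind_ract x \o linfun ind_ract y)%VF.
Proof.
rewrite !(linfunEl ind_ract_linear).
have -> : (x * y : opalg L) = tmul (y : L) (x : L) by [].
have I0 : ind_ract 0 = 0 by rewrite /ind_ract linear0.
have ID s t : ind_ract (s + t) = ind_ract s + ind_ract t.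
  by rewrite /ind_ract -linearD.
have IZ c s : ind_ract (c *: s) = c *: ind_ract s.
  by rewrite /ind_ract -linearZ.
elim/(@tensor_ind k A B): x => [|s t IHs IHt|c s IH|a b].
- by rewrite /tmul linear0 I0 comp_lfun0l.
- by rewrite tmulDr !ID IHs IHt comp_lfunDl.
- by rewrite -tscalerAr !IZ IH comp_lfunZl.
elim/(@tensor_ind k A B): y => [|s t IHs IHt|c s IH|a' b'].
- by rewrite /tmul /tmul_op linear0 zero_lfunE I0 comp_lfun0r.
- by rewrite tmulDl !ID IHs IHt comp_lfunDr.
- by rewrite -tscalerAl !IZ IH comp_lfunZr.
apply: tens_ext => a'' v.
rewrite comp_lfunE tmul_tens !ind_ract_tens mulrA; congr tens.
have -> : mact V (b' * b : B) = (mact V b \o mact V b')%VF.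
  exact: (mactM V (b : opalg B) (b' : opalg B)).
by rewrite comp_lfunE.
Qed.
Definition ind_rmod : rfdmod L := FDMod ind_ract1 ind_ractM.

Definition ind_lact (a : A) : 'End(ind_rmod) := tmap (amull a) \1%VF.
Lemma ind_lact_linear : linear ind_lact.
Proof.
move=> c a b; rewrite /ind_lact linearP.
by have [tl _] := @tmap_hom_bilinear k A V A V; apply: tl.
Qed.
Lemma ind_lact1 : linfun ind_lact 1 = \1%VF.
Proof. by rewrite (linfunEl ind_lact_linear) /ind_lact amull1 tmap1. Qed.
Lemma ind_lactM a b :
  linfun ind_lact (a * b) = (linfun ind_lact a \o linfun ind_lact b)%VF.
Proof.
apply: tens_ext => a' v; rewrite comp_lfunE !(linfunEl ind_lact_linear).
by rewrite /ind_lact !tmapE !lfunE /= mulrA.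
Qed.
Lemma ind_lact_comm a :
  @ishom k (opalg L) ind_rmod ind_rmod (linfun ind_lact a).
Proof.
move=> x m; rewrite (linfunEl ind_lact_linear).
have -> : mact ind_rmod x = ind_ract x by exact: (linfunEl ind_ract_linear).
suff : (ind_lact a \o ind_ract x = ind_ract x \o ind_lact a)%VF.
  by move/lfunP/(_ m); rewrite !comp_lfunE.
elim/(@tensor_ind k A B): x => [|s t IHs IHt|c s IH|b b'].
- by rewrite /ind_ract linear0 comp_lfun0l comp_lfun0r.
- by rewrite /ind_ract linearD comp_lfunDl comp_lfunDr IHs IHt.
- by rewrite /ind_ract linearZ -comp_lfunZl -comp_lfunZr IH.
apply: tens_ext => a' v.
rewrite !comp_lfunE ind_ract_tens /ind_lact !tmapE ind_ract_tens.
by rewrite !lfunE /= mulrA.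
Qed.

(* The [A]-[A (x) B]-bimodule [A (x) V], for a right [B]-module [V], with
   [a (a' (x) v) (c (x) b) = a a' c (x) v b]. *)
Definition ind_bimod : bimod A L := BiMod ind_lact1 ind_lactM ind_lact_comm.
End Induced.

(* [Mon X] is [X \in Mon(B, A)], and [MonIn C X] is [X \in Mon(B, C)] for a
   class [C] of left [A]-modules. *)
Definition Mon (k : fieldType) (A B : falgType k) (X : fdmod (talg A B)) : Prop :=
  forall S : fdmod B, simple_mod S ->
  forall i, (1 <= i)%N ->
  forall t : Tor i (ind_bimod A (dual S)) X, t = 0.

Definition MonIn (k : fieldType) (A B : falgType k) (C : fdmod A -> Prop)
    (X : fdmod (talg A B)) : Prop :=
  Mon X /\ forall V : rfdmod B, C (btens (ind_bimod A V) X).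

Definition Gorenstein (k : fieldType) (G : falgType k) : Prop :=
  finite_injdim (regmod G) /\ finite_injdim (regmod (opalg G)).

(* Main.v *)
(**
A right module [A (x) V] over [A (x) B] satisfies
[Tor_i(A (x) V, X) = Tor_i^B(V, X)], so [X] lies in [Mon(B, A)] if and only if
[X] is projective over [B], and then [(A (x) V) (x) X = V (x)_B X].

Let [X] be projective over [B] with all [V (x)_B X] Gorenstein projective.
Since [Ext_{A (x) B}(X, A (x) D V) = Ext_A(V (x)_B X, A) = 0], a left
approximation of [X] by free modules stays one after applying [V (x)_B -];
hence it is injective, its cokernel belongs to the same class, and iterating
gives a complete resolution of [X].

Conversely, let [X] be Gorenstein projective and [B] be CM-free.  If [A] is
Gorenstein then [D A] has finite projective dimension, so maps from the complete
resolution of [X] to [D A (x) B] extend, which means that it is a complete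
resolution over [B], so that [X] is projective over [B]; and over the Gorenstein
algebra [A] every acyclic complex of projectives is totally acyclic.  If [B]
is Gorenstein, CM-freeness gives it finite global dimension, and then
[Ext(X, A (x) W) = 0] for all [W].  Finally, if the two classes agree and [M] is
Gorenstein projective over [B], then so is [A (x) M], which is therefore
projective over [B] and has [M] as a direct summand.
*)
Require Import Defs.
From mathcomp Require Import all_boot all_order all_algebra all_field.
From mathcomp Require Import zify.
From Stdlib Require Import Classical ClassicalEpsilon.

Set Implicit Arguments.
Unset Strict Implicit.
Unset Printing Implicit Defensive.

Import GRing.Theory.
Local Open Scope ring_scope.

(** * Short exact sequences *)

(** Complete resolutions are traded for their classes of cycles: a module is Gorenstein projective
    if and only if it lies in a class closed under taking a syzygy and a cosyzygy, with [Ext^1] into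
    the algebra zero. In such a class [Ext^1] is enough, as higher groups are [Ext^1] of other
    members. Restriction to [B], and [V (x)_B -] on members projective over [B], preserve the
    closure conditions; only a vanishing statement remains, which comes from adjunctions and finite
    dimensions. The price is that syzygies are unique only up to projective summands, so a given
    syzygy of a member may lie outside the class; retracts in the stable category repair this. That
    the approximation [f] of [X] is injective is not seen on [X] directly. All [V (x)_B f] are
    injective, since [V (x)_B X] is torsionless over [A]; the choice [V = D X] then splits [f] over
    [B], which also makes its cokernel projective over [B]. *)

Definition lfE :=
  (comp_lfunE, add_lfunE, opp_lfunE, scale_lfunE, zero_lfunE, id_lfunE).

Section LinearMaps.
Variable k : fieldType.
Implicit Types U V W E : vectType k.

Definition curry V W E (b : V -> W -> E) : 'Hom(V, 'Hom(W, E)) :=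
  linfun (fun v => linfun (b v)).

Lemma curryE V W E (b : V -> W -> E) v w :
  bilinear_fun b -> curry b v w = b v w.
Proof.
case=> bl br; rewrite linfunEl ?(linfunEl (br v)) // => c x y.
by apply/lfunP => z; rewrite !lfE !(linfunEl (br _)) bl.
Qed.

Lemma lker0_inj V W (f : 'Hom(V, W)) : lker f = 0%VS <-> injective f.
Proof. by split=> [/eqP/lker0P|/lker0P/eqP]. Qed.

Lemma lker0_eq0 V W (f : 'Hom(V, W)) :
  lker f = 0%VS <-> forall x, f x = 0 -> x = 0.
Proof.
split=> [/lker0_inj fi x fx|f0]; first by apply: fi; rewrite fx linear0.
apply/lker0_inj => x y fxy; apply/eqP; rewrite -subr_eq0; apply/eqP/f0.
by rewrite linearB /= fxy subrr.
Qed.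

Lemma limg_fullP V W (f : 'Hom(V, W)) :
  limg f = fullv <-> forall y, exists x, y = f x.
Proof.
split=> [f1 y|sf].
  have /memv_imgP[x _ ->] : y \in limg f by rewrite f1 memvf.
  by exists x.
apply/eqP; rewrite eqEsubv subvf; apply/subvP => y _.
by have [x ->] := sf y; rewrite memv_img ?memvf.
Qed.

Lemma limg_lkerP U V W (u : 'Hom(U, V)) (p : 'Hom(V, W)) :
  limg u = lker p <->
  (forall x, p (u x) = 0) /\ (forall y, p y = 0 -> exists x, y = u x).
Proof.
split=> [up|[pu ex]].
  split=> [x|y /eqP]; first by apply/eqP; rewrite -memv_ker -up memv_img ?memvf.
  by rewrite -memv_ker -up => /memv_imgP[x _ ->]; exists x.
apply/vspaceP => y; rewrite memv_ker; apply/memv_imgP/eqP => [[x _ ->]//|/ex[x ->]].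
by exists x; rewrite ?memvf.
Qed.

Lemma lin_split U V W (u : 'Hom(U, V)) (p : 'Hom(V, W)) :
  lker u = 0%VS -> limg p = fullv -> limg u = lker p ->
  exists (r : 'Hom(V, U)) (s : 'Hom(W, V)),
    [/\ forall x, r (u x) = x, forall z, p (s z) = z,
        forall y, u (r y) + s (p y) = y & forall x, p (u x) = 0].
Proof.
move=> u0 p1 up; have [pu0 ker_im] := (limg_lkerP u p).1 up.
have pK x : p (p^-1%VF x) = x by rewrite limg_lfunVK ?p1 ?memvf.
have uK x : u^-1%VF (u x) = x by rewrite -comp_lfunE lker0_compVf ?u0 ?lfE.
exists (u^-1 \o (\1%VF - (p^-1 \o p)%VF))%VF, p^-1%VF; split=> // [x|y].
  by rewrite !lfE pu0 linear0 subr0 uK.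
have [|x yE] := ker_im (y - (p^-1)%VF (p y)).
  by rewrite linearB /= pK subrr.
by rewrite !lfE yE uK -yE subrK.
Qed.

End LinearMaps.

Section Modules.
Variables (k : fieldType) (G : falgType k).
Implicit Types (L M N P Q X Y Z I : fdmod G).

Lemma hom_comp M N P (g : 'Hom(N, P)) (f : 'Hom(M, N)) :
  ishom g -> ishom f -> ishom (g \o f)%VF.
Proof. by move=> hg hf a m; rewrite !lfE hf hg. Qed.
Lemma hom_add M N (f g : 'Hom(M, N)) : ishom f -> ishom g -> ishom (f + g).
Proof. by move=> hf hg a m; rewrite !lfE linearD hf hg. Qed.
Lemma hom_opp M N (f : 'Hom(M, N)) : ishom f -> ishom (- f).
Proof. by move=> hf a m; rewrite !lfE linearN hf. Qed.
Lemma hom_zero M N : ishom (0 : 'Hom(M, N)).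
Proof. by move=> a m; rewrite !lfE linear0. Qed.
Lemma hom_one M : ishom (\1%VF : 'Hom(M, M)).
Proof. by move=> a m; rewrite !lfE. Qed.

Definition ses L M N (u : 'Hom(L, M)) (p : 'Hom(M, N)) : Prop :=
  [/\ injective_hom u, surjective_hom p & limg u = lker p].

(** Exactness is rephrased by equations in a [k]-linear retraction [r] and section [s], in general
    not module maps. Linear functors preserve such equations, which is how [ldual_ses],
    [oten_ses_r], [oten_ses_l] and [T_ses] obtain exactness. *)
Lemma sesP L M N (u : 'Hom(L, M)) (p : 'Hom(M, N)) :
  ses u p <-> [/\ ishom u, ishom p &
    exists (r : 'Hom(M, L)) (s : 'Hom(N, M)),
    [/\ forall x, r (u x) = x, forall z, p (s z) = z,
        forall y, u (r y) + s (p y) = y & forall x, p (u x) = 0]].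
Proof.
split=> [[[hu u0] [hp p1] up]|[hu hp [r [s [ru ps us pu]]]]].
  by split=> //; apply: lin_split.
split; first by split=> //; apply/lker0_inj; apply: can_inj ru.
  by split=> //; apply/limg_fullP => z; exists (s z).
apply/limg_lkerP; split=> // y py; exists (r y).
by rewrite -[LHS]us py linear0 addr0.
Qed.

Lemma ses_inj L M N (u : 'Hom(L, M)) (p : 'Hom(M, N)) : ses u p -> injective u.
Proof. by case=> [[_ /lker0_inj]]. Qed.
Lemma ses_hom1 L M N (u : 'Hom(L, M)) (p : 'Hom(M, N)) : ses u p -> ishom u.
Proof. by case=> [[]]. Qed.
Lemma ses_hom2 L M N (u : 'Hom(L, M)) (p : 'Hom(M, N)) : ses u p -> ishom p.
Proof. by case=> _ []. Qed.
Lemma ses_sur L M N (u : 'Hom(L, M)) (p : 'Hom(M, N)) :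
  ses u p -> forall z, exists y, z = p y.
Proof. by case=> _ [_ /limg_fullP]. Qed.
Lemma ses0 L M N (u : 'Hom(L, M)) (p : 'Hom(M, N)) :
  ses u p -> forall x, p (u x) = 0.
Proof. by case=> _ _ /limg_lkerP[]. Qed.
Lemma ses_ex L M N (u : 'Hom(L, M)) (p : 'Hom(M, N)) :
  ses u p -> forall y, p y = 0 -> exists x, y = u x.
Proof. by case=> _ _ /limg_lkerP[]. Qed.

Lemma ses_lift L M N X (u : 'Hom(L, M)) (p : 'Hom(M, N)) (f : 'Hom(X, M)) :
  ses u p -> ishom f -> (forall x, p (f x) = 0) ->
  exists2 g : 'Hom(X, L), ishom g & forall x, u (g x) = f x.
Proof.
move=> S hf pf; have ui := ses_inj S; have hu := ses_hom1 S.
have [_ _ [r [s [ru ps us pu]]]] := (sesP u p).1 S.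
have ur x : u (r (f x)) = f x by rewrite -[RHS]us pf linear0 addr0.
exists (r \o f)%VF => [a x|x]; last by rewrite lfE.
by apply: ui; rewrite hu !lfE !ur hf.
Qed.

Lemma ses_factor L M N X (u : 'Hom(L, M)) (p : 'Hom(M, N)) (f : 'Hom(M, X)) :
  ses u p -> ishom f -> (forall x, f (u x) = 0) ->
  exists2 g : 'Hom(N, X), ishom g & forall y, g (p y) = f y.
Proof.
move=> S hf fu; have hp := ses_hom2 S.
have [_ _ [r [s [ru ps us pu]]]] := (sesP u p).1 S.
have fs y : f (s (p y)) = f y by rewrite -[in RHS](us y) linearD /= fu add0r.
exists (f \o s)%VF => [a z|y]; last by rewrite lfE.
by have [y ->] := ses_sur S z; rewrite -hp !lfE !fs hf.
Qed.

Lemma kernel_ses M N (p : 'Hom(M, N)) :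
  surjective_hom p -> exists (L : fdmod G) (u : 'Hom(L, M)), ses u p.
Proof.
move=> [hp p1]; exists (ker_mod hp), (incl (lker p)); split=> //.
  by split; [exact: incl_hom | exact: lker_incl].
exact: limg_incl.
Qed.

Section Quotient.
Variables (M : fdmod G) (U : {vspace M}).
Hypothesis stabU : forall g, (mact M g @: U <= U)%VS.

Definition quot_act g : 'End(quot U) := qmap U U (mact M g).
Lemma quot_actE g m : quot_act g (qproj U m) = qproj U (mact M g m).
Proof. exact: qmapE. Qed.
Lemma quot_act_linear : linear quot_act.
Proof.
move=> c g h; apply: quot_ext => m; rewrite add_lfunE scale_lfunE !quot_actE.
by rewrite linearP add_lfunE scale_lfunE linearP.
Qed.
Lemma quot_act1 : linfun quot_act 1 = \1%VF.
Proof.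
by apply: quot_ext => m; rewrite (linfunEl quot_act_linear) quot_actE mact1 !id_lfunE.
Qed.
Lemma quot_actM g h :
  linfun quot_act (g * h) = (linfun quot_act g \o linfun quot_act h)%VF.
Proof.
apply: quot_ext => m.
by rewrite [RHS]comp_lfunE !(linfunEl quot_act_linear) !quot_actE mactM comp_lfunE.
Qed.
Definition quotmod : fdmod G := FDMod quot_act1 quot_actM.

Lemma qproj_hom : @ishom _ _ M quotmod (qproj U).
Proof.
move=> g m; have -> : mact quotmod g = quot_act g.
  exact: (linfunEl quot_act_linear).
by rewrite quot_actE.
Qed.

Lemma quot_ses :
  @ses (submod stabU) M quotmod (incl U) (qproj U).
Proof.
split; first by split; [exact: incl_hom | exact: lker_incl].
  by split; [exact: qproj_hom | exact: qproj_sur].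
rewrite limg_incl; apply/vspaceP => m; rewrite memv_ker.
apply/idP/eqP => [/qproj0//|m0].
by rewrite -[m](subrK (qsec U (qproj U m))) {2}m0 linear0 addr0 qprojK.
Qed.
End Quotient.

Lemma img_stab M N (f : 'Hom(M, N)) :
  ishom f -> forall g, (mact N g @: limg f <= limg f)%VS.
Proof.
move=> hf g; apply/subvP => _ /memv_imgP[_ /memv_imgP[m _ ->] ->].
by rewrite -hf memv_img ?memvf.
Qed.

Lemma cokernel_ses M N (u : 'Hom(M, N)) :
  injective_hom u -> exists (C : fdmod G) (p : 'Hom(N, C)), ses u p.
Proof.
move=> hu; have hh := hu.1; have S := quot_ses (img_stab hh).
exists (quotmod (img_stab hh)), (qproj (limg u)); split=> //.
  by case: S.
by case: S => _ _ <-; rewrite limg_incl.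
Qed.

End Modules.

#[export] Hint Resolve hom_comp hom_add hom_opp hom_zero hom_one : hom.
Ltac homs := solve [eauto 10 with hom].

(** * Vanishing of the first extension group *)

Section Premodule.
Variables (k : fieldType) (G : falgType k) (V : rfdmod G) (N : vectType k).

(** The common source of the injective modules [cofree] ([V] regular), of the dual [ldual] ([N = k])
    and of the action of [B] on [hmodB]. *)
Definition pre_act (g : G) : 'End('Hom(V, N)) :=
  linfun (fun f : 'Hom(V, N) => f \o mact V g)%VF.

Lemma pre_actE g f v : pre_act g f v = f (mact V g v).
Proof.
rewrite linfunEl ?comp_lfunE // => c f1 f2.
by rewrite comp_lfunDl comp_lfunZl.
Qed.

Lemma ractM (W : rfdmod G) (g h : G) w :
  mact W (g * h : G) w = mact W h (mact W g w).
Proof.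
have -> : mact W (g * h : G) = (mact W h \o mact W g)%VF.
  exact: (mactM W (h : opalg G) (g : opalg G)).
by rewrite comp_lfunE.
Qed.

Lemma ract1 (W : rfdmod G) w : mact W (1 : G) w = w.
Proof.
have -> : mact W (1 : G) = \1%VF by exact: mact1.
by rewrite id_lfunE.
Qed.

Lemma pre_act_linear : linear pre_act.
Proof.
move=> c g h; apply/lfunP => f; apply/lfunP => v.
rewrite 2!add_lfunE 2!scale_lfunE !pre_actE.
have -> : mact V (c *: g + h) = c *: mact V g + mact V h by exact: linearP.
by rewrite add_lfunE scale_lfunE linearP.
Qed.
Lemma pre_act1 : linfun pre_act 1 = \1%VF.
Proof.
apply/lfunP => f; apply/lfunP => v; rewrite (linfunEl pre_act_linear) pre_actE.
by rewrite ract1 id_lfunE.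
Qed.
Lemma pre_actM g h :
  linfun pre_act (g * h) = (linfun pre_act g \o linfun pre_act h)%VF.
Proof.
apply/lfunP => f; apply/lfunP => v.
by rewrite comp_lfunE !(linfunEl pre_act_linear) !pre_actE ractM.
Qed.

Definition premod : fdmod G := FDMod pre_act1 pre_actM.

Lemma premodE (g : G) (f : 'Hom(V, N)) v :
  (mact premod g f : 'Hom(V, N)) v = f (mact V g v).
Proof.
have -> : mact premod g = pre_act g by exact: (linfunEl pre_act_linear).
exact: pre_actE.
Qed.
End Premodule.

Section HomologicalAlgebra.
Variables (k : fieldType) (G : falgType k).
Implicit Types (E F L M N P Q X Y Z I : fdmod G) (U V W : vectType k).

Lemma inj_lift L M X (u : 'Hom(L, M)) (f : 'Hom(X, M)) :
  injective_hom u -> ishom f -> (forall x, exists y, f x = u y) ->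
  exists2 g : 'Hom(X, L), ishom g & forall x, u (g x) = f x.
Proof.
move=> [hu u0] hf fu; have /lker0_inj ui := u0.
have ug x : u ((u^-1 \o f)%VF x) = f x.
  by have [y fy] := fu x; rewrite lfE limg_lfunVK // fy memv_img ?memvf.
exists (u^-1 \o f)%VF => [a x|x]; last exact: ug.
by apply: ui; rewrite hu !ug hf.
Qed.

Lemma proj_lift P M N (p : 'Hom(M, N)) (f : 'Hom(P, N)) :
  projective_mod P -> surjective_hom p -> ishom f ->
  exists2 h : 'Hom(P, M), ishom h & forall x, p (h x) = f x.
Proof.
move=> pP sp hf; have [h hh ->] := pP _ _ _ _ sp hf.
by exists h => // x; rewrite lfE.
Qed.

Lemma inj_extend I M N (i : 'Hom(M, N)) (f : 'Hom(M, I)) :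
  injective_mod I -> injective_hom i -> ishom f ->
  exists2 h : 'Hom(N, I), ishom h & forall x, h (i x) = f x.
Proof.
move=> iI hi hf; have [h hh ->] := iI _ _ _ _ hi hf.
by exists h => // x; rewrite lfE.
Qed.

Lemma proj_retract P Y (i : 'Hom(Y, P)) (r : 'Hom(P, Y)) :
  projective_mod P -> ishom i -> ishom r -> (forall y, r (i y) = y) ->
  projective_mod Y.
Proof.
move=> pP hi hr ri M N p f sp hf.
have [h hh ph] := proj_lift pP sp (hom_comp hf hr).
exists (h \o i)%VF; first homs.
by apply/lfunP => y; rewrite !lfE ph lfE ri.
Qed.

Lemma free_ses X : exists Y V (u : 'Hom(Y, free_mod G V)) (p : 'Hom(_, X)), ses u p.
Proof.
by have [Y [u S]] := kernel_ses (free_cover_sur X); exists Y, X, u, (free_cover X).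
Qed.

Lemma proj_free P : projective_mod P ->
  exists V (i : 'Hom(P, free_mod G V)) (r : 'Hom(free_mod G V, P)),
    [/\ ishom i, ishom r & forall x, r (i x) = x].
Proof.
move=> pP; have [i hi ri] := proj_lift pP (free_cover_sur P) (@hom_one _ _ P).
exists P, i, (free_cover P); split=> // [|x]; last by rewrite ri lfE.
by have [] := free_cover_sur P.
Qed.

Lemma proj_ses_split L M P (u : 'Hom(L, M)) (p : 'Hom(M, P)) :
  ses u p -> projective_mod P ->
  exists (r : 'Hom(M, L)) (s : 'Hom(P, M)),
    [/\ ishom r, ishom s, forall x, r (u x) = x, forall z, p (s z) = z &
        forall y, u (r y) + s (p y) = y].
Proof.
move=> S pP; have hp := ses_hom2 S.
have [_ sp _] := S; have [s hs ps] := proj_lift pP sp (@hom_one _ _ P).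
have [|x|r hr ur] := ses_lift S (f := \1%VF - (s \o p)%VF); first homs.
  by rewrite !lfE linearB /= ps lfE subrr.
exists r, s; split=> // [x|z|y].
- by apply: (ses_inj S); rewrite ur !lfE (ses0 S) linear0 subr0.
- by rewrite ps lfE.
by rewrite ur !lfE subrK.
Qed.

(** Surjectivity of [Hom_G(E, M) -> Hom_G(Y, M)]. Injectivity of [u] is not built in, since for left
    approximations it is a conclusion. *)
Definition extends Y E (u : 'Hom(Y, E)) M : Prop :=
  forall f : 'Hom(Y, M), ishom f ->
    exists2 h : 'Hom(E, M), ishom h & forall y, h (u y) = f y.

(* [Ext^1_G(X, M) = 0]: every extension of [M] has the lifting property with
   respect to [X]. *)
Definition ext10 X M : Prop :=
  forall N N' (v : 'Hom(M, N)) (q : 'Hom(N, N')) (g : 'Hom(X, N')),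
    ses v q -> ishom g ->
    exists2 h : 'Hom(X, N), ishom h & forall x, q (h x) = g x.

(** A lift [h] of [g \o p] to [N] restricts on [Y] to a map into [M]. Once this restriction is
    extended to [Q], subtracting the extension makes [h] vanish on [Y], and it descends to [X]. *)
Lemma ext10I Y Q X (u : 'Hom(Y, Q)) (p : 'Hom(Q, X)) M :
  ses u p -> projective_mod Q -> extends u M -> ext10 X M.
Proof.
move=> S pQ uM N N' v q g T hg; have hp := ses_hom2 S; have hu := ses_hom1 S.
have hv := ses_hom1 T; have [_ sq _] := T.
have [h hh qh] := proj_lift pQ sq (hom_comp hg hp).
have [||f hf vf] := ses_lift T (f := (h \o u)%VF); first homs.
  by move=> y; rewrite lfE qh lfE (ses0 S) linear0.
have [e he eu] := uM f hf.
have [||l hl lp] := ses_factor S (f := h - (v \o e)%VF); first homs.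
  by move=> y; rewrite !lfE eu vf lfE subrr.
exists l => // x; have [y ->] := ses_sur S x.
by rewrite lp !lfE linearB /= qh (ses0 T) subr0 lfE.
Qed.

(** The right adjoint of the forgetful functor: [Hom_G(M, cofree U) = Hom_k(M, U)], whence its
    injectivity. *)
Definition cofree (U : vectType k) : fdmod G := premod (regmod (opalg G)) U.

Lemma cofreeE U (g : G) (f : cofree U) (h : G) :
  (mact (cofree U) g f : 'Hom(G, U)) h = (f : 'Hom(G, U)) (h * g).
Proof.
transitivity ((f : 'Hom(G, U)) (mact (regmod (opalg G)) g h)).
  exact: (@premodE k G (regmod (opalg G)) U g f h).
have -> : mact (regmod (opalg G)) g = amull (g : opalg G).
  exact: (linfunEl (@amull_linear k (opalg G))).
by rewrite lfunE.
Qed.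

Lemma regmodE (g h : G) : mact (regmod G) g h = g * h.
Proof. by rewrite [mact _ g](linfunEl (@amull_linear k G)) lfunE. Qed.

Lemma regmod_proj : projective_mod (regmod G).
Proof.
move=> M N p f [hp /limg_fullP sp] hf; have [m pm] := sp (f 1).
have hE g : linfun (fun g => mact M g m) g = mact M g m.
  by apply: linfunEl => c x y; rewrite linearP !lfE.
exists (linfun (fun g => mact M g m)) => [g h|].
  by rewrite !hE regmodE mactM lfE.
by apply/lfunP => g; rewrite lfE hE hp -pm -hf regmodE mulr1.
Qed.

Definition cofree_lift M U (l : 'Hom(M, U)) : 'Hom(M, cofree U) :=
  curry (fun m (h : G) => l (mact M h m)).

Lemma cofree_liftE M U (l : 'Hom(M, U)) m (h : G) :
  (cofree_lift l m : 'Hom(G, U)) h = l (mact M h m).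
Proof.
apply: curryE; split=> [w c x y|w c x y]; first by rewrite !linearP.
by rewrite (linearP (mact M)) !lfE linearP.
Qed.

Lemma cofree_lift_hom M U (l : 'Hom(M, U)) : ishom (cofree_lift l).
Proof.
move=> g m; apply/(@lfunP _ G U) => h.
by rewrite cofreeE !cofree_liftE mactM lfE.
Qed.

Lemma cofree_inj U : injective_mod (cofree U).
Proof.
move=> M N i f [hi i0] hf.
pose ev : 'Hom(cofree U, U) := linfun (fun f : 'Hom(G, U) => f 1).
have evE (c : 'Hom(G, U)) : ev c = c 1.
  by rewrite linfunEl // => a x y; rewrite !lfE.
have iK m : i^-1%VF (i m) = m by rewrite -comp_lfunE lker0_compVf ?i0 ?lfE.
exists (cofree_lift (ev \o f \o i^-1)%VF); first exact: cofree_lift_hom.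
apply/lfunP => m; apply/(@lfunP _ G U) => h.
by rewrite [in RHS]comp_lfunE cofree_liftE !comp_lfunE -hi iK evE hf cofreeE mul1r.
Qed.

Lemma inj_embed M : exists I (u : 'Hom(M, I)), injective_mod I /\ injective_hom u.
Proof.
exists (cofree M), (cofree_lift \1%VF); split; first exact: cofree_inj.
split; first exact: cofree_lift_hom.
apply/lker0_eq0 => m /(@lfunP _ G M)/(_ 1).
by rewrite cofree_liftE mact1 !lfE.
Qed.

Lemma inj_ses M : exists I N (u : 'Hom(M, I)) (q : 'Hom(I, N)),
  injective_mod I /\ ses u q.
Proof.
have [I [u [iI iu]]] := inj_embed M; have [N [q S]] := cokernel_ses iu.
by exists I, N, u, q.
Qed.

(** At least [f] extends to a map [e] from [E] into an injective module [I] containing [M]. Modulo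
    [M] it descends to [X -> I / M]; a lift of that to [I], subtracted from [e], leaves a map into
    [M]. *)
Lemma ext10E Y E X (u : 'Hom(Y, E)) (p : 'Hom(E, X)) M :
  ses u p -> ext10 X M -> extends u M.
Proof.
move=> S XM f hf; have hp := ses_hom2 S.
have [I [N [j [q [iI T]]]]] := inj_ses M.
have hj := ses_hom1 T; have hq := ses_hom2 T; have [iu _ _] := S.
have [e he eu] := inj_extend iI iu (hom_comp hj hf).
have [||g hg gp] := ses_factor S (f := (q \o e)%VF); first homs.
  by move=> y; rewrite lfE eu lfE (ses0 T).
have [h hh qh] := XM _ _ _ _ _ T hg.
have [||l hl jl] := ses_lift T (f := e - (h \o p)%VF); first homs.
  by move=> y; rewrite !lfE linearB /= qh gp lfE subrr.
exists l => // y; apply: (ses_inj T).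
by rewrite jl !lfE (ses0 S) linear0 subr0 eu lfE.
Qed.

Lemma ext10_inj X I : injective_mod I -> ext10 X I.
Proof.
move=> iI; have [Y [V [u [p S]]]] := free_ses X.
apply: (ext10I S); first exact: free_proj.
by move=> f hf; have [iu _ _] := S; apply: inj_extend.
Qed.

Lemma ext10_projl P M : projective_mod P -> ext10 P M.
Proof. by move=> pP N N' v q g [_ sq _] hg; apply: proj_lift. Qed.

(** A relation and not a function, as any projective module may stand in the middle; it is also read
    as [X] being a cosyzygy of [Y]. *)
Definition syz Y X : Prop :=
  exists Q (u : 'Hom(Y, Q)) (p : 'Hom(Q, X)), projective_mod Q /\ ses u p.

Lemma syz_ex X : exists Y, syz Y X.
Proof.
have [Y [V [u [p S]]]] := free_ses X.
by exists Y, (free_mod G V), u, p; split=> //; apply: free_proj.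
Qed.

(** [Ext^1(X, N)] lies between [Ext^1(X, M)] and [Ext^2(X, L) = Ext^1(Y, L)] in the long exact
    sequence. *)
Lemma ext10_quot Y X L M N (v : 'Hom(L, M)) (q : 'Hom(M, N)) :
  syz Y X -> ses v q -> ext10 X M -> ext10 Y L -> ext10 X N.
Proof.
move=> [Q [u [p [pQ S]]]] T XM YL; apply: (ext10I S) => // f hf.
have [h hh qh] := YL _ _ _ _ _ T hf; have [e he eu] := ext10E S XM hh.
exists (q \o e)%VF; first by have := ses_hom2 T; homs.
by move=> y; rewrite lfE eu qh.
Qed.

(** As [X] is a syzygy of [Z], the exact sequence [Ext^1(Z, N) -> Ext^2(Z, L) -> Ext^2(Z, M)] reads
    [Ext^1(Z, N) -> Ext^1(X, L) -> Ext^1(X, M)]. *)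
Lemma ext10_sub X Z L M N (v : 'Hom(L, M)) (q : 'Hom(M, N)) :
  syz X Z -> ses v q -> ext10 X M -> ext10 Z N -> ext10 X L.
Proof.
move=> [Q [w [t [pQ R]]]] T XM ZN; have [Y [V [u [p S]]]] := free_ses X.
have hv := ses_hom1 T; have hp := ses_hom2 S; have hq := ses_hom2 T.
have hw := ses_hom1 R; have [_ sq _] := T.
apply: (ext10I S); first exact: free_proj.
move=> f hf; have [g hg gu] := ext10E S XM (hom_comp hv hf).
have [||l hl lp] := ses_factor S (f := (q \o g)%VF); first homs.
  by move=> y; rewrite lfE gu lfE (ses0 T).
have [m hm mw] := ext10E R ZN hl; have [n hn qn] := proj_lift pQ sq hm.
have [||e he ve] := ses_lift T (f := g - (n \o w \o p)%VF); first homs.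
  by move=> y; rewrite !lfE linearB /= qn mw lp lfE subrr.
exists e => // y; apply: (ses_inj T).
by rewrite ve !lfE (ses0 S) !linear0 addr0 gu lfE.
Qed.

Lemma ext10_mid X L M N (v : 'Hom(L, M)) (q : 'Hom(M, N)) :
  ses v q -> ext10 X L -> ext10 X N -> ext10 X M.
Proof.
move=> T XL XN; have [Y [V [u [p S]]]] := free_ses X.
have hv := ses_hom1 T; have hq := ses_hom2 T; have [_ sq _] := T.
have hu := ses_hom1 S; have pF := @free_proj k G V.
apply: (ext10I S) => // f hf.
have [e he eu] := ext10E S XN (hom_comp hq hf).
have [g hg qg] := proj_lift pF sq he.
have [||l hl vl] := ses_lift T (f := f - (g \o u)%VF); first homs.
  by move=> y; rewrite !lfE linearB /= qg eu lfE subrr.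
have [m hm mu] := ext10E S XL hl.
exists (g + (v \o m)%VF); first homs.
by move=> y; rewrite !lfE mu vl !lfE addrC subrK.
Qed.

Section Coordinates.
Variable V : vectType k.
Let e := vbasis {:V}.

Definition free_in (j : 'I_(\dim {:V})) : 'Hom(regmod G, free_mod G V) :=
  linfun (fun g : G => tens g e`_j).
Lemma free_inE j g : free_in j g = tens g e`_j.
Proof. by apply: linfunEl; have [tl _] := @tens_bilinear k G V; apply: tl. Qed.
Lemma free_in_hom j : ishom (free_in j).
Proof. by move=> g h; rewrite !free_inE free_modE regmodE. Qed.

Definition free_co (j : 'I_(\dim {:V})) : 'Hom(free_mod G V, regmod G) :=
  tlift (fun (g : G) v => coord e j v *: g).
Lemma free_coE j g v : free_co j (tens g v) = coord e j v *: g.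
Proof.
apply: tliftE; split=> [w c x y|x c w w'].
  by rewrite scalerDr !scalerA mulrC.
by rewrite linearP scalerDl scalerA.
Qed.
Lemma free_co_hom j : ishom (free_co j).
Proof.
move=> g m; suff : (free_co j \o mact (free_mod G V) g =
    mact (regmod G) g \o free_co j)%VF by move/lfunP/(_ m); rewrite !lfE.
apply: tens_ext => h v; rewrite !lfE free_modE !free_coE linearZ /=.
by rewrite regmodE.
Qed.

Lemma free_co_in m : \sum_j free_in j (free_co j m) = m.
Proof.
suff : (\sum_j (free_in j \o free_co j) = \1)%VF.
  move/lfunP/(_ m); rewrite lfE sum_lfunE => {2}<-.
  by apply: eq_bigr => j _; rewrite lfE.
apply: tens_ext => g v; rewrite sum_lfunE lfE.
rewrite {2}(coord_vbasis (memvf v)) -/e.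
have [_ tr] := @tens_bilinear k G V; rewrite (linear_sum_fun _ _ (tr g)).
by apply: eq_bigr => j _; rewrite lfE free_coE linearZ /= free_inE.
Qed.
End Coordinates.

(** [Hom_G(u, -)] respects finite direct sums and retracts, and [P] is a retract of a finite sum of
    copies of [G]. *)
Lemma extends_proj Y E (u : 'Hom(Y, E)) P :
  extends u (regmod G) -> projective_mod P -> extends u P.
Proof.
move=> uG /proj_free[V [i [r [hi hr ri]]]] f hf.
suff [h hh hE] : exists2 h : 'Hom(E, free_mod G V), ishom h & forall y,
    h (u y) = \sum_j free_in j (free_co j (i (f y))).
  exists (r \o h)%VF; first homs.
  by move=> y; rewrite lfE hE free_co_in ri.
elim: (index_enum _) => [|j s [h hh hE]].
  by exists 0 => [|y]; [homs | rewrite lfE big_nil].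
have hj := free_co_hom j.
have [g hg gE] := uG (free_co j \o (i \o f))%VF (hom_comp hj (hom_comp hi hf)).
exists ((free_in j \o g)%VF + h); first by have := @free_in_hom V j; homs.
by move=> y; rewrite big_cons !lfE hE gE !lfE.
Qed.

Lemma ext10_projr X P : ext10 X (regmod G) -> projective_mod P -> ext10 X P.
Proof.
move=> XG pP; have [Y [V [u [p S]]]] := free_ses X.
apply: (ext10I S); first exact: free_proj.
exact: extends_proj (ext10E S XG) pP.
Qed.

Definition torsionless X : Prop :=
  forall x : X, (forall f : 'Hom(X, regmod G), ishom f -> f x = 0) -> x = 0.

Lemma torsionless_inj X E (f : 'Hom(X, E)) :
  torsionless X -> ishom f -> extends f (regmod G) -> injective_hom f.
Proof.
move=> tX hf ef; split=> //; apply/lker0_eq0 => x fx; apply: tX => g hg.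
by have [h _ <-] := ef g hg; rewrite fx linear0.
Qed.

Lemma torsionless_free V : torsionless (free_mod G V).
Proof.
move=> x fx; rewrite -(free_co_in x); apply: big1 => j _.
by rewrite fx ?linear0 //; apply: free_co_hom.
Qed.

Lemma torsionless_sub X Y (i : 'Hom(X, Y)) :
  torsionless Y -> injective_hom i -> torsionless X.
Proof.
move=> tY [hi /lker0_eq0 i0] x fx; apply/i0/tY => f hf.
by rewrite -comp_lfunE fx //; homs.
Qed.

Lemma torsionless_proj P : projective_mod P -> torsionless P.
Proof.
move=> /proj_free[V [i [r [hi hr ri]]]].
apply: torsionless_sub (@torsionless_free V) _; split=> //.
by apply/lker0_inj; apply: can_inj ri.
Qed.

(* A left approximation of [X] by free modules: with [f_1, ..., f_n] a basis
   of [Hom_G(X, G)], send [x] to [(f_1 x, ..., f_n x)]. *)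
Lemma left_approx X :
  exists V (f : 'Hom(X, free_mod G V)), ishom f /\ extends f (regmod G).
Proof.
(* [Psi f g] measures how far [f] is from commuting with [g], so that [lker Psi] is [Hom_G(X, G)] as
   a subspace, with a finite basis. *)
pose Psi := curry (fun (f : 'Hom(X, regmod G)) (g : G) =>
  (f \o mact X g)%VF - (mact (regmod G) g \o f)%VF).
have PsiE f g : Psi f g = (f \o mact X g)%VF - (mact (regmod G) g \o f)%VF.
  apply: curryE; split=> [h c f1 f2|f1 c g1 g2].
    apply/lfunP => x; rewrite !lfE !linearP /=.
    by rewrite scalerDr -!addrA; congr (_ + _); rewrite addrCA.
  apply/lfunP => x; rewrite !lfE !(linearP (mact _)) !lfE.
  by rewrite !linearP /= scalerDr -!addrA; congr (_ + _); rewrite addrCA.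
have PsiP f : f \in lker Psi <-> ishom f.
  rewrite memv_ker; split=> [/eqP f0 g x|hf].
    move/lfunP/(_ g): f0; rewrite PsiE lfE => /lfunP/(_ x); rewrite !lfE.
    by move/eqP; rewrite subr_eq0 => /eqP.
  apply/eqP/lfunP => g; rewrite PsiE lfE; apply/lfunP => x.
  by rewrite !lfE hf subrr.
set H := lker Psi in PsiP; pose n := \dim H; pose b := vbasis H.
pose V : vectType k := 'rV[k]_n.
pose t (i : 'I_n) : 'Hom(regmod G, free_mod G V) :=
  linfun (fun g : G => tens g (delta_mx 0 i : V)).
have tE i g : t i g = tens g (delta_mx 0 i : V).
  by apply: linfunEl; have [tl _] := @tens_bilinear k G V; apply: tl.
have ht i : ishom (t i) by move=> g h; rewrite !tE free_modE regmodE.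
have hb (i : 'I_n) : ishom (b`_i).
  by apply/PsiP; apply: vbasis_mem; rewrite mem_nth ?size_tuple.
exists V, (\sum_i (t i \o b`_i)%VF); split.
  by apply: (big_ind (@ishom k G X (free_mod G V))) => *; homs.
move=> f /PsiP/coord_vbasis fE.
pose c : 'Hom(V, regmod G) := linfun (fun w : 'rV[k]_n =>
  \sum_i (coord b i f * w 0 i) *: (1 : G)).
have cE w : c w = \sum_i (coord b i f * w 0 i) *: (1 : G).
  apply: linfunEl => a w1 w2; rewrite scaler_sumr -big_split /=.
  by apply: eq_bigr => i _; rewrite !mxE mulrDr scalerDl scalerA mulrCA.
exists (free_lift c); first exact: free_lift_hom.
move=> x; rewrite fE !sum_lfunE linear_sum; apply: eq_bigr => i _.
rewrite [in LHS]comp_lfunE tE.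
transitivity (mact (regmod G) (b`_i x) (c (delta_mx 0 i))).
  exact: free_liftE.
rewrite cE (bigD1 i) //= big1 => [|j ji].
  by rewrite addr0 !mxE !eqxx mulr1 lfE linearZ /= regmodE mulr1.
by rewrite !mxE (negbTE ji) andbF mulr0 scale0r.
Qed.

End HomologicalAlgebra.

(** * Gorenstein projective modules *)

Section GorensteinProjective.
Variables (k : fieldType) (G : falgType k).
Implicit Types (E F L M N P Q X Y Z I : fdmod G) (U V W : vectType k).
Implicit Types C : fdmod G -> Prop.

(* The kernels of the differentials of acyclic complexes of projectives. *)
Definition stable C : Prop :=
  (forall X, C X -> exists2 Y, C Y & syz Y X) /\
  (forall X, C X -> exists2 Y, C Y & syz X Y).

(** For [C] closed under syzygies this amounts to [Ext^i(X, M) = 0] for all [i >= 1]. *)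
Definition perp C M : Prop := forall X, C X -> ext10 X M.

(** [C] consists of the modules isomorphic to a module of cycles of the complete resolution.
    Together with [stable_Gproj] this makes [Gproj] the largest stable class orthogonal to [G], so
    membership is proved by exhibiting a class. *)
Lemma Gproj_stable M : Gproj M ->
  exists C, [/\ stable C, perp C (regmod G) & C M].
Proof.
case=> [P [d [pP hd dG [e ie eM]]]].
have hom_d i : ishom (d i) by case: (hd i).
(* Indices are written as [j + 1] and substituted, since [d] would otherwise have to be transported
   along [i - 1 + 1 = i]. *)
have pred_ex (i : int) : exists j, i = j + 1 by exists (i - 1); rewrite subrK.
pose C Y := exists i (f : 'Hom(Y, P i)), injective_hom f /\ limg f = lker (d i).
pose K i := ker_mod (hom_d i).
pose inc i : 'Hom(K i, P i) := incl (lker (d i)).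
have inc_inj i : injective_hom (inc i).
  by split; [exact: incl_hom | exact: lker_incl].
have inc_im i : limg (inc i) = lker (d i) by exact: limg_incl.
have CK i : C (K i) by exists i, (inc i).
have cosyzP i : exists2 p : 'Hom(P i, K (i + 1)), surjective_hom p &
    forall x, inc (i + 1) (p x) = d i x.
  have im x : exists y, d i x = inc (i + 1) y.
    suff /memv_imgP[y _ ->] : d i x \in limg (inc (i + 1)) by exists y.
    by rewrite inc_im -(hd i).2 memv_img ?memvf.
  have [p hp pE] := inj_lift (inc_inj (i + 1)) (hom_d i) im.
  exists p => //; split=> //; apply/limg_fullP => y.
  have : inc (i + 1) y \in limg (d i).
    by rewrite (hd i).2 -inc_im memv_img ?memvf.
  case/memv_imgP=> x _; rewrite -pE => eq; exists x.
  by have [_ /lker0_inj inj] := inc_inj (i + 1); apply: inj.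
have ses_cosyz Y i (f : 'Hom(Y, P i)) : injective_hom f -> limg f = lker (d i) ->
    exists p : 'Hom(P i, K (i + 1)),
    ses f p /\ forall x, inc (i + 1) (p x) = d i x.
  move=> jf fi; have [p sp pE] := cosyzP i; exists p; split=> //; split=> //.
  rewrite fi; apply/vspaceP => x; rewrite !memv_ker -pE.
  have [_ /lker0_eq0 inj] := inc_inj (i + 1).
  by apply/eqP/eqP => [/inj|->]; last exact: linear0.
have ses_syz Y i (f : 'Hom(Y, P (i + 1))) :
    injective_hom f -> limg f = lker (d (i + 1)) ->
    exists p : 'Hom(P i, Y), ses (inc i) p.
  move=> jf fi.
  have im x : exists y, d i x = f y.
    suff /memv_imgP[y _ ->] : d i x \in limg f by exists y.
    by rewrite fi -(hd i).2 memv_img ?memvf.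
  have [p hp pE] := inj_lift jf (hom_d i) im.
  have [_ /lker0_inj inj] := jf.
  exists p; split=> //.
    split=> //; apply/limg_fullP => y.
    have : f y \in limg (d i) by rewrite (hd i).2 -fi memv_img ?memvf.
    by case/memv_imgP=> x _; rewrite -pE => /inj eq; exists x.
  rewrite inc_im; apply/vspaceP => x; rewrite !memv_ker -pE.
  apply/eqP/eqP => [fx|->]; last exact: linear0.
  by apply: inj; rewrite fx linear0.
exists C; split; last by exists 1, e.
  split=> Y [i [f [jf fi]]].
    have [j Ej] := pred_ex i; subst i; have [p S] := ses_syz _ _ _ jf fi.
    by exists (K j) => //; exists (P j), (inc j), p.
  have [p [S _]] := ses_cosyz _ _ _ jf fi.
  by exists (K (i + 1)) => //; exists (P i), f, p.
move=> Y [i [f [jf fi]]].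
(* With [i = l + 3], a map [g] on the syzygy [K (l + 2)] of [Y] is composed with
   [P (l + 1) -> K (l + 2)]. The result kills the image of [d l], so exactness of the dual complex
   factors it through [d (l + 1)]. *)
have [j Ej] := pred_ex i; have [m Em] := pred_ex j; have [l El] := pred_ex m.
subst m j i; have [p S] := ses_syz _ _ _ jf fi.
apply: (ext10I S) => // g hg; have [q sq qE] := cosyzP (l + 1).
have [hq _] := sq.
have : ((g \o q) \o d l = 0)%VF.
  apply/lfunP => x; rewrite !lfE; suff -> : q (d l x) = 0 by rewrite linear0.
  have [_ /lker0_eq0 inj] := inc_inj (l + 1 + 1); apply: inj; rewrite qE.
  by apply/eqP; rewrite -memv_ker -(hd l).2 memv_img ?memvf.
case/(dG l (g \o q)%VF (hom_comp hg hq)) => h hh hE; exists h => // y.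
have [_ /limg_fullP sur] := sq; have [x ->] := sur y.
by move/lfunP/(_ x): hE; rewrite !lfE qE => ->.
Qed.

Lemma int_syz_sequence C M : stable C -> C M ->
  exists Z : int -> fdmod G, [/\ Z 0 = M, forall i, C (Z i) &
    forall i, syz (Z i) (Z (i + 1))].
Proof.
move=> [Cs Cc] CM; pose T := {X | C X}.
have nextP (X : T) : {Y : T | syz (sval X) (sval Y)}.
  apply: constructive_indefinite_description.
  by have [Y CY] := Cc _ (svalP X); exists (exist _ Y CY).
have prevP (X : T) : {Y : T | syz (sval Y) (sval X)}.
  apply: constructive_indefinite_description.
  by have [Y CY] := Cs _ (svalP X); exists (exist _ Y CY).
pose next (X : T) := sval (nextP X); pose prev (X : T) := sval (prevP X).
pose T0 : T := exist _ M CM.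
(* [Negz n] stands for [- (n + 1)], whence [n.+1] steps to the left. *)
exists (fun i => match i with
  | Posz n => sval (iter n next T0) | Negz n => sval (iter n.+1 prev T0) end).
split=> // [[n|n]|[n|[|n]]]; [exact: svalP | exact: svalP | ..].
- by rewrite -PoszD addn1 iterS; apply: (svalP (nextP _)).
- exact: (svalP (prevP _)).
have -> : Negz n.+1 + 1 = Negz n.
  by rewrite !NegzE -[n.+2]addn1 PoszD opprD subrK.
by rewrite [iter n.+2 _ _]iterS; apply: (svalP (prevP _)).
Qed.

(** The complex is spliced from sequences [Z i -> Q i -> Z (i + 1)] of members of [C]; exactness of
    its dual is the vanishing of [Ext^1] from the [Z i] into [G]. *)
Lemma stable_Gproj C M : stable C -> perp C (regmod G) -> C M -> Gproj M.
Proof.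
move=> sC pC CM; have [Z0 [Z0M CZ0 sZ0]] := int_syz_sequence sC CM.
(* Shifted by one place, because [Gproj] asks for [M] as the kernel of [d 1]. *)
pose Z i := Z0 (i - 1).
have CZ i : C (Z i) by exact: CZ0.
have sZ i : syz (Z i) (Z (i + 1)).
  by have := sZ0 (i - 1); rewrite subrK /Z addrK.
have Z1 : Z 1 = M by rewrite /Z subrr.
case: M / Z1 {CM Z0M}.
pose Q i := sval (constructive_indefinite_description _ (sZ i)).
have uE i := svalP (constructive_indefinite_description _ (sZ i)).
pose u i := sval (constructive_indefinite_description _ (uE i)).
have pE i := svalP (constructive_indefinite_description _ (uE i)).
pose p i := sval (constructive_indefinite_description _ (pE i)).
have [pQ S] : (forall i, projective_mod (Q i)) /\ (forall i, ses (u i) (p i)).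
  by split=> i; have [] := svalP (constructive_indefinite_description _ (pE i)).
have hu i := ses_hom1 (S i); have hp i := ses_hom2 (S i).
have inj i := ses_inj (S i).
exists Q, (fun i => u (i + 1) \o p i)%VF; split=> // [i|i f hf|].
- split; first homs.
  apply/limg_lkerP; split=> [x|y].
    by rewrite !lfE (ses0 (S _)) linear0.
  rewrite lfE => uy; have /(ses_ex (S _))[x ->] : p (i + 1) y = 0.
    by apply: inj; rewrite uy linear0.
  have [z ->] := ses_sur (S i) x.
  by exists z; rewrite lfE.
- split=> [fd|[h hh ->]]; last first.
    by apply/lfunP => x; rewrite !lfE (ses0 (S _)) !linear0.
  have fu x : f (u (i + 1) x) = 0.
    have [y ->] := ses_sur (S i) x.
    by move/lfunP/(_ y): fd; rewrite !lfE.
  have [g hg gE] := ses_factor (S _) hf fu.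
  have [h hh hE] := ext10E (S (i + 1 + 1)) (pC _ (CZ _)) hg.
  by exists h => //; apply/lfunP => x; rewrite !lfE hE gE.
exists (u 1); first by have [] := S 1.
apply/limg_lkerP; split=> [x|y]; first by rewrite !lfE (ses0 (S _)) linear0.
by rewrite lfE => uy; apply: (ses_ex (S _)); apply: inj; rewrite uy linear0.
Qed.

Lemma perp_quot C L M N (v : 'Hom(L, M)) (q : 'Hom(M, N)) :
  (forall X, C X -> exists2 Y, C Y & syz Y X) ->
  ses v q -> perp C M -> perp C L -> perp C N.
Proof.
move=> Cs T CM CL X CX; have [Y CY YX] := Cs X CX.
exact: ext10_quot YX T (CM _ CX) (CL _ CY).
Qed.

Lemma perp_sub C L M N (v : 'Hom(L, M)) (q : 'Hom(M, N)) :
  (forall X, C X -> exists2 Y, C Y & syz X Y) ->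
  ses v q -> perp C M -> perp C N -> perp C L.
Proof.
move=> Cc T CM CN X CX; have [Y CY XY] := Cc X CX.
exact: ext10_sub XY T (CM _ CX) (CN _ CY).
Qed.

Lemma Gproj_is_stable : stable (@Gproj k G).
Proof.
by split=> X /Gproj_stable[C [sC pC CX]];
  [have [Y CY S] := sC.1 X CX | have [Y CY S] := sC.2 X CX];
  exists Y => //; apply: (stable_Gproj sC pC CY).
Qed.

Lemma Gproj_perp : perp (@Gproj k G) (regmod G).
Proof. by move=> X /Gproj_stable[C [_ pC CX]]; apply: pC. Qed.

Lemma Gproj_torsionless X : Gproj X -> torsionless X.
Proof.
move=> /Gproj_is_stable.2[Y _ [Q [u [p [pQ [iu _ _]]]]]].
exact: torsionless_sub (torsionless_proj pQ) iu.
Qed.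

Lemma proj_Gproj P : projective_mod P -> Gproj P.
Proof.
have stab0 g : (mact P g @: (0 : {vspace P}) <= 0)%VS by rewrite limg0.
have stab (M : fdmod G) g : (mact M g @: (0 : {vspace M}) <= 0)%VS.
  by rewrite limg0.
pose O := submod (stab (regmod G)).
have O0 (x : O) : x = 0.
  by apply: val_inj; apply/eqP; rewrite -memv0 subvsP.
have pO : projective_mod O.
  move=> M N p f _ _; exists 0; first homs.
  by apply/lfunP => x; rewrite (O0 x) !linear0.
have S1 (M : fdmod G) : ses (0 : 'Hom(O, M)) (\1%VF : 'Hom(M, M)).
  apply/sesP; split; [homs | homs | exists 0, \1%VF].
  by split=> x; rewrite ?lfE ?linear0 ?add0r //; rewrite (O0 x).
have S2 (M : fdmod G) : ses (\1%VF : 'Hom(M, M)) (0 : 'Hom(M, O)).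
  apply/sesP; split; [homs | homs | exists \1%VF, 0].
  by split=> x; rewrite ?lfE ?linear0 ?addr0 //; rewrite (O0 x).
apply: (@stable_Gproj (@projective_mod k G)).
- split=> X pX; exists O => //; first by exists X, 0, \1%VF.
  by exists X, \1%VF, 0.
by move=> X; apply: ext10_projl.
Qed.

(** * Retracts in the stable category *)

Section StableRetract.
Variable C : fdmod G -> Prop.
Hypothesis sC : stable C.
Hypothesis pC : perp C (regmod G).

(* [Y] is a retract of a module of [C] in the stable category, in which the
   homomorphisms that factor through a projective module vanish. *)
Let C' Y : Prop := exists Z Q (i : 'Hom(Y, Z)) (r : 'Hom(Z, Y))
    (s : 'Hom(Y, Q)) (t : 'Hom(Q, Y)),
  [/\ C Z, projective_mod Q, ishom i /\ ishom r, ishom s /\ ishom t &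
      forall y, y = r (i y) + t (s y)].

Lemma stable_retract_ext Y M : C' Y -> perp C M -> ext10 Y M.
Proof.
move=> [Z [Q [i [r [s [t [CZ pQ [hi hr] [hs ht] E]]]]]]] CM.
move=> N N' v q g T hg.
have [h hh qh] := CM Z CZ _ _ _ _ _ T (hom_comp hg hr).
have [h' hh' qh'] := ext10_projl pQ T (hom_comp hg ht).
exists ((h \o i)%VF + (h' \o s)%VF); first homs.
by move=> y; rewrite !lfE linearD /= qh qh' !lfE -linearD -E.
Qed.

(** [a] and [b] lift [i] and [r] to the projective terms and induce [a'] and [b'] on the syzygies.
    The difference of the identity and [b \o a], corrected by the part [c] through [Q], is killed by
    [p]; it takes values in [K], and so writes [1 - b' \o a'] as a map through [R]. *)
Lemma stable_retract_syz K X : C' X -> syz K X -> C' K.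
Proof.
move=> [Z [Q [i [r [s [t [CZ pQ [hi hr] [hs ht] E]]]]]]].
move=> [R [u [p [pR S]]]]; have [Z1 CZ1 [Q1 [u1 [p1 [pQ1 S1]]]]] := sC.1 Z CZ.
have hu := ses_hom1 S; have hp := ses_hom2 S.
have hu1 := ses_hom1 S1; have hp1 := ses_hom2 S1.
have [_ sp _] := S; have [_ sp1 _] := S1.
have [a ha pa] := proj_lift pR sp1 (hom_comp hi hp).
have [b hb pb] := proj_lift pQ1 sp (hom_comp hr hp1).
have [c hc pc] := proj_lift pQ sp ht.
have [||a' ha' ua'] := ses_lift S1 (f := (a \o u)%VF); first homs.
  by move=> x; rewrite !lfE pa lfE (ses0 S) linear0.
have [||b' hb' ub'] := ses_lift S (f := (b \o u1)%VF); first homs.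
  by move=> x; rewrite !lfE pb lfE (ses0 S1) linear0.
have [||h hh uh] := ses_lift S (f := \1%VF - (b \o a)%VF - (c \o (s \o p))%VF).
- homs.
- move=> x; rewrite !lfE !linearB /= pb pc !lfE pa lfE {1}(E (p x)).
  by rewrite addrAC addrK subrr.
exists Z1, R, a', b', u, h; split=> // x.
apply: (ses_inj S); rewrite linearD /= uh ub' !lfE ua' lfE (ses0 S).
by rewrite !linear0 addr0 addrC subrK.
Qed.

(** Dual to [stable_retract_syz]: maps are extended along [u] and [u1] to projective targets, into
    which [Ext^1] from [Y] and from [Z1] vanishes. *)
Lemma stable_retract_cosyz X Y : C' X -> syz X Y -> ext10 Y (regmod G) -> C' Y.
Proof.
move=> [Z [Q [i [r [s [t [CZ pQ [hi hr] [hs ht] E]]]]]]].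
move=> [R [u [p [pR S]]]] YG.
have [Z1 CZ1 [Q1 [u1 [p1 [pQ1 S1]]]]] := sC.2 Z CZ.
have hu := ses_hom1 S; have hp := ses_hom2 S.
have hu1 := ses_hom1 S1; have hp1 := ses_hom2 S1.
have ZG := pC CZ1.
have [a ha au] := ext10E S (ext10_projr YG pQ1) (hom_comp hu1 hi).
have [b hb bu] := ext10E S1 (ext10_projr ZG pR) (hom_comp hu hr).
have [c hc cu] := ext10E S (ext10_projr YG pQ) hs.
have [||a' ha' ap] := ses_factor S (f := (p1 \o a)%VF); first homs.
  by move=> x; rewrite !lfE au lfE (ses0 S1).
have [||b' hb' bp] := ses_factor S1 (f := (p \o b)%VF); first homs.
  by move=> x; rewrite !lfE bu lfE (ses0 S).
have [||h hh hE] := ses_factor S (f := \1%VF - (b \o a)%VF - (u \o (t \o c))%VF).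
- homs.
- move=> x; rewrite !lfE cu au !lfE bu lfE {1}(E x) linearD /=.
  by rewrite addrAC addrK subrr.
exists Z1, R, a', b', h, p; split=> // y; have [x ->] := ses_sur S y.
rewrite hE ap lfE bp !lfE !linearB /= (ses0 S) subr0.
by rewrite addrC subrK.
Qed.

Lemma stable_retract_torsionless Y : C' Y -> torsionless Y.
Proof.
move=> [Z [Q [i [r [s [t [CZ pQ [hi hr] [hs ht] E]]]]]]] y fy.
have [Z1 CZ1 [Q1 [u1 [p1 [pQ1 S1]]]]] := sC.2 Z CZ; have [iu _ _] := S1.
have tZ := torsionless_sub (torsionless_proj pQ1) iu.
rewrite (E y) (tZ (i y)); last by move=> f hf; rewrite -comp_lfunE fy //; homs.
rewrite (torsionless_proj pQ (x := s y)) ?linear0 ?addr0 //.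
by move=> f hf; rewrite -comp_lfunE fy //; homs.
Qed.

Lemma stable_retract_stable : stable C'.
Proof.
split=> X CX.
  by have [Y YX] := syz_ex X; exists Y => //; apply: stable_retract_syz CX _.
(* The cokernel of a left approximation is a cosyzygy with no [Ext^1] into [G]; the approximation is
   injective because [X] is torsionless. *)
have [V [f [hf fG]]] := left_approx X.
have jf := torsionless_inj (stable_retract_torsionless CX) hf fG.
have [Y [p S]] := cokernel_ses jf; have XY : syz X Y.
  by exists (free_mod G V), f, p; split=> //; apply: free_proj.
exists Y => //; apply: stable_retract_cosyz CX XY _.
by apply: (ext10I S) => //; apply: free_proj.
Qed.

Lemma stable_retract_Gproj Y : C' Y -> Gproj Y.
Proof.
apply: stable_Gproj stable_retract_stable _.
by move=> X CX; apply: stable_retract_ext CX pC.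
Qed.

Lemma stable_retract_refl X : C X -> C' X.
Proof.
move=> CX; have [Q pQ] : exists Q, projective_mod Q.
  by exists (free_mod G G); apply: free_proj.
exists X, Q, \1%VF, \1%VF, 0, 0; split=> //; try by split; homs.
by move=> y; rewrite !lfE addr0.
Qed.

End StableRetract.

(** A retract is in particular a stable one, with [s = t = 0]; this covers direct summands as well
    as isomorphic copies. *)
Lemma Gproj_iso M N (f : 'Hom(M, N)) (g : 'Hom(N, M)) :
  ishom f -> ishom g -> (forall x, g (f x) = x) -> Gproj N -> Gproj M.
Proof.
move=> hf hg gf GN; apply: (stable_retract_Gproj Gproj_is_stable Gproj_perp).
have [Q pQ] : exists Q, projective_mod Q.
  by exists (free_mod G G); apply: free_proj.
exists N, Q, f, g, 0, 0; split=> //; try by split; homs.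
by move=> y; rewrite !lfE addr0 gf.
Qed.

Lemma Gproj_syz Y X : syz Y X -> Gproj X -> Gproj Y.
Proof.
move=> YX GX; apply: (stable_retract_Gproj Gproj_is_stable Gproj_perp).
apply: stable_retract_syz YX; first exact: Gproj_is_stable.
exact: stable_retract_refl.
Qed.

Lemma Gproj_cosyz X Y : syz X Y -> ext10 Y (regmod G) -> Gproj X -> Gproj Y.
Proof.
move=> XY YG GX; apply: (stable_retract_Gproj Gproj_is_stable Gproj_perp).
apply: stable_retract_cosyz XY YG => //; [exact: Gproj_is_stable | exact: Gproj_perp |].
exact: stable_retract_refl.
Qed.

(** * Finite injective and projective dimension *)

Inductive fid : fdmod G -> Prop :=
| fid_inj I : injective_mod I -> fid I
| fid_ses M I N (u : 'Hom(M, I)) (q : 'Hom(I, N)) :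
    injective_mod I -> ses u q -> fid N -> fid M.

Inductive fpd : fdmod G -> Prop :=
| fpd_proj P : projective_mod P -> fpd P
| fpd_ses Y P X (u : 'Hom(Y, P)) (q : 'Hom(P, X)) :
    projective_mod P -> ses u q -> fpd Y -> fpd X.

(** The coresolution is cut into [K i -> I i -> K i.+1], and [fid] is carried down from [K n.+1 = 0]
    to [M]. *)
Lemma finite_injdim_fid M : finite_injdim M -> fid M.
Proof.
case=> n [I [e [d [[iI zI] ie hd eM dd]]]].
pose K i := ker_mod (hd i); pose inc i : 'Hom(K i, I i) := incl (lker (d i)).
have inc_inj i : injective_hom (inc i).
  by split; [exact: incl_hom | exact: lker_incl].
have sesK X i (f : 'Hom(X, I i)) : injective_hom f -> limg f = lker (d i) ->
    exists p : 'Hom(I i, K i.+1), ses f p.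
  move=> jf fi.
  have im x : exists y, d i x = inc i.+1 y.
    suff /memv_imgP[y _ ->] : d i x \in limg (inc i.+1) by exists y.
    by rewrite limg_incl -dd memv_img ?memvf.
  have [p hp pE] := inj_lift (inc_inj i.+1) (hd i) im.
  have [_ /lker0_inj inj] := inc_inj i.+1.
  exists p; split=> //.
    split=> //; apply/limg_fullP => y.
    have : inc i.+1 y \in limg (inc i.+1) by rewrite memv_img ?memvf.
    rewrite limg_incl -dd => /memv_imgP[x _].
    by rewrite -pE => /inj eq; exists x.
  rewrite fi; apply/vspaceP => x; rewrite !memv_ker -pE.
  apply/eqP/eqP => [dx|->]; last exact: linear0.
  by apply: inj; rewrite dx linear0.
have K0 (x : K n.+1) : x = 0.
  by apply: val_inj; have z := zI n.+1 (ltnSn n); rewrite [LHS]z [RHS]z.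
(* [j] counts from the right end; past [n] the truncated difference stays at [0]. *)
have fidK j : fid (K (n.+1 - j)%N).
  elim: j => [|j IH].
    rewrite subn0; apply: fid_inj => X Y i f _ _; exists 0; first homs.
    by apply/lfunP => x; rewrite [LHS]K0 [RHS]K0.
  have [jn|nj] := ltnP n j.
    by have -> : (n.+1 - j.+1)%N = (n.+1 - j)%N by lia.
  have E : (n.+1 - j)%N = (n.+1 - j.+1).+1 by lia.
  have [p S] := sesK _ _ _ (inc_inj (n.+1 - j.+1)%N) (limg_incl _).
  by apply: (fid_ses (iI _) S); rewrite -E.
have [p S] := sesK _ _ _ ie eM; apply: (fid_ses (iI _) S).
by have := fidK n; rewrite subSnn.
Qed.

(** Each [X] in [C] is an [n]-th syzygy of some member, for every [n], so [Ext^1(X, M)] is an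
    [Ext^{n+1}] and vanishes beyond the injective dimension of [M]. *)
Lemma fid_perp C M :
  (forall X, C X -> exists2 Y, C Y & syz X Y) -> fid M -> perp C M.
Proof.
move=> Cc; elim=> [I iI X _|L I N u q iI S _]; first exact: ext10_inj.
by apply: perp_sub Cc S _ => X _; apply: ext10_inj.
Qed.

(** All [Ext^i(X, P)] with [i >= 1] and [P] projective vanish, and a finite projective resolution of
    [M] shifts [Ext^1(X, M)] into these groups. *)
Lemma fpd_perp C M :
  (forall X, C X -> exists2 Y, C Y & syz Y X) -> perp C (regmod G) ->
  fpd M -> perp C M.
Proof.
move=> Cs pC; have pP P : projective_mod P -> perp C P.
  by move=> pP X CX; apply: ext10_projr pP; apply: pC.
elim=> [P /pP//|Y P X u q /pP CP S _].
exact: perp_quot Cs S CP.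
Qed.

Lemma syz_syzygy X n : syz (syzygy X n.+1) (syzygy X n).
Proof.
exists (free_mod G (syzygy X n)), (incl (lker (free_cover (syzygy X n)))),
  (free_cover (syzygy X n)); split; first exact: free_proj.
split; [|exact: free_cover_sur | exact: limg_incl].
by split; [exact: incl_hom | exact: lker_incl].
Qed.

Lemma fid_ext10_syzygy M : fid M ->
  exists n, forall X j, (n <= j)%N -> ext10 (syzygy X j) M.
Proof.
elim=> [I iI|L I N u q iI S _ [n nN]].
  by exists 0%N => X j _; apply: ext10_inj.
exists n.+1 => X [//|j] nj; apply: ext10_sub (syz_syzygy X j) S _ (nN _ _ nj).
exact: ext10_inj.
Qed.

End GorensteinProjective.

(** * Duality *)

Section VectorDuality.
Variable k : fieldType.
Implicit Types U V W : vectType k.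

Definition cofun V (i : 'I_(\dim {:V})) : 'Hom(V, k^o) :=
  linfun (fun v => coord (vbasis {:V}) i v : k^o).
Lemma cofunE V i (v : V) : cofun i v = coord (vbasis {:V}) i v.
Proof. by apply: linfunEl => c x y; rewrite linearP. Qed.

Lemma functional_sep V (v : V) : (forall f : 'Hom(V, k^o), f v = 0) -> v = 0.
Proof.
move=> fv; rewrite (coord_vbasis (memvf v)); apply: big1 => i _.
by rewrite -cofunE fv scale0r.
Qed.

Definition evm V : 'Hom(V, 'Hom('Hom(V, k^o), k^o)) :=
  curry (fun v (f : 'Hom(V, k^o)) => f v).

Lemma evmE V v f : evm V v f = f v.
Proof.
apply: curryE; split=> [g c x y|x c g h]; first by rewrite linearP.
by rewrite !lfE.
Qed.

Lemma evm_sur V Phi : exists v : V, Phi = evm V v.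
Proof.
exists (\sum_(i < \dim {:V}) Phi (cofun i) *: (vbasis {:V})`_i).
apply/lfunP => f; rewrite evmE linear_sum /=.
have {1}-> : f = \sum_(i < \dim {:V}) f ((vbasis {:V})`_i) *: cofun i.
  apply/lfunP => v; rewrite {1}(coord_vbasis (memvf v)) linear_sum sum_lfunE.
  by apply: eq_bigr => i _; rewrite !lfE cofunE linearZ; apply: mulrC.
rewrite linear_sum; apply: eq_bigr => i _.
by rewrite !linearZ; apply: mulrC.
Qed.

Lemma evmK V Phi (f : 'Hom(V, k^o)) : f ((evm V)^-1%VF Phi) = Phi f.
Proof.
by have [v ->] := evm_sur Phi; rewrite -evmE limg_lfunVK // memv_img ?memvf.
Qed.

Definition precomp U V W (f : 'Hom(U, V)) : 'Hom('Hom(V, W), 'Hom(U, W)) :=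
  linfun (fun g : 'Hom(V, W) => g \o f)%VF.

Lemma precompE U V W (f : 'Hom(U, V)) (g : 'Hom(V, W)) x :
  precomp W f g x = g (f x).
Proof.
by rewrite linfunEl ?lfE // => c h h'; rewrite comp_lfunDl comp_lfunZl.
Qed.

Lemma functional_extend U V (u : 'Hom(U, V)) (f : 'Hom(U, k^o)) :
  (forall x, u x = 0 -> f x = 0) ->
  exists g : 'Hom(V, k^o), forall x, g (u x) = f x.
Proof.
move=> uf; exists (f \o u^-1)%VF => x; rewrite lfE.
apply/eqP; rewrite -subr_eq0 -linearB /=; apply/eqP/uf.
by rewrite linearB /= limg_lfunVK ?subrr // memv_img ?memvf.
Qed.

Lemma functional_sub V (U : {vspace V}) v :
  (forall f : 'Hom(V, k^o), (forall x, x \in U -> f x = 0) -> f v = 0) -> v \in U.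
Proof.
move=> fv; have qv : qproj U v = 0.
  apply: functional_sep => f; rewrite -comp_lfunE; apply: fv => x Ux.
  by rewrite comp_lfunE qproj0 ?linear0.
by have := qprojK U v; rewrite qv linear0 subr0.
Qed.

End VectorDuality.

Section ModuleDuality.
Variables (k : fieldType) (G : falgType k).
Implicit Types (E F L M N P Q X Y Z I : fdmod G).

Definition ldual (V : rfdmod G) : fdmod G := premod V k^o.

Lemma dualE (S : fdmod G) (b : G) (f : 'Hom(S, k^o)) s :
  (mact (dual S) b f : 'Hom(S, k^o)) s = f (mact S b s).
Proof.
have -> : mact (dual S) b = dual_act S b by exact: (linfunEl (@dual_act_linear _ _ S)).
exact: dual_actE.
Qed.

Lemma ldual_ses (L M N : rfdmod G) (u : 'Hom(L, M)) (q : 'Hom(M, N)) :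
  ses u q -> @ses k G (ldual N) (ldual M) (ldual L) (precomp k^o q) (precomp k^o u).
Proof.
move=> /sesP[hu hq [r [s [ru qs us qu]]]]; apply/sesP; split.
- by move=> g f; apply/(@lfunP _ M k^o) => x; rewrite !(premodE, precompE) hq.
- by move=> g f; apply/(@lfunP _ L k^o) => x; rewrite !(premodE, precompE) hu.
exists (precomp k^o s), (precomp k^o r).
split=> f; apply/(@lfunP _ _ k^o) => x.
- by rewrite !precompE qs.
- by rewrite !precompE ru.
- by rewrite add_lfunE !precompE -linearD addrC us.
by rewrite !precompE qu !linear0 lfE.
Qed.

(* Dualising a surjection from a free module onto [D(I)] gives an injection
   of [I], which splits; so [D(I)] is a retract of the free module. *)
Lemma ldual_inj_proj (I : rfdmod G) : injective_mod I -> projective_mod (ldual I).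
Proof.
move=> iI; pose F := free_mod G (ldual I).
pose p : 'Hom(F, ldual I) := free_cover (ldual I).
have [hp /limg_fullP sp] : surjective_hom p by exact: free_cover_sur.
pose pt : 'Hom(I, dual F) := curry (fun i (x : F) => (p x : 'Hom(I, k^o)) i).
have ptE i x : (pt i : 'Hom(F, k^o)) x = (p x : 'Hom(I, k^o)) i.
  apply: curryE; split=> [y c i1 i2|y c i1 i2]; first by rewrite linearP.
  by rewrite linearP !lfE.
have pt_inj : @injective_hom _ _ I (dual F) pt.
  split=> [g i|].
    by apply/(@lfunP _ F k^o) => x; rewrite dualE !ptE hp premodE.
  apply/lker0_eq0 => i pti; apply: functional_sep => f.
  by have [x ->] := sp f; rewrite -ptE pti lfE.
have [r hr rpt] := inj_extend iI pt_inj (@hom_one _ _ I).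
pose s : 'Hom(ldual I, F) := ((evm F)^-1 \o precomp k^o r)%VF.
have sE (f : 'Hom(I, k^o)) (h : 'Hom(F, k^o)) : h (s f) = f (r h).
  by rewrite comp_lfunE evmK precompE.
apply: (@proj_retract _ _ F _ s p); [exact: free_proj | | exact: hp |].
  move=> g f; apply/eqP; rewrite -subr_eq0; apply/eqP/functional_sep => h.
  rewrite linearB /= sE -[h _]dualE sE premodE.
  by rewrite (hr g h) subrr.
move=> f; apply/(@lfunP _ I k^o) => i.
by rewrite -ptE sE rpt lfE.
Qed.

Lemma fid_ldual (V : rfdmod G) : fid V -> fpd (ldual V).
Proof.
elim=> [I iI|M I N u q iI S _ IH]; first by apply: fpd_proj; apply: ldual_inj_proj.
by apply: fpd_ses (ldual_ses S) IH; apply: ldual_inj_proj.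
Qed.

Lemma Gorenstein_fid : Gorenstein G -> fid (regmod G).
Proof. by case=> /finite_injdim_fid. Qed.

Lemma Gorenstein_fpd : Gorenstein G -> fpd (ldual (regmod (opalg G))).
Proof. by case=> _ /finite_injdim_fid; apply: fid_ldual. Qed.

(* [Ext^i_G(X, G) = 0] for all [i >= 1]. *)
Let ext_acyclic X : Prop := exists D : fdmod G -> Prop,
  [/\ forall Y, D Y -> exists2 Z, D Z & syz Z Y, perp D (regmod G) & D X].

(** Functionals on [X] correspond to maps from [X] to [D G]. As [D G] has finite projective
    dimension, such a map lifts to a projective module over [D G], whose elements are detected by
    maps to [G]; hence an element killed by all maps to [G] is killed by all functionals. *)
Lemma ext_acyclic_torsionless X :
  Gorenstein G -> ext_acyclic X -> torsionless X.
Proof.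
have cover T : fpd T -> ext_acyclic X -> forall g : 'Hom(X, T), ishom g ->
    exists P (p : 'Hom(P, T)) (h : 'Hom(X, P)),
    [/\ projective_mod P, ishom h & forall y, g y = p (h y)].
  case=> {T} [P pP|Y P T u q pP S fY] [D [Ds DG DX]] g hg.
    by exists P, \1%VF, g; split=> // y; rewrite lfE.
  have [h hh qh] := fpd_perp Ds DG fY DX S hg.
  by exists P, q, h; split=> // y; rewrite qh.
move=> /Gorenstein_fpd fD aX x fx; apply: functional_sep => f.
pose g : 'Hom(X, ldual (regmod (opalg G))) := cofree_lift f.
have gx1 : (g x : 'Hom(G, k^o)) 1 = f x.
  by rewrite [LHS](@cofree_liftE _ _ X k^o) mact1 lfE.
have hg : ishom g by exact: cofree_lift_hom.
suff gx : g x = 0 by rewrite -gx1 gx lfE.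
have [P [p [h [pP hh ->]]]] := cover _ fD aX g hg.
rewrite (torsionless_proj pP (x := h x)) ?linear0 // => l hl.
by rewrite -comp_lfunE fx //; homs.
Qed.

Lemma ext_acyclic_Gproj X : Gorenstein G -> ext_acyclic X -> Gproj X.
Proof.
move=> GG; apply: stable_Gproj; last by move=> Y [D [_ DG DY]]; apply: DG.
split=> Y aY; have [D [Ds DG DY]] := aY.
  by have [Z DZ ZY] := Ds Y DY; exists Z => //; exists D.
have [V [f [hf fG]]] := left_approx Y.
have jf := torsionless_inj (ext_acyclic_torsionless GG aY) hf fG.
have [Z [p S]] := cokernel_ses jf; have YZ : syz Y Z.
  by exists (free_mod G V), f, p; split=> //; apply: free_proj.
(* Adding [Z] keeps the class closed under syzygies, [Y] being one of [Z], and [Ext^1(Z, G) = 0] by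
   the choice of [f]. *)
exists Z => //; exists (fun Z' => D Z' \/ Z' = Z); split; last by right.
  move=> Z' [/Ds[W DW WZ']|->]; first by exists W; [left |].
  by exists Y; [left |].
move=> Z' [/DG//|->]; apply: (ext10I S) => //; exact: free_proj.
Qed.

(** Beyond the injective dimension of [G], the syzygies of [W] have no [Ext] into [G]; they are
    Gorenstein projective, hence projective, and the resolution of [W] stops. *)
Lemma Gorenstein_CMfree_fpd : Gorenstein G -> CMfree G -> forall W : fdmod G, fpd W.
Proof.
move=> GG cm W; have [n nG] := fid_ext10_syzygy (Gorenstein_fid GG).
have : fpd (syzygy W n).
  apply: fpd_proj; apply/cm/ext_acyclic_Gproj => //.
  exists (fun Z => exists2 j, (n <= j)%N & Z = syzygy W j); split.
  - move=> Y [j nj ->]; exists (syzygy W j.+1); last exact: syz_syzygy.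
    by exists j.+1; rewrite // leqW.
  - by move=> Y [j nj ->]; apply: nG.
  by exists n.
elim: {nG} n => // n IH fn; apply: IH.
by have [Q [u [p [pQ S]]]] := syz_syzygy W n; apply: fpd_ses pQ S fn.
Qed.

End ModuleDuality.

(** * Tensor products *)

Section TensorProduct.
Variables (k : fieldType) (G : falgType k).
Implicit Types (M V : rfdmod G) (X Y Z N : fdmod G) (E U W : vectType k).

Definition mt M X (m : M) (x : X) : mtens M X := qproj (tens_rel M X) (tens m x).

Lemma mt_linearr M X m : linear (@mt M X m).
Proof.
by move=> c x y; rewrite /mt; have [_ tr] := @tens_bilinear k M X; rewrite tr linearP.
Qed.
Lemma mt_linearl M X x : linear (fun m => @mt M X m x).
Proof.
by move=> c m n; rewrite /mt; have [tl _] := @tens_bilinear k M X; rewrite tl linearP.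
Qed.

Lemma mt_bal M X (g : G) m x : mt (mact M g m) x = mt m (mact X g x).
Proof.
apply/eqP; rewrite -subr_eq0 -linearB /=; apply/eqP/qproj0.
exact: tens_relP.
Qed.

Lemma mt_ext M X E (f g : 'Hom(mtens M X, E)) :
  (forall m x, f (mt m x) = g (mt m x)) -> f = g.
Proof.
move=> fg; apply: quot_ext => t.
suff /lfunP/(_ t) : (f \o qproj (tens_rel M X) = g \o qproj (tens_rel M X))%VF.
  by rewrite [X in X = _]comp_lfunE [X in _ = X]comp_lfunE.
by apply: tens_ext => m x; rewrite [LHS]comp_lfunE [RHS]comp_lfunE fg.
Qed.

Definition balanced M X E (b : M -> X -> E) : Prop :=
  bilinear_fun b /\ forall (g : G) m x, b (mact M g m) x = b m (mact X g x).

Definition mt_lift M X E (b : M -> X -> E) : 'Hom(mtens M X, E) :=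
  (tlift b \o qsec (tens_rel M X))%VF.

Lemma mt_liftE M X E (b : M -> X -> E) m x :
  balanced b -> mt_lift b (mt m x) = b m x.
Proof.
move=> [bb bal].
have kill t : t \in tens_rel M X -> tlift b t = 0.
  case/memv_sumP=> w wP ->; rewrite linear_sum big1 // => i _ /=.
  have /memv_imgP[s _ ->] := wP i isT; rewrite -comp_lfunE.
  suff -> : (tlift b \o (tmap (mact M (vbasis {:G})`_i) \1%VF -
     tmap \1%VF (mact X (vbasis {:G})`_i)) = 0)%VF by rewrite lfE.
  apply: tens_ext => m' x'.
  by rewrite !lfE !tmapE linearB /= !tliftE // !lfE bal subrr.
rewrite /mt_lift comp_lfunE -(tliftE _ _ bb) /mt.
apply/esym/eqP; rewrite -subr_eq0 -linearB /=; apply/eqP/kill.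
exact: qprojK.
Qed.

Definition mtmap M X Y (f : 'Hom(X, Y)) : 'Hom(mtens M X, mtens M Y) :=
  mtens_map (\1%VF : 'End(M)) f.

Lemma mtmapE M X Y (f : 'Hom(X, Y)) m x :
  ishom f -> mtmap M f (mt m x) = mt m (f x).
Proof.
by move=> hf; rewrite /mtmap /mt mtens_mapE ?lfE //; apply: hom_one.
Qed.

(** Half of the duality [D(D N (x)_G Y) = Hom_G(Y, N)]: [phi] is read as a map from [Y] to the
    bidual of [N]. *)
Lemma dual_adj1 (N : fdmod G) Y (phi : 'Hom(mtens (dual N) Y, k^o)) :
  exists2 g : 'Hom(Y, N), ishom g &
    forall (xi : 'Hom(N, k^o)) y, xi (g y) = phi (@mt (dual N) Y xi y).
Proof.
pose c := curry (fun (y : Y) (xi : 'Hom(N, k^o)) => phi (@mt (dual N) Y xi y)).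
have cE y xi : c y xi = phi (@mt (dual N) Y xi y).
  apply: curryE; split=> [xi' a y1 y2|y' a x1 x2].
    by rewrite mt_linearr linearP.
  by rewrite (mt_linearl (M := dual N)) linearP.
have gE (xi : 'Hom(N, k^o)) y : xi (((evm N)^-1 \o c)%VF y) = phi (@mt (dual N) Y xi y).
  by rewrite comp_lfunE evmK cE.
exists ((evm N)^-1 \o c)%VF => // g y.
apply/eqP; rewrite -subr_eq0; apply/eqP/functional_sep => xi.
by rewrite linearB /= gE -mt_bal -[X in _ - X]dualE gE subrr.
Qed.

Lemma dual_adj2 (N : fdmod G) Y (g : 'Hom(Y, N)) : ishom g ->
  exists phi : 'Hom(mtens (dual N) Y, k^o),
    forall (xi : 'Hom(N, k^o)) y, phi (@mt (dual N) Y xi y) = xi (g y).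
Proof.
move=> hg; exists (mt_lift (fun (xi : dual N) (y : Y) => (xi : 'Hom(N, k^o)) (g y))).
move=> xi y; apply: (mt_liftE (M := dual N)); split.
  split=> [z c x1 x2|z c y1 y2]; first by rewrite !lfE.
  by rewrite !linearP.
by move=> b z x; rewrite hg dualE.
Qed.

(** By duality the identity of [Y] is a functional on [D Y (x)_G Y]. Injectivity of [D Y (x)_G f]
    extends it to [D Y (x)_G Z], where it corresponds to a retraction of [f]. *)
Lemma mt_inj_retract Y Z (f : 'Hom(Y, Z)) :
  ishom f -> (forall M, injective (mtmap M f)) ->
  exists2 r : 'Hom(Z, Y), ishom r & forall y, r (f y) = y.
Proof.
move=> hf fi; have [phi phiE] := dual_adj2 (@hom_one _ _ Y).
have [|psi psiE] := @functional_extend _ _ _ (mtmap (dual Y) f) phi.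
  by move=> x fx; rewrite (_ : x = 0) ?linear0 //; apply: (fi (dual Y)); rewrite fx linear0.
have [r hr rE] := dual_adj1 psi; exists r => // y.
apply/eqP; rewrite -subr_eq0; apply/eqP/functional_sep => xi.
by rewrite linearB /= rE -(mtmapE _ _ hf) psiE phiE lfE subrr.
Qed.

End TensorProduct.

(** * Modules over [A (x) B] *)

Section TensorAlgebraModules.
Variables (k : fieldType) (A B : falgType k).
Local Notation L := (talg A B).
Implicit Types (X Y Z P Q : fdmod L) (E : vectType k).

Lemma atens_linear1 (b : B) : linear (fun a : A => atens a b).
Proof. by have [tl _] := @tens_bilinear k A B; apply: tl. Qed.
Lemma atens_linear2 (a : A) : linear (fun b : B => atens a b).
Proof. by have [_ tr] := @tens_bilinear k A B; apply: tr. Qed.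

Lemma talg_hom X Y (f : 'Hom(X, Y)) :
  (forall a b x, f (mact X (atens a b) x) = mact Y (atens a b) (f x)) -> ishom f.
Proof.
move=> hf g x; elim/(@tensor_ind k A B): g => [|s t IHs IHt|c s IH|a b].
- by rewrite (linear0 (mact X)) (linear0 (mact Y)) !lfE linear0.
- by rewrite (linearD (mact X)) (linearD (mact Y)) !lfE linearD /= IHs IHt.
- by rewrite (linearZ_LR (mact X)) (linearZ_LR (mact Y)) !lfE linearZ /= IH.
exact: hf.
Qed.

Lemma actAB X a b x :
  mact X (atens a b) x = mact X (atens a 1) (mact X (atens 1 b) x).
Proof. by rewrite -comp_lfunE -mactM talgM mulr1 mul1r. Qed.
Lemma actBA X a b x :
  mact X (atens a b) x = mact X (atens 1 b) (mact X (atens a 1) x).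
Proof. by rewrite -comp_lfunE -mactM talgM mulr1 mul1r. Qed.

Section Restriction.
Variable X : fdmod L.
Definition resB_act (b : B) : 'End(X) := mact X (atens 1 b).
Lemma resB_linear : linear resB_act.
Proof. by move=> c b b'; rewrite /resB_act atens_linear2 linearP. Qed.
Lemma resB_act1 : linfun resB_act 1 = \1%VF.
Proof. by rewrite (linfunEl resB_linear) /resB_act -talg1 mact1. Qed.
Lemma resB_actM b b' :
  linfun resB_act (b * b') = (linfun resB_act b \o linfun resB_act b')%VF.
Proof. by rewrite !(linfunEl resB_linear) /resB_act -mactM talgM mulr1. Qed.
Definition resB : fdmod B := FDMod resB_act1 resB_actM.
Lemma resBE b x : mact resB b x = mact X (atens 1 b) x.
Proof.
by have -> : mact resB b = resB_act b by exact: (linfunEl resB_linear).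
Qed.

Definition resA_act (a : A) : 'End(X) := mact X (atens a 1).
Lemma resA_linear : linear resA_act.
Proof. by move=> c b b'; rewrite /resA_act atens_linear1 linearP. Qed.
Lemma resA_act1 : linfun resA_act 1 = \1%VF.
Proof. by rewrite (linfunEl resA_linear) /resA_act -talg1 mact1. Qed.
Lemma resA_actM b b' :
  linfun resA_act (b * b') = (linfun resA_act b \o linfun resA_act b')%VF.
Proof. by rewrite !(linfunEl resA_linear) /resA_act -mactM talgM mulr1. Qed.
Definition resA : fdmod A := FDMod resA_act1 resA_actM.
Lemma resAE b x : mact resA b x = mact X (atens b 1) x.
Proof.
by have -> : mact resA b = resA_act b by exact: (linfunEl resA_linear).
Qed.
End Restriction.

Lemma resB_hom X Y (f : 'Hom(X, Y)) : ishom f -> @ishom _ _ (resB X) (resB Y) f.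
Proof. by move=> hf b x; rewrite !resBE hf. Qed.
Lemma resA_hom X Y (f : 'Hom(X, Y)) : ishom f -> @ishom _ _ (resA X) (resA Y) f.
Proof. by move=> hf b x; rewrite !resAE hf. Qed.

Lemma resB_ses X Y Z (u : 'Hom(X, Y)) (p : 'Hom(Y, Z)) :
  ses u p -> @ses _ _ (resB X) (resB Y) (resB Z) u p.
Proof.
by case=> [[hu u0] [hp p1] up]; split=> //; split=> //; apply: resB_hom.
Qed.

Lemma actA_homB X a : @ishom _ _ (resB X) (resB X) (mact X (atens a 1)).
Proof. by move=> b x; rewrite !resBE -actAB -actBA. Qed.

Section Bimodule.
Variables (E : vectType k) (ra : A -> 'End(E)) (rb : B -> 'End(E)).
Hypothesis ra_lin : linear ra.
Hypothesis rb_lin : linear rb.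
Hypothesis ra1 : ra 1 = \1%VF.
Hypothesis rb1 : rb 1 = \1%VF.
Hypothesis raM : forall a a', ra (a * a') = (ra a \o ra a')%VF.
Hypothesis rbM : forall b b', rb (b * b') = (rb b \o rb b')%VF.
Hypothesis rab : forall a b, (rb b \o ra a = ra a \o rb b)%VF.

(** Commuting actions of [A] and [B] on one space amount to an action of [A (x) B]; [oten], [hmodB]
    and [hmodA] arise in this way. *)
Definition bim_act : 'Hom(L, 'End(E)) := tlift (fun a b => ra a \o rb b)%VF.
Lemma bim_actE a b : bim_act (atens a b) = (ra a \o rb b)%VF.
Proof.
apply: tliftE; split=> [b' c a1 a2|a' c b1 b2].
  by rewrite ra_lin comp_lfunDl comp_lfunZl.
by rewrite rb_lin comp_lfunDr comp_lfunZr.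
Qed.
Lemma bim_act1 : bim_act 1 = \1%VF.
Proof. by rewrite talg1 bim_actE ra1 rb1 comp_lfun1l. Qed.
Lemma bim_actM x y : bim_act (x * y) = (bim_act x \o bim_act y)%VF.
Proof.
elim/(@tensor_ind k A B): x => [|s t IHs IHt|c s IH|a b].
- by rewrite mul0r linear0 comp_lfun0l.
- by rewrite mulrDl !linearD /= comp_lfunDl IHs IHt.
- by rewrite -scalerAl !linearZ /= -comp_lfunZl IH.
elim/(@tensor_ind k A B): y => [|s t IHs IHt|c s IH|a' b'].
- by rewrite mulr0 linear0 comp_lfun0r.
- by rewrite mulrDr !linearD /= comp_lfunDr IHs IHt.
- by rewrite -scalerAr !linearZ /= -comp_lfunZr IH.
rewrite -![tens _ _]/(atens _ _) talgM !bim_actE raM rbM.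
by rewrite -!comp_lfunA; congr comp_lfun; rewrite !comp_lfunA rab.
Qed.
Definition bim : fdmod L := FDMod bim_act1 bim_actM.
Lemma bimE a b x : mact bim (atens a b) x = ra a (rb b x).
Proof. by rewrite bim_actE lfE. Qed.
End Bimodule.

End TensorAlgebraModules.

(** * Exterior products [U (x) W] and the modules [Hom_k(V, N)] *)

Section ExteriorProduct.
Variables (k : fieldType) (A B : falgType k).
Local Notation L := (talg A B).
Implicit Types (X Y Z P Q : fdmod L) (E : vectType k).

Section Oten.
Variables (U : fdmod A) (W : fdmod B).
Definition oten_ra (a : A) : 'End(tensor U W) := tmap (mact U a) \1%VF.
Definition oten_rb (b : B) : 'End(tensor U W) := tmap \1%VF (mact W b).
Lemma oten_ra_lin : linear oten_ra.
Proof.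
move=> c a a'; rewrite /oten_ra (linearP (mact U)).
by have [tl _] := @tmap_hom_bilinear k U W U W; apply: tl.
Qed.
Lemma oten_rb_lin : linear oten_rb.
Proof.
move=> c a a'; rewrite /oten_rb (linearP (mact W)).
by have [_ tr] := @tmap_hom_bilinear k U W U W; apply: tr.
Qed.
Lemma oten_ra1 : oten_ra 1 = \1%VF.
Proof. by rewrite /oten_ra mact1 tmap1. Qed.
Lemma oten_rb1 : oten_rb 1 = \1%VF.
Proof. by rewrite /oten_rb mact1 tmap1. Qed.
Lemma oten_raM a a' : oten_ra (a * a') = (oten_ra a \o oten_ra a')%VF.
Proof. by rewrite /oten_ra tmap_comp mactM comp_lfun1l. Qed.
Lemma oten_rbM a a' : oten_rb (a * a') = (oten_rb a \o oten_rb a')%VF.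
Proof. by rewrite /oten_rb tmap_comp mactM comp_lfun1l. Qed.
Lemma oten_rab a b : (oten_rb b \o oten_ra a = oten_ra a \o oten_rb b)%VF.
Proof. by rewrite !tmap_comp !comp_lfun1l !comp_lfun1r. Qed.
Definition oten : fdmod L := bim oten_ra_lin oten_rb_lin oten_ra1 oten_rb1
  oten_raM oten_rbM oten_rab.
Lemma otenE a b u w :
  mact oten (atens a b) (tens u w) = tens (mact U a u) (mact W b w).
Proof. by rewrite bimE /oten_ra /oten_rb !tmapE !lfE. Qed.
End Oten.

(* [Hom_k(V, N)] for a right [B]-module [V] and a left [A]-module [N], with
   [((a (x) b) f) v = a (f (v b))]; similarly for [hmodA]. *)
Section HmodB.
Variables (V : rfdmod B) (N : fdmod A).
Definition hmodB_ra (a : A) : 'End('Hom(V, N)) :=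
  linfun (fun f : 'Hom(V, N) => mact N a \o f)%VF.
Lemma hmodB_raE a f v : hmodB_ra a f v = mact N a (f v).
Proof.
by rewrite linfunEl ?lfE // => c h h'; rewrite comp_lfunDr comp_lfunZr.
Qed.
Lemma hmodB_ra_lin : linear hmodB_ra.
Proof.
move=> c a a'; apply/lfunP => f; apply/lfunP => v.
by rewrite !lfE !hmodB_raE (linearP (mact N)) !lfE.
Qed.
Lemma hmodB_ra1 : hmodB_ra 1 = \1%VF.
Proof. by apply/lfunP => f; apply/lfunP => v; rewrite hmodB_raE mact1 !lfE. Qed.
Lemma hmodB_raM a a' : hmodB_ra (a * a') = (hmodB_ra a \o hmodB_ra a')%VF.
Proof.
by apply/lfunP => f; apply/lfunP => v; rewrite comp_lfunE !hmodB_raE mactM lfE.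
Qed.
Lemma hmodB_rbM b b' :
  pre_act V N (b * b') = (pre_act V N b \o pre_act V N b')%VF.
Proof.
by apply/lfunP => f; apply/lfunP => v; rewrite comp_lfunE !pre_actE ractM.
Qed.
Lemma hmodB_rb1 : pre_act V N 1 = \1%VF.
Proof. by apply/lfunP => f; apply/lfunP => v; rewrite pre_actE ract1 lfE. Qed.
Lemma hmodB_rab a b :
  (pre_act V N b \o hmodB_ra a = hmodB_ra a \o pre_act V N b)%VF.
Proof.
apply/lfunP => f; apply/lfunP => v.
by rewrite !comp_lfunE pre_actE !hmodB_raE pre_actE.
Qed.
Definition hmodB : fdmod L := bim hmodB_ra_lin (@pre_act_linear _ _ V N)
  hmodB_ra1 hmodB_rb1 hmodB_raM hmodB_rbM hmodB_rab.
Lemma hmodBE a b (f : 'Hom(V, N)) v :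
  (mact hmodB (atens a b) f : 'Hom(V, N)) v = mact N a (f (mact V b v)).
Proof. by rewrite bimE hmodB_raE pre_actE. Qed.
End HmodB.

End ExteriorProduct.

Section HmodA.
Variables (k : fieldType) (A B : falgType k) (V : rfdmod A) (N : fdmod B).
Lemma hmodA_rab a b :
  (hmodB_ra V N b \o pre_act V N a = pre_act V N a \o hmodB_ra V N b)%VF.
Proof. by rewrite hmodB_rab. Qed.
Definition hmodA : fdmod (talg A B) := bim (@pre_act_linear _ _ V N)
  (@hmodB_ra_lin _ _ _ V N) (@hmodB_rb1 _ _ _ V N) (@hmodB_ra1 _ _ _ V N)
  (@hmodB_rbM _ _ _ V N) (@hmodB_raM _ _ _ V N) hmodA_rab.
Lemma hmodAE a b (f : 'Hom(V, N)) v :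
  (mact hmodA (atens a b) f : 'Hom(V, N)) v = mact N b (f (mact V a v)).
Proof. by rewrite bimE pre_actE hmodB_raE. Qed.
End HmodA.

Section ExteriorProductHoms.
Variables (k : fieldType) (A B : falgType k).
Local Notation L := (talg A B).
Implicit Types (X Y Z P Q : fdmod L) (E : vectType k) (U : fdmod A) (W : fdmod B).

Lemma tmap_r_hom (U : fdmod A) (W W' : fdmod B) (f : 'Hom(W, W')) : ishom f ->
  @ishom _ _ (oten U W) (oten U W') (tmap \1%VF f).
Proof.
move=> hf; apply: talg_hom => a b.
suff /lfunP E : (tmap \1%VF f \o mact (oten U W) (atens a b) =
  mact (oten U W') (atens a b) \o tmap \1%VF f)%VF.
  by move=> x; have := E x; rewrite !comp_lfunE.
by apply: tens_ext => u w; rewrite !comp_lfunE !tmapE !otenE tmapE !id_lfunE hf.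
Qed.

Lemma tmap_l_hom (U U' : fdmod A) (W : fdmod B) (f : 'Hom(U, U')) : ishom f ->
  @ishom _ _ (oten U W) (oten U' W) (tmap f \1%VF).
Proof.
move=> hf; apply: talg_hom => a b.
suff /lfunP E : (tmap f \1%VF \o mact (oten U W) (atens a b) =
  mact (oten U' W) (atens a b) \o tmap f \1%VF)%VF.
  by move=> x; have := E x; rewrite !comp_lfunE.
by apply: tens_ext => u w; rewrite !comp_lfunE !tmapE !otenE tmapE !id_lfunE hf.
Qed.

Lemma oten_ses_r (U : fdmod A) (M N W : fdmod B) (u : 'Hom(M, N)) (q : 'Hom(N, W)) :
  ses u q -> @ses _ _ (oten U M) (oten U N) (oten U W) (tmap \1%VF u) (tmap \1%VF q).
Proof.
have [_ tr] := @tens_bilinear k U N.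
move=> /sesP[hu hq [r [s [ru qs us qu]]]]; apply/sesP.
split; [exact: tmap_r_hom | exact: tmap_r_hom |].
exists (tmap \1%VF r), (tmap \1%VF s); split=> x.
- rewrite -comp_lfunE tmap_comp comp_lfun1l -[RHS]id_lfunE -tmap1.
  by congr (tmap _ _ _); apply/lfunP => y; rewrite !lfE ru.
- rewrite -comp_lfunE tmap_comp comp_lfun1l -[RHS]id_lfunE -tmap1.
  by congr (tmap _ _ _); apply/lfunP => y; rewrite !lfE qs.
- rewrite -!comp_lfunE !tmap_comp comp_lfun1l -add_lfunE -[RHS]id_lfunE -tmap1.
  move: x; apply/lfunP/tens_ext => y z; rewrite add_lfunE !tmapE !lfE.
  by rewrite -[in RHS](us z) -[X in tens _ (X + _)]scale1r tr scale1r.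
rewrite -comp_lfunE tmap_comp comp_lfun1l; move: x.
suff -> : tmap \1%VF (q \o u)%VF = 0 :> 'Hom(tensor U M, tensor U W).
  by move=> x; rewrite lfE.
have [_ tr'] := @tens_bilinear k U W.
apply: tens_ext => y z; rewrite tmapE !lfE qu.
by have := tr' y (-1) 0 0; rewrite scaler0 addr0 scaleN1r addNr.
Qed.

Lemma oten_ses_l (W : fdmod B) (M N U : fdmod A) (u : 'Hom(M, N)) (q : 'Hom(N, U)) :
  ses u q -> @ses _ _ (oten M W) (oten N W) (oten U W) (tmap u \1%VF) (tmap q \1%VF).
Proof.
have [tl _] := @tens_bilinear k N W.
move=> /sesP[hu hq [r [s [ru qs us qu]]]]; apply/sesP.
split; [exact: tmap_l_hom | exact: tmap_l_hom |].
exists (tmap r \1%VF), (tmap s \1%VF); split=> x.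
- rewrite -comp_lfunE tmap_comp comp_lfun1l -[RHS]id_lfunE -tmap1.
  by congr (tmap _ _ _); apply/lfunP => y; rewrite !lfE ru.
- rewrite -comp_lfunE tmap_comp comp_lfun1l -[RHS]id_lfunE -tmap1.
  by congr (tmap _ _ _); apply/lfunP => y; rewrite !lfE qs.
- rewrite -!comp_lfunE !tmap_comp comp_lfun1l -add_lfunE -[RHS]id_lfunE -tmap1.
  move: x; apply/lfunP/tens_ext => y z; rewrite add_lfunE !tmapE !lfE.
  by rewrite -[in RHS](us y) -[X in tens (X + _) _]scale1r tl scale1r.
rewrite -comp_lfunE tmap_comp comp_lfun1l; move: x.
suff -> : tmap (q \o u)%VF \1%VF = 0 :> 'Hom(tensor M W, tensor U W).
  by move=> x; rewrite lfE.
have [tl' _] := @tens_bilinear k U W.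
apply: tens_ext => y z; rewrite tmapE !lfE qu.
by have := tl' z (-1) 0 0; rewrite scaler0 addr0 scaleN1r addNr.
Qed.

(* The universal property [Hom_L(A (x) W, N) = Hom_B(W, N)]. *)
Definition oten_liftB (W : fdmod B) (N : fdmod L) (g : 'Hom(W, N)) :
    'Hom(oten (regmod A) W, N) :=
  tlift (fun (a : A) (w : W) => mact N (atens a 1) (g w)).

Lemma oten_liftBE W (N : fdmod L) (g : 'Hom(W, N)) (a : A) w :
  oten_liftB g (tens a w) = mact N (atens a 1) (g w).
Proof.
apply: tliftE; split=> [w' c x y|x c w1 w2]; last by rewrite !linearP.
by rewrite atens_linear1 (linearP (mact N)) !lfE.
Qed.

Lemma oten_liftB_hom W (N : fdmod L) (g : 'Hom(W, N)) :
  @ishom _ _ W (resB N) g -> ishom (oten_liftB g).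
Proof.
move=> hg; apply: talg_hom => a b.
suff /lfunP E : (oten_liftB g \o mact (oten (regmod A) W) (atens a b) =
  mact N (atens a b) \o oten_liftB g)%VF.
  by move=> x; have := E x; rewrite !comp_lfunE.
apply: tens_ext => u w.
rewrite !comp_lfunE otenE !oten_liftBE regmodE hg resBE.
by rewrite -!comp_lfunE -!mactM !talgM !mulr1 !mul1r.
Qed.

Definition oten_liftA (U : fdmod A) (N : fdmod L) (g : 'Hom(U, N)) :
    'Hom(oten U (regmod B), N) :=
  tlift (fun (u : U) (b : B) => mact N (atens 1 b) (g u)).

Lemma oten_liftAE U (N : fdmod L) (g : 'Hom(U, N)) u (b : B) :
  oten_liftA g (tens u b) = mact N (atens 1 b) (g u).
Proof.
apply: tliftE; split=> [w' c x y|x c w1 w2]; first by rewrite !linearP.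
by rewrite atens_linear2 (linearP (mact N)) !lfE.
Qed.

Lemma oten_liftA_hom U (N : fdmod L) (g : 'Hom(U, N)) :
  @ishom _ _ U (resA N) g -> ishom (oten_liftA g).
Proof.
move=> hg; apply: talg_hom => a b.
suff /lfunP E : (oten_liftA g \o mact (oten U (regmod B)) (atens a b) =
  mact N (atens a b) \o oten_liftA g)%VF.
  by move=> x; have := E x; rewrite !comp_lfunE.
apply: tens_ext => u w.
rewrite !comp_lfunE otenE !oten_liftAE regmodE hg resAE.
by rewrite -!comp_lfunE -!mactM !talgM !mulr1 !mul1r.
Qed.

Definition oten_inB (W : fdmod B) : 'Hom(W, oten (regmod A) W) :=
  linfun (fun w => tens (1 : A) w).
Lemma oten_inBE W w : oten_inB W w = tens (1 : A) w.
Proof. by apply: linfunEl; have [_ tr] := @tens_bilinear k A W; apply: tr. Qed.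
Lemma oten_inB_hom W : @ishom _ _ W (resB (oten (regmod A) W)) (oten_inB W).
Proof. by move=> b w; rewrite resBE !oten_inBE otenE regmodE mulr1. Qed.

Definition oten_inA (U : fdmod A) : 'Hom(U, oten U (regmod B)) :=
  linfun (fun u => tens u (1 : B)).
Lemma oten_inAE U u : oten_inA U u = tens u (1 : B).
Proof. by apply: linfunEl; have [tl _] := @tens_bilinear k U B; apply: tl. Qed.
Lemma oten_inA_hom U : @ishom _ _ U (resA (oten U (regmod B))) (oten_inA U).
Proof. by move=> b w; rewrite resAE !oten_inAE otenE regmodE mulr1. Qed.

(** [A (x) -] is left adjoint to restriction to [B], which preserves surjections. *)
Lemma oten_projB (W : fdmod B) : projective_mod W -> projective_mod (oten (regmod A) W).
Proof.
move=> pW M N p f [hp p1] hf.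
have sp : @surjective_hom _ _ (resB M) (resB N) p by split=> //; apply: resB_hom.
have hg := hom_comp (resB_hom hf) (@oten_inB_hom W).
have [h hh ph] := proj_lift pW sp hg.
exists (oten_liftB h); first exact: oten_liftB_hom.
apply: tens_ext => a w; rewrite comp_lfunE oten_liftBE hp ph comp_lfunE oten_inBE.
by rewrite -hf otenE regmodE mulr1 mact1 lfE.
Qed.

Lemma oten_projA (U : fdmod A) : projective_mod U -> projective_mod (oten U (regmod B)).
Proof.
move=> pW M N p f [hp p1] hf.
have sp : @surjective_hom _ _ (resA M) (resA N) p by split=> //; apply: resA_hom.
have hg := hom_comp (resA_hom hf) (@oten_inA_hom U).
have [h hh ph] := proj_lift pW sp hg.
exists (oten_liftA h); first exact: oten_liftA_hom.
apply: tens_ext => a w; rewrite comp_lfunE oten_liftAE hp ph comp_lfunE oten_inAE.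
by rewrite -hf otenE regmodE mulr1 mact1 lfE.
Qed.

Lemma regmod_oten :
  @ishom _ _ (regmod L) (oten (regmod A) (regmod B)) \1%VF /\
  @ishom _ _ (oten (regmod A) (regmod B)) (regmod L) \1%VF.
Proof.
have E a b (x : L) : mact (regmod L) (atens a b) x =
    mact (oten (regmod A) (regmod B)) (atens a b) x.
  rewrite regmodE; elim/(@tensor_ind k A B): x => [|s t IHs IHt|c s IH|a' b'].
  - by rewrite mulr0 linear0.
  - by rewrite mulrDr linearD /= IHs IHt.
  - by rewrite -scalerAr linearZ /= IH.
  by rewrite otenE !regmodE; apply: tmul_tens.
by split; apply: talg_hom => a b x; rewrite ![\1%VF _]lfE E.
Qed.

Lemma postcomp_sur (V : vectType k) E E' (p : 'Hom(E, E')) (f : 'Hom(V, E')) :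
  limg p = fullv -> exists g : 'Hom(V, E), (p \o g = f)%VF.
Proof.
move=> p1; exists (p^-1 \o f)%VF; apply/lfunP => v.
by rewrite !lfE limg_lfunVK ?p1 ?memvf.
Qed.

Definition postcomp (V : vectType k) E E' (p : 'Hom(E, E')) :
    'Hom('Hom(V, E), 'Hom(V, E')) :=
  linfun (fun f : 'Hom(V, E) => p \o f)%VF.
Lemma postcompE (V : vectType k) E E' (p : 'Hom(E, E')) (f : 'Hom(V, E)) :
  postcomp V p f = (p \o f)%VF.
Proof. by apply: linfunEl => c h h'; rewrite comp_lfunDr comp_lfunZr. Qed.

Lemma coindE (N : fdmod B) a b (f : 'Hom(A, N)) (a' : A) :
  (mact (hmodA (regmod (opalg A)) N) (atens a b) f : 'Hom(A, N)) a' =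
  mact N b (f (a' * a)).
Proof.
transitivity (mact N b (f (mact (regmod (opalg A)) a a'))).
  exact: (@hmodAE k A B (regmod (opalg A)) N a b f a').
by congr (mact N b (f _)); apply: (@regmodE _ (opalg A)).
Qed.

(* [Hom_B(Y, N) = Hom_L(Y, Hom_k(A, N))]. *)
Lemma coindB_adj Y (N : fdmod B) (f : 'Hom(Y, N)) : @ishom _ _ (resB Y) N f ->
  exists2 g : 'Hom(Y, hmodA (regmod (opalg A)) N), ishom g &
    forall y (a : A), (g y : 'Hom(A, N)) a = f (mact Y (atens a 1) y).
Proof.
move=> hf; pose g : 'Hom(Y, hmodA (regmod (opalg A)) N) :=
  curry (fun y (a : A) => f (mact Y (atens a 1) y)).
have gE y (a : A) : (g y : 'Hom(A, N)) a = f (mact Y (atens a 1) y).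
  apply: (@curryE _ Y A N); split=> [b c x x'|x c b b']; first by rewrite !linearP.
  by rewrite atens_linear1 (linearP (mact Y)) !lfE linearP.
exists g => //; apply: talg_hom => a b y; apply/(@lfunP _ A N) => a'.
rewrite coindE !gE -hf resBE; congr (f _).
by rewrite -!comp_lfunE -!mactM !talgM !mulr1 !mul1r.
Qed.

Lemma coindB_ev Y (N : fdmod B) (g : 'Hom(Y, hmodA (regmod (opalg A)) N)) :
  ishom g -> exists2 f : 'Hom(Y, N), @ishom _ _ (resB Y) N f &
    forall y, f y = (g y : 'Hom(A, N)) 1.
Proof.
move=> hg; pose f : 'Hom(Y, N) := linfun (fun y => (g y : 'Hom(A, N)) 1).
have fE y : f y = (g y : 'Hom(A, N)) 1.
  apply: (@linfunEl _ Y N (fun y => (g y : 'Hom(A, N)) 1)) => c x x'.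
  by rewrite linearP !lfE.
by exists f => // b y; rewrite !fE resBE hg coindE mulr1.
Qed.

(** Restriction to [B] has the exact right adjoint [Hom_k(A, -)]. *)
Lemma resB_proj P : projective_mod P -> projective_mod (resB P).
Proof.
move=> pP M N p f [hp p1] hf; have [g hg gE] := coindB_adj hf.
pose q : 'Hom(hmodA (regmod (opalg A)) M, hmodA (regmod (opalg A)) N) := postcomp A p.
have qE (h : 'Hom(A, M)) (a : A) : (q h : 'Hom(A, N)) a = p (h a).
  by rewrite [q h]postcompE lfE.
have sq : surjective_hom q.
  split.
    apply: talg_hom => a b h; apply/(@lfunP _ A N) => a'.
    by rewrite qE !coindE hp qE.
  apply/limg_fullP => h; have [l lE] := postcomp_sur h p1.
  by exists l; rewrite [q l]postcompE lE.
have [h hh qh] := proj_lift pP sq hg; have [l hl lE] := coindB_ev hh.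
exists l => //; apply/lfunP => x; rewrite lfE lE -qE qh gE -talg1 mact1.
by rewrite lfE.
Qed.

End ExteriorProductHoms.

(** * The functor V (x)_B - *)

Section TensorFunctor.
Variables (k : fieldType) (A B : falgType k).
Local Notation L := (talg A B).
Implicit Types (X Y Z P Q : fdmod L) (E : vectType k) (V : rfdmod B).

Section Tmod.
Variables (V : rfdmod B) (X : fdmod L).
Definition Tact (a : A) : 'End(mtens V (resB X)) :=
  @mtmap _ _ V (resB X) (resB X) (mact X (atens a 1)).
Lemma TactE a v x :
  Tact a (@mt _ _ V (resB X) v x) = @mt _ _ V (resB X) v (mact X (atens a 1) x).
Proof. by rewrite [LHS]mtmapE //; apply: actA_homB. Qed.
Lemma Tact_linear : linear Tact.
Proof.
move=> c a a'; apply: mt_ext => v x; rewrite add_lfunE scale_lfunE !TactE.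
by rewrite atens_linear1 linearP add_lfunE scale_lfunE (@mt_linearr _ _ V (resB X)).
Qed.
Lemma Tact1 : linfun Tact 1 = \1%VF.
Proof.
by apply: mt_ext => v x; rewrite (linfunEl Tact_linear) TactE -talg1 mact1 !id_lfunE.
Qed.
Lemma TactM a a' : linfun Tact (a * a') = (linfun Tact a \o linfun Tact a')%VF.
Proof.
apply: mt_ext => v x; rewrite [RHS]comp_lfunE !(linfunEl Tact_linear) !TactE.
by congr (mt _ _); rewrite -[RHS]comp_lfunE -mactM talgM mulr1.
Qed.
(* [V (x)_B X] as a left [A]-module. *)
Definition Tmod : fdmod A := FDMod Tact1 TactM.

Definition Tmt (v : V) (x : X) : Tmod := @mt _ _ V (resB X) v x.
Lemma TmodE a v x : mact Tmod a (Tmt v x) = Tmt v (mact X (atens a 1) x).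
Proof.
have -> : mact Tmod a = Tact a by exact: (linfunEl Tact_linear).
exact: TactE.
Qed.
Lemma Tmt_linearr v : linear (Tmt v). Proof. exact: (@mt_linearr _ _ V (resB X)). Qed.
Lemma Tmt_linearl x : linear (fun v => Tmt v x). Proof. exact: (@mt_linearl _ _ V (resB X)). Qed.
Lemma Tmt_bal v (b : B) x : Tmt (mact V b v) x = Tmt v (mact X (atens 1 b) x).
Proof. by rewrite /Tmt mt_bal resBE. Qed.
Lemma Tmt_ext E (f g : 'Hom(Tmod, E)) :
  (forall v x, f (Tmt v x) = g (Tmt v x)) -> f = g.
Proof. by move=> fg; apply: mt_ext. Qed.
End Tmod.

Definition Tmap V X Y (f : 'Hom(X, Y)) : 'Hom(Tmod V X, Tmod V Y) :=
  @mtmap _ _ V (resB X) (resB Y) f.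

Lemma TmapE V X Y (f : 'Hom(X, Y)) v x : @ishom _ _ (resB X) (resB Y) f ->
  Tmap V f (Tmt v x) = Tmt v (f x).
Proof. by move=> hf; apply: mtmapE. Qed.

Lemma Tmap_hom V X Y (f : 'Hom(X, Y)) : ishom f -> ishom (Tmap V f).
Proof.
move=> hf a; have hB := resB_hom hf.
suff /lfunP E : (Tmap V f \o mact (Tmod V X) a = mact (Tmod V Y) a \o Tmap V f)%VF.
  by move=> m; have := E m; rewrite [X in X = _]comp_lfunE [X in _ = X]comp_lfunE.
apply: Tmt_ext => v x; rewrite [LHS]comp_lfunE [RHS]comp_lfunE.
by rewrite TmodE !TmapE // TmodE hf.
Qed.

(** As [Z] is projective over [B], the sequence splits over [B], and [V (x)_B -] carries the
    splitting along. *)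
Lemma T_ses V X Y Z (u : 'Hom(X, Y)) (p : 'Hom(Y, Z)) :
  ses u p -> projective_mod (resB Z) -> ses (Tmap V u) (Tmap V p).
Proof.
move=> S pZ; have SB := resB_ses S; have hu := resB_hom (ses_hom1 S).
have hp := resB_hom (ses_hom2 S); have [r [s [hr hs ru ps us]]] := proj_ses_split SB pZ.
apply/sesP; split; [exact: Tmap_hom (ses_hom1 S) | exact: Tmap_hom (ses_hom2 S) |].
(* [r] and [s] are only [B]-linear; they are retyped so that [Tmap] accepts them. *)
pose r' : 'Hom(Y, X) := r; pose s' : 'Hom(Z, Y) := s.
exists (Tmap V r'), (Tmap V s'); split=> m.
- suff /lfunP/(_ m) : (Tmap V r' \o Tmap V u = \1)%VF.
    by rewrite [X in X = _]comp_lfunE [X in _ = X]id_lfunE.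
  by apply: Tmt_ext => v x; rewrite [LHS]comp_lfunE id_lfunE !TmapE // ru.
- suff /lfunP/(_ m) : (Tmap V p \o Tmap V s' = \1)%VF.
    by rewrite [X in X = _]comp_lfunE [X in _ = X]id_lfunE.
  by apply: Tmt_ext => v x; rewrite [LHS]comp_lfunE id_lfunE !TmapE // ps.
- suff /lfunP/(_ m) : ((Tmap V u \o Tmap V r')%VF + (Tmap V s' \o Tmap V p)%VF = \1%VF).
    move=> E; apply: (etrans _ (etrans E (id_lfunE m))).
    by rewrite add_lfunE; congr (_ + _); rewrite [RHS]comp_lfunE.
  apply: Tmt_ext => v x; rewrite add_lfunE [X in X + _]comp_lfunE [X in _ + X]comp_lfunE.
  rewrite id_lfunE !TmapE // -[X in X + _]scale1r -Tmt_linearr scale1r.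
  by congr (Tmt v _); apply: us.
suff /lfunP/(_ m) : (Tmap V p \o Tmap V u = 0)%VF.
  by rewrite [X in X = _]comp_lfunE [X in _ = X]zero_lfunE.
apply: Tmt_ext => v x; rewrite [LHS]comp_lfunE zero_lfunE !TmapE // (ses0 S).
by have := @Tmt_linearr V Z v (-1) 0 0; rewrite scaler0 addr0 scaleN1r addNr.
Qed.

(* [Hom_A(V (x)_B X, N) = Hom_L(X, Hom_k(V, N))]. *)
Lemma T_adj1 V X (N : fdmod A) (f : 'Hom(Tmod V X, N)) : ishom f ->
  exists2 g : 'Hom(X, hmodB V N), ishom g &
    forall x v, (g x : 'Hom(V, N)) v = f (Tmt v x).
Proof.
move=> hf; pose g : 'Hom(X, hmodB V N) := curry (fun x v => f (Tmt v x)).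
have gE x v : (g x : 'Hom(V, N)) v = f (Tmt v x).
  apply: (@curryE _ X V N); split=> [v' c x1 x2|x' c v1 v2].
    by rewrite Tmt_linearr linearP.
  by rewrite (Tmt_linearl x') linearP.
exists g => //; apply: talg_hom => a b x; apply/(@lfunP _ V N) => v.
by rewrite hmodBE !gE -hf TmodE Tmt_bal actBA.
Qed.

Lemma T_adj2 V X (N : fdmod A) (g : 'Hom(X, hmodB V N)) : ishom g ->
  exists2 f : 'Hom(Tmod V X, N), ishom f &
    forall x v, f (Tmt v x) = (g x : 'Hom(V, N)) v.
Proof.
move=> hg; pose f : 'Hom(Tmod V X, N) :=
  @mt_lift _ _ V (resB X) N (fun v x => (g x : 'Hom(V, N)) v).
have fE x v : f (Tmt v x) = (g x : 'Hom(V, N)) v.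
  apply: (@mt_liftE _ _ V (resB X)); split.
    split=> [x' c v1 v2|v' c x1 x2]; first by rewrite linearP.
    by rewrite (linearP g) !lfE.
  by move=> b v' x'; rewrite resBE hg hmodBE mact1 lfE.
exists f => // a.
suff /lfunP E : (f \o mact (Tmod V X) a = mact N a \o f)%VF.
  by move=> m; have := E m; rewrite [X in X = _]comp_lfunE [X in _ = X]comp_lfunE.
apply: Tmt_ext => v x; rewrite [LHS]comp_lfunE [RHS]comp_lfunE.
by rewrite TmodE !fE hg hmodBE ract1.
Qed.

Lemma extends_T V X Y (u : 'Hom(X, Y)) (N : fdmod A) : ishom u ->
  extends (Tmap V u) N <-> extends u (hmodB V N).
Proof.
move=> hu; have hB := resB_hom hu; split=> ext f hf.
  have [f' hf' fE] := T_adj2 hf; have [h hh hE] := ext f' hf'.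
  have [g hg gE] := T_adj1 hh; exists g => // x; apply/(@lfunP _ V N) => v.
  by rewrite gE -fE -hE TmapE.
have [f' hf' fE] := T_adj1 hf; have [h hh hE] := ext f' hf'.
have [g hg gE] := T_adj2 hh; exists g => // m.
suff /lfunP/(_ m) : (g \o Tmap V u = f)%VF by rewrite [X in X = _]comp_lfunE.
by apply: Tmt_ext => v x; rewrite [LHS]comp_lfunE TmapE // gE hE fE.
Qed.

Lemma T_proj V P : projective_mod P -> projective_mod (Tmod V P).
Proof.
move=> pP M N p f [hp p1] hf; have [g hg gE] := T_adj1 hf.
pose q : 'Hom(hmodB V M, hmodB V N) := postcomp V p.
have qE (h : 'Hom(V, M)) v : (q h : 'Hom(V, N)) v = p (h v).
  by rewrite [q h]postcompE lfE.
have sq : surjective_hom q.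
  split.
    by apply: talg_hom => a b h; apply/(@lfunP _ V N) => v; rewrite qE !hmodBE hp qE.
  apply/limg_fullP => h; have [l lE] := postcomp_sur h p1.
  by exists l; rewrite [q l]postcompE lE.
have [h hh qh] := proj_lift pP sq hg; have [l hl lE] := T_adj2 hh.
exists l => //; apply: Tmt_ext => v x.
by rewrite [RHS]comp_lfunE lE -qE qh gE.
Qed.

(** The inverse sends [v (x) x] to [(1 (x) v) (x) x]. Since [a (x) v] is [1 (x) v] acted on by [a],
    balancing moves [a] over to [x]; this is [slide] below. *)
Lemma T_btens V X : exists (f : 'Hom(btens (ind_bimod A V) X, Tmod V X))
    (g : 'Hom(Tmod V X, btens (ind_bimod A V) X)),
  [/\ ishom f, ishom g, cancel f g, cancel g f &
      forall a v x, f (@mt _ _ (ind_bimod A V) X (tens a v) x) =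
                    Tmt v (mact X (atens a 1) x)].
Proof.
pose M : rfdmod L := ind_rmod A V.
pose c : 'Hom(tensor A V, 'Hom(X, Tmod V X)) :=
  tlift (fun (a : A) v => linfun (fun x => Tmt v (mact X (atens a 1) x))).
have lin (a : A) (v : V) : linear (fun x => Tmt v (mact X (atens a 1) x)).
  by move=> b x y; rewrite linearP Tmt_linearr.
have cE a (v : V) x : c (tens a v) x = Tmt v (mact X (atens a 1) x).
  rewrite tliftE ?(linfunEl (lin a v)) //; split=> [v' b a1 a2|a' b v1 v2].
    apply/lfunP => y; rewrite !lfE !(linfunEl (lin _ _)).
    by rewrite atens_linear1 linearP !lfE Tmt_linearr.
  apply/lfunP => y; rewrite !lfE !(linfunEl (lin _ _)).
  exact: Tmt_linearl.
have Mact a b a' (v : V) : mact M (atens a b) (tens a' v) = tens (a' * a) (mact V b v).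
  have -> : mact M (atens a b) = ind_ract V (atens a b).
    exact: (linfunEl (@ind_ract_linear _ _ _ V)).
  exact: ind_ract_tens.
(* With evaluation at [y] as a linear map, identities in [m] become equalities of linear maps, to be
   checked on pure tensors. *)
have [ev evE] : exists ev : X -> 'Hom('Hom(X, Tmod V X), Tmod V X),
    forall y h, ev y h = h y.
  exists (fun y => linfun (fun h : 'Hom(X, Tmod V X) => h y)) => y h.
  by apply: linfunEl => b h1 h2; rewrite !lfE.
have cbal : balanced (M := M) (fun (m : M) (x : X) => c m x).
  split; first by split=> [x b m n|m b x y]; rewrite linearP ?lfE.
  move=> g m x; move: m; elim/(@tensor_ind k A B): g => [|s t IHs IHt|b s IH|a b] m.
  - by rewrite (linear0 (mact M)) (linear0 (mact X)) !lfE !linear0 lfE.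
  - rewrite (linearD (mact M)) (linearD (mact X)) !lfE !linearD /=.
    by rewrite lfE IHs IHt.
  - rewrite (linearZ_LR (mact M)) (linearZ_LR (mact X)) !lfE !linearZ /=.
    by rewrite lfE IH.
  rewrite -![tens a b]/(atens a b).
  have /lfunP/(_ m) : (ev x \o c \o mact M (atens a b) =
      ev (mact X (atens a b) x) \o c)%VF.
    apply: tens_ext => a' v; rewrite !comp_lfunE Mact !evE !cE Tmt_bal.
    rewrite -[RHS]/(Tmt v _); congr (Tmt v _).
    by rewrite -!comp_lfunE -!mactM !talgM !mulr1 !mul1r.
  by rewrite !comp_lfunE !evE.
pose f : 'Hom(btens (ind_bimod A V) X, Tmod V X) := mt_lift (M := M) (fun m x => c m x).
have fE a v x : f (@mt _ _ M X (tens a v) x) = Tmt v (mact X (atens a 1) x).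
  by rewrite [LHS](mt_liftE _ _ cbal) cE.
have tr := @tens_bilinear k A V.
have gbal : balanced (M := V) (X := resB X)
    (fun (v : V) (x : resB X) => @mt _ _ M X (tens 1 v) x).
  split.
    split=> [x b v1 v2|v b x y]; last exact: mt_linearr.
    by rewrite tr.2 (@mt_linearl _ _ M X).
  by move=> b v x; rewrite resBE -mt_bal Mact mulr1.
pose g : 'Hom(Tmod V X, btens (ind_bimod A V) X) :=
  mt_lift (M := V) (X := resB X) (fun v x => @mt _ _ M X (tens 1 v) x).
have gE v x : g (Tmt v x) = @mt _ _ M X (tens 1 v) x.
  exact: (mt_liftE _ _ gbal).
have slide a v x : @mt _ _ M X (tens 1 v) (mact X (atens a 1) x) = @mt _ _ M X (tens a v) x.
  by rewrite -mt_bal Mact mul1r ract1.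
have btE a m x : mact (btens (ind_bimod A V) X) a (@mt _ _ M X m x) =
    @mt _ _ M X (tmap (amull a) \1%VF m) x.
  have -> : mact (btens (ind_bimod A V) X) a = btens_act (ind_bimod A V) X a.
    exact: (linfunEl (@btens_act_linear _ _ _ (ind_bimod A V) X)).
  rewrite [LHS]btens_actE; congr (qproj _ (tens _ x)).
  by rewrite [lact _ a](linfunEl (@ind_lact_linear _ _ _ V)).
have fM m x : f (@mt _ _ M X m x) = c m x by exact: (mt_liftE _ _ cbal).
pose mx x : 'Hom(tensor A V, mtens M X) := linfun (fun m : M => @mt _ _ M X m x).
have mxE x m : mx x m = @mt _ _ M X m x by apply: linfunEl; apply: (@mt_linearl _ _ M X).
clearbody f g mx c.
have hf : ishom f.
  move=> a; suff /lfunP E : (f \o mact (btens (ind_bimod A V) X) a =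
      mact (Tmod V X) a \o f)%VF.
    by move=> m; have := E m; rewrite [X in X = _]comp_lfunE [X in _ = X]comp_lfunE.
  apply: (@mt_ext _ _ M X) => m x; rewrite [LHS]comp_lfunE [RHS]comp_lfunE btE !fM.
  have /lfunP/(_ m) : (ev x \o c \o tmap (amull a) \1%VF =
      mact (Tmod V X) a \o ev x \o c)%VF.
    apply: tens_ext => a' v; rewrite !comp_lfunE tmapE !evE !cE TmodE !lfE lfunE /=.
    by rewrite -comp_lfunE -mactM talgM mulr1.
  by rewrite !comp_lfunE !evE.
have hg : ishom g.
  move=> a; suff /lfunP E : (g \o mact (Tmod V X) a =
      mact (btens (ind_bimod A V) X) a \o g)%VF.
    by move=> m; have := E m; rewrite [X in X = _]comp_lfunE [X in _ = X]comp_lfunE.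
  apply: Tmt_ext => v x; rewrite [LHS]comp_lfunE [RHS]comp_lfunE TmodE !gE btE.
  by rewrite slide tmapE !lfE lfunE /= mulr1.
exists f, g; split=> // m.
  suff /lfunP/(_ m) : (g \o f = \1)%VF.
    by rewrite [X in X = _]comp_lfunE [X in _ = X]id_lfunE.
  apply: (@mt_ext _ _ M X) => n x; rewrite [LHS]comp_lfunE id_lfunE fM.
  have /lfunP/(_ n) : (g \o (ev x \o c) = mx x)%VF.
    by apply: tens_ext => a v; rewrite !comp_lfunE evE cE gE mxE slide.
  by rewrite !comp_lfunE evE mxE.
suff /lfunP/(_ m) : (f \o g = \1)%VF.
  by rewrite [X in X = _]comp_lfunE [X in _ = X]id_lfunE.
by apply: Tmt_ext => v x; rewrite [LHS]comp_lfunE id_lfunE gE fE -talg1 mact1 lfE.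
Qed.

End TensorFunctor.

(** * Perfect pairings *)

Section PerfectPairings.
Variable k : fieldType.

(** [Hom_k(V, N) = N (x) D V] in finite dimension, with [W] in the role of [D V]; [K'] is the usual
    sum over a basis of [V] and its dual basis. *)
Lemma tens_Hom (V W N : vectType k) (e : 'Hom(W, 'Hom(V, k^o))) :
  injective e -> (forall f, exists w, f = e w) ->
  exists (K : 'Hom(tensor N W, 'Hom(V, N))) (K' : 'Hom('Hom(V, N), tensor N W)),
    [/\ cancel K K', cancel K' K & forall n w v, K (tens n w) v = e w v *: n].
Proof.
move=> ei es; have [tl tr] := @tens_bilinear k N W.
have tl0 w : tens (0 : N) w = 0 :> tensor N W.
  by have := tl w (-1) 0 0; rewrite scaler0 addr0 scaleN1r addNr.
have tlZ (c : k) n w : tens (c *: n) w = c *: tens n w :> tensor N W.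
  by have := tl w c n 0; rewrite tl0 !addr0.
pose K : 'Hom(tensor N W, 'Hom(V, N)) :=
  tlift (fun n w => linfun (fun v => (e w v : k) *: n)).
have lin (n : N) w : linear (fun v => (e w v : k) *: n).
  by move=> c v v'; rewrite linearP scalerDl scalerA.
have KE n w v : K (tens n w) v = (e w v : k) *: n.
  rewrite tliftE ?(linfunEl (lin n w)) //; split=> [w' c n1 n2|n' c w1 w2].
    apply/lfunP => x; rewrite !lfE !(linfunEl (lin _ _)) scalerDr !scalerA.
    by congr (_ *: _ + _); rewrite mulrC.
  apply/lfunP => x; rewrite !lfE !(linfunEl (lin _ _)).
  by rewrite linearP !lfE scalerDl scalerA.
pose K' : 'Hom('Hom(V, N), tensor N W) := linfun (fun f : 'Hom(V, N) =>
  \sum_(i < \dim {:V}) tens (f (vbasis {:V})`_i) (e^-1%VF (cofun i))).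
have eK f : e (e^-1%VF f) = f.
  by have [w ->] := es f; rewrite limg_lfunVK // memv_img ?memvf.
have K'E f : K' f = \sum_(i < \dim {:V}) tens (f (vbasis {:V})`_i) (e^-1%VF (cofun i)).
  apply: linfunEl => c g h; rewrite scaler_sumr -big_split.
  by apply: eq_bigr => i _; rewrite !lfE tl.
exists K, K'; split=> // [t|f]; last first.
  apply/lfunP => v; rewrite K'E linear_sum sum_lfunE.
  rewrite [in RHS](coord_vbasis (memvf v)) linear_sum.
  by apply: eq_bigr => i _; rewrite KE eK cofunE linearZ.
rewrite -[RHS]id_lfunE -[LHS]comp_lfunE; move: t; apply/lfunP/tens_ext => n w.
rewrite comp_lfunE id_lfunE K'E.
transitivity (tens n (\sum_(i < \dim {:V})
    (e w (vbasis {:V})`_i : k) *: e^-1%VF (cofun i))).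
  rewrite (linear_sum_fun _ _ (tr n)); apply: eq_bigr => i _.
  by rewrite KE tlZ.
congr (tens n _); apply: ei; rewrite linear_sum; apply/lfunP => v.
rewrite sum_lfunE [in RHS](coord_vbasis (memvf v)) linear_sum.
apply: eq_bigr => i _; rewrite linearZ /= scale_lfunE eK cofunE linearZ.
exact: mulrC.
Qed.

Definition tswap (V W : vectType k) : 'Hom(tensor V W, tensor W V) :=
  tlift (fun v w => tens w v).
Lemma tswapE V W v w : tswap V W (tens v w) = tens w v.
Proof.
have [tl tr] := @tens_bilinear k W V.
by apply: tliftE; split=> x; [apply: tr | apply: tl].
Qed.
Lemma tswapK V W : cancel (tswap V W) (tswap W V).
Proof.
move=> t; rewrite -[RHS]id_lfunE -[LHS]comp_lfunE; move: t; apply/lfunP/tens_ext => v w.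
by rewrite !lfE !tswapE.
Qed.

Lemma iso_inv_hom (G : falgType k) (M N : fdmod G) (f : 'Hom(M, N)) (g : 'Hom(N, M)) :
  cancel f g -> cancel g f -> ishom f -> ishom g.
Proof. by move=> fg gf hf a n; apply: (can_inj fg); rewrite gf hf gf. Qed.

(** [W] is [D V] as a left module; the relation serves both for [V = D W] with [W] given and for
    [W = D V] with [V] given. *)
Definition perfect (G : falgType k) (V : rfdmod G) (W : fdmod G) : Prop :=
  exists e : 'Hom(W, 'Hom(V, k^o)),
    [/\ injective e, forall f, exists w, f = e w &
        forall (g : G) w v, e (mact W g w) v = e w (mact V g v)].

Lemma perfect_dual (G : falgType k) (W : fdmod G) : perfect (dual W) W.
Proof.
exists (evm W); split=> [|f|g w v].
- apply/lker0_inj/lker0_eq0 => w w0; apply: functional_sep => f.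
  by rewrite -evmE w0 lfE.
- exact: evm_sur.
by rewrite !evmE dualE.
Qed.

Lemma perfect_ldual (G : falgType k) (V : rfdmod G) : perfect V (ldual V).
Proof.
exists \1%VF; split=> [x y|f|g w v]; first by rewrite !lfE.
  by exists f; rewrite lfE.
by rewrite !lfE premodE.
Qed.

Lemma extends_iso (G : falgType k) (Y E M N : fdmod G) (u : 'Hom(Y, E))
    (f : 'Hom(M, N)) (g : 'Hom(N, M)) :
  ishom f -> ishom g -> cancel g f -> extends u M -> extends u N.
Proof.
move=> hf hg gf ext h hh; have [l hl lE] := ext _ (hom_comp hg hh).
by exists (f \o l)%VF; [homs | move=> y; rewrite lfE lE lfE gf].
Qed.

End PerfectPairings.

(** * Transfer of extension properties along the adjunctions *)

Section Transfer.
Variables (k : fieldType) (A B : falgType k).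
Local Notation L := (talg A B).
Implicit Types (X Y Z P Q : fdmod L) (E : vectType k) (V : rfdmod B).

(** [Hom_A(V (x)_B X, N) = Hom_L(X, Hom_k(V, N)) = Hom_L(X, N (x) W)], naturally in [X]. *)
Lemma extends_T_oten V (W : fdmod B) (N : fdmod A) X Y (u : 'Hom(X, Y)) :
  perfect V W -> ishom u -> extends (Tmap V u) N <-> extends u (oten N W).
Proof.
move=> [e [ei es ee]] hu; have [K [K' [KK' K'K KE]]] := tens_Hom N ei es.
have hK : @ishom _ _ (oten N W) (hmodB V N) K.
  apply: talg_hom => a b.
  suff /lfunP E : (K \o mact (oten N W) (atens a b) = mact (hmodB V N) (atens a b) \o K)%VF.
    by move=> t; have := E t; rewrite !comp_lfunE.
  apply: tens_ext => n w; rewrite !comp_lfunE otenE; apply/lfunP => v.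
  by rewrite KE hmodBE KE linearZ ee.
have hK' : @ishom _ _ (hmodB V N) (oten N W) K'.
  exact: (@iso_inv_hom _ _ (oten N W) (hmodB V N) K K' KK' K'K hK).
rewrite (extends_T V N hu); split.
  exact: (@extends_iso _ _ X Y (hmodB V N) (oten N W) u K' K hK' hK KK').
exact: (@extends_iso _ _ X Y (oten N W) (hmodB V N) u K K' hK hK' K'K).
Qed.

(** [Hom_B(X, N) = Hom_L(X, Hom_k(A, N)) = Hom_L(X, D A (x) N)]. The factors are swapped because
    [tens_Hom] yields [N (x) D A]. *)
Lemma extends_coind (N : fdmod B) X Y (u : 'Hom(X, Y)) :
  extends u (oten (ldual (regmod (opalg A))) N) ->
  @extends _ _ (resB X) (resB Y) u N.
Proof.
pose V := regmod (opalg A); pose W := ldual V.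
have [e [ei es ee]] := perfect_ldual V; have [K [K' [KK' K'K KE]]] := tens_Hom N ei es.
pose J : 'Hom(tensor W N, 'Hom(V, N)) := (K \o tswap W N)%VF.
pose J' : 'Hom('Hom(V, N), tensor W N) := (tswap N W \o K')%VF.
have JJ' : cancel J J' by move=> t; rewrite !lfE KK' tswapK.
have J'J : cancel J' J by move=> t; rewrite !lfE tswapK K'K.
have JE w n v : J (tens w n) v = e w v *: n by rewrite lfE tswapE KE.
have hJ : @ishom _ _ (oten W N) (hmodA V N) J.
  apply: talg_hom => a b.
  suff /lfunP E : (J \o mact (oten W N) (atens a b) = mact (hmodA V N) (atens a b) \o J)%VF.
    by move=> t; have := E t; rewrite [X in X = _]comp_lfunE [X in _ = X]comp_lfunE.
  apply: tens_ext => w n; rewrite [LHS]comp_lfunE [RHS]comp_lfunE otenE.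
  by apply/lfunP => v; rewrite JE hmodAE JE linearZ ee.
have hJ' : @ishom _ _ (hmodA V N) (oten W N) J'.
  exact: (@iso_inv_hom _ _ (oten W N) (hmodA V N) J J' JJ' J'J hJ).
move/(@extends_iso _ _ X Y (oten W N) (hmodA V N) u J J' hJ hJ' J'J) => ext f hf.
have [g hg gE] := coindB_adj hf; have [h hh hE] := ext g hg.
have [l hl lE] := coindB_ev hh; exists l => // y.
by rewrite lE hE gE -talg1 mact1 lfE.
Qed.

Lemma homology0P (U V W : vectType k) (f : 'Hom(U, V)) (g : 'Hom(V, W)) :
  (forall t : homology f g, t = 0) <->
  (forall z, g z = 0 -> exists y, z = f y).
Proof.
split=> [h0 z /eqP|ex t].
  rewrite -memv_ker => gz; pose z' := Subvs gz.
  have := qprojK (incl (lker g) @^-1: limg f)%VS z'.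
  rewrite (h0 (qproj _ z')) linear0 subr0 -memv_preim lfunE => /memv_imgP[y _ zy].
  by exists y.
rewrite -[t]qsecK; apply: qproj0; set s := qsec _ _.
rewrite -memv_preim lfunE; have /eqP := subvsP s.
rewrite memv_ker eqb_id => /eqP/ex[y /= ->].
by rewrite memv_img ?memvf.
Qed.

(** [D((A (x) D S) (x)_L Y) = D(D S (x)_B Y) = Hom_B(Y, S)]; [ind_adj2] is the opposite
    direction. *)
Lemma ind_adj1 (S : fdmod B) Y (phi : 'Hom(mtens (ind_bimod A (dual S)) Y, k^o)) :
  exists2 g : 'Hom(Y, S), @ishom _ _ (resB Y) S g &
    forall a (xi : 'Hom(S, k^o)) y,
      phi (@mt _ _ (ind_bimod A (dual S)) Y (tens a xi) y) = xi (g (mact Y (atens a 1) y)).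
Proof.
have [f [g [hf hg fg gf fE]]] := T_btens (dual S) Y.
pose phi' : 'Hom(Tmod (dual S) Y, k^o) := (phi \o g)%VF.
have [h hh hE] := @dual_adj1 _ _ S (resB Y) phi'.
exists h => // a xi y; rewrite hE /phi' comp_lfunE; congr (phi _).
rewrite -[LHS]fg; congr (g _); exact: fE.
Qed.

Lemma ind_adj2 (S : fdmod B) Y (g : 'Hom(Y, S)) : @ishom _ _ (resB Y) S g ->
  exists phi : 'Hom(mtens (ind_bimod A (dual S)) Y, k^o),
    forall a (xi : 'Hom(S, k^o)) y,
      phi (@mt _ _ (ind_bimod A (dual S)) Y (tens a xi) y) = xi (g (mact Y (atens a 1) y)).
Proof.
move=> hg; have [phi phiE] := dual_adj2 hg.
have [f [f' [hf hf' ff' f'f fE]]] := T_btens (dual S) Y.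
pose psi : 'Hom(mtens (ind_bimod A (dual S)) Y, k^o) := (phi \o f)%VF.
by exists psi => a xi y; rewrite -phiE /psi comp_lfunE; congr (phi _); apply: fE.
Qed.

Lemma ind_ext (S : fdmod B) Y E (f g : 'Hom(mtens (ind_bimod A (dual S)) Y, E)) :
  (forall a (xi : 'Hom(S, k^o)) y,
    f (@mt _ _ (ind_bimod A (dual S)) Y (tens a xi) y) =
    g (@mt _ _ (ind_bimod A (dual S)) Y (tens a xi) y)) -> f = g.
Proof.
move=> fg; apply: mt_ext => m y; move: m.
pose M := ind_rmod A (dual S).
have [mx mxE] : exists mx : 'Hom(tensor A (dual S), mtens M Y),
    forall m, mx m = @mt _ _ M Y m y.
  exists (linfun (fun m : M => @mt _ _ M Y m y)) => m.
  by apply: linfunEl; apply: (@mt_linearl _ _ M Y).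
suff /lfunP E' : (f \o mx = g \o mx)%VF.
  by move=> m; have := E' m; rewrite ![(_ \o mx)%VF _]comp_lfunE mxE.
by apply: tens_ext => a xi; rewrite [LHS]comp_lfunE [RHS]comp_lfunE mxE fg.
Qed.

End Transfer.

(** * The monomorphism category *)

Lemma dim_subvs (k : fieldType) (V : vectType k) (U : {vspace V}) :
  \dim {:subvs_of U} = \dim U.
Proof.
by rewrite -[in RHS](limg_incl U) limg_dim_eq // lker_incl capv0.
Qed.

Section SimpleModules.
Variables (k : fieldType) (G : falgType k).
Implicit Types Y N S : fdmod G.

Lemma ext10_all_proj Y : (forall N, ext10 Y N) -> projective_mod Y.
Proof.
move=> ext; have [K [V [u [p S]]]] := free_ses Y.
have [h hh ph] := ext K _ _ _ _ _ S (@hom_one _ _ Y).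
apply: (@proj_retract _ _ (free_mod G V) _ h p) => //; first exact: free_proj.
  exact: ses_hom2 S.
by move=> y; rewrite ph lfE.
Qed.

(** Induction on the dimension: a module neither zero nor simple is an extension of smaller ones,
    and [Ext^1(Y, -)] is half exact. *)
Lemma ext10_simple Y : (forall S, simple_mod S -> ext10 Y S) -> forall N, ext10 Y N.
Proof.
move=> extS N; have [n] := ubnP (\dim {:N}); elim: n N => // n IH N dN.
have [zN|nzN] := classic (zero_mod N).
  apply: ext10_inj => M M' i f _ _; exists 0; first homs.
  by apply/lfunP => x; rewrite [LHS]zN [RHS]zN.
have [sN|nsN] := classic (simple_mod N); first exact: extS.
have [U [stabU [nU0 nUf]]] : exists U : {vspace N},
    (forall g, (mact N g @: U <= U)%VS) /\ U <> 0%VS /\ U <> fullv.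
  apply: NNPP => none; apply: nsN; split=> // U stabU.
  apply: NNPP => nU; apply: none; exists U; split=> //.
  by split=> E; apply: nU; [left|right].
have dU : (0 < \dim U)%N by rewrite lt0n dimv_eq0; apply/eqP.
have dUN : (\dim U < \dim {:N})%N.
  rewrite ltn_neqAle dimvS ?subvf // andbT; apply/eqP => E; apply: nUf.
  by apply/eqP; rewrite eqEdim subvf E leqnn.
apply: (ext10_mid (quot_ses stabU)); apply: IH.
  by rewrite [X in (X < _)%N]dim_subvs; lia.
by rewrite [X in (X < _)%N]dim_subvs dimv_compl; lia.
Qed.
End SimpleModules.

Section MonomorphismCategory.
Variables (k : fieldType) (A B : falgType k).
Local Notation L := (talg A B).
Implicit Types (X Y Z P Q : fdmod L) (E : vectType k) (V : rfdmod B).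

Lemma resB_syz X Y : syz X Y -> syz (resB X) (resB Y).
Proof.
move=> [Q [u [p [pQ S]]]]; exists (resB Q), u, p.
by split; [exact: resB_proj | exact: resB_ses].
Qed.

Lemma resB_syz_proj X Y : syz X Y -> projective_mod (resB Y) -> projective_mod (resB X).
Proof.
move=> /resB_syz[Q [u [p [pQ S]]]] pY.
have [r [_ [hr _ ru _ _]]] := proj_ses_split S pY.
exact: proj_retract pQ (ses_hom1 S) hr ru.
Qed.

(** By [ind_adj1] and [ind_adj2], the complex computing [Tor_i(A (x) D S, X)] is dual to
    [Hom_B(F, S)], where the free resolution [F] of [X] is also projective over [B]. So [Tor_i] is
    dual to [Ext_B^i(X, S)], and simple modules suffice to test projectivity. *)
Lemma Mon_proj X : Mon X <-> projective_mod (resB X).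
Proof.
pose syzX := syzygy X; pose F n := free_mod L (syzX n).
pose c n : 'Hom(F n, syzX n) := free_cover (syzX n).
pose inc n : 'Hom(syzX n.+1, F n) := incl (lker (free_cover (syzX n))).
pose d n : 'Hom(F n.+1, F n) := free_resd X n.
have dE n y : d n y = inc n (c n.+1 y) by rewrite /d /free_resd comp_lfunE.
have S n : ses (inc n) (c n).
  split; [|exact: free_cover_sur | exact: limg_incl].
  by split; [exact: incl_hom | exact: lker_incl].
have hd n : ishom (d n) by exact: free_resd_hom.
have pF n : projective_mod (F n) by exact: free_proj.
pose D S' n := @mtmap k L (ind_bimod A (dual S')) (F n.+1) (F n) (d n).
have DE S' n m y : D S' n (mt m y) = mt m (d n y) by rewrite mtmapE.
have TorP (S' : fdmod B) n : (forall t : Tor n.+1 (ind_bimod A (dual S')) X, t = 0) <->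
    (forall z, D S' n z = 0 -> exists y, z = D S' n.+1 y).
  exact: homology0P.
have [hc hinc] : (forall n, ishom (c n)) /\ (forall n, ishom (inc n)).
  by split=> n; [exact: ses_hom2 (S n) | exact: ses_hom1 (S n)].
split=> [monX|pX S' _ [//|n] _].
  apply: ext10_all_proj; rewrite -[X]/(syzX 0%N); move: 0%N => n.
  apply: ext10_simple => S' sS'; apply: (ext10I (resB_ses (S n))).
    exact: resB_proj.
  (* The cocycle [G] becomes a functional [phi], which vanishes on the image of [D S' n.+1]. That
     image contains the kernel of [D S' n], so [phi] extends along [D S' n]. *)
  move=> f hf; pose G : 'Hom(F n.+1, S') := (f \o c n.+1)%VF.
  have hG : @ishom _ _ (resB (F n.+1)) S' G.
    by apply: (@hom_comp _ _ (resB (F n.+1)) (resB (syzX n.+1))) hf _; apply: resB_hom.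
  have [phi phiE] := ind_adj2 hG.
  have exT : forall z, D S' n z = 0 -> exists y, z = D S' n.+1 y.
    by apply/TorP => t; apply: monX.
  have phiD : (phi \o D S' n.+1 = 0)%VF.
    apply: ind_ext => a xi y; rewrite comp_lfunE zero_lfunE DE phiE -hd dE.
    by rewrite /G comp_lfunE (ses0 (S n.+1)) !linear0.
  have [z Dz|psi psiE] := @functional_extend _ _ _ (D S' n) phi.
    by have [y ->] := exT z Dz; rewrite -[LHS]comp_lfunE phiD zero_lfunE.
  have [h hh hE] := ind_adj1 psi; exists h => // x.
  have [y ->] := ses_sur (S n.+1) x; rewrite -dE.
  apply/eqP; rewrite -subr_eq0; apply/eqP/functional_sep => xi; rewrite linearB /=.
  have := hE 1 xi (d n y); rewrite -talg1 mact1 id_lfunE => <-.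
  rewrite -DE psiE phiE -talg1 mact1 id_lfunE /G comp_lfunE.
  by rewrite subrr.
have pS m : projective_mod (resB (syzX m)).
  elim: m => // m IH; apply: resB_syz_proj IH; exact: syz_syzygy.
apply/TorP => z Dz.
suff /memv_imgP[y _ ->] : z \in limg (D S' n.+1) by exists y.
(* It suffices that every [phi] vanishing on that image factors through [D S' n]. The corresponding
   [G] kills the image of [d n.+1], hence descends to [syzX n.+1], and extends from there to [F n]
   because [syzX n] is projective over [B]. *)
apply: functional_sub => phi phiD; have [G hG GE] := ind_adj1 phi.
have Gd y : G (d n.+1 y) = 0.
  apply: functional_sep => xi.
  have := GE 1 xi (d n.+1 y); rewrite -talg1 mact1 id_lfunE => <-.
  by rewrite -DE phiD // memv_img ?memvf.
have Ginc x : G (inc n.+1 x) = 0.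
  by have [y ->] := ses_sur (S n.+2) x; rewrite -dE Gd.
have [f hf fE] := ses_factor (resB_ses (S n.+1)) hG Ginc.
have [h hh hE] := ext10E (resB_ses (S n)) (ext10_projl (pS n)) hf.
have [psi psiE] := ind_adj2 hh.
suff -> : phi = (psi \o D S' n)%VF by rewrite comp_lfunE Dz linear0.
apply: ind_ext => a xi y; rewrite comp_lfunE DE GE psiE -hd dE hE fE.
by [].
Qed.

Section Class.
Variable C : fdmod L -> Prop.
Hypothesis sC : stable C.
Hypothesis pC : perp C (regmod L).

Lemma resB_stable : stable (fun N : fdmod B => exists2 X, C X & N = resB X).
Proof.
split=> _ [X CX ->].
  have [Y CY YX] := sC.1 X CX; exists (resB Y); first by exists Y.
  exact: resB_syz.
have [Y CY YX] := sC.2 X CX; exists (resB Y); first by exists Y.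
exact: resB_syz.
Qed.

Lemma T_syz V X Y : projective_mod (resB Y) -> syz X Y -> syz (Tmod V X) (Tmod V Y).
Proof.
move=> pY [Q [u [p [pQ S]]]]; exists (Tmod V Q), (Tmap V u), (Tmap V p).
by split; [exact: T_proj | exact: T_ses].
Qed.

Lemma T_stable V : (forall X, C X -> projective_mod (resB X)) ->
  stable (fun N : fdmod A => exists2 X, C X & N = Tmod V X).
Proof.
move=> pr; split=> _ [X CX ->].
  have [Y CY YX] := sC.1 X CX; exists (Tmod V Y); first by exists Y.
  by apply: T_syz => //; apply: pr.
have [Y CY YX] := sC.2 X CX; exists (Tmod V Y); first by exists Y.
by apply: T_syz => //; apply: pr.
Qed.

Lemma perp_oten_regB U : fpd U -> perp C (oten U (regmod B)).
Proof.
elim=> [P pP X CX|Y P Z u q pP S _ CY].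
  by apply: ext10_projr (oten_projA pP); apply: pC.
apply: perp_quot sC.1 (oten_ses_l (regmod B) S) _ CY => X CX.
by apply: ext10_projr (oten_projA pP); apply: pC.
Qed.

Lemma perp_oten_regA W : fpd W -> perp C (oten (regmod A) W).
Proof.
elim=> [P pP X CX|Y P Z u q pP S _ CY].
  by apply: ext10_projr (oten_projB pP); apply: pC.
apply: perp_quot sC.1 (oten_ses_r (regmod A) S) _ CY => X CX.
by apply: ext10_projr (oten_projB pP); apply: pC.
Qed.

Lemma resB_perp :
  Gorenstein A -> perp (fun N : fdmod B => exists2 X, C X & N = resB X) (regmod B).
Proof.
move=> GA _ [X CX ->]; have [Y CY [Q [u [p [pQ S]]]]] := sC.1 X CX.
apply: (ext10I (resB_ses S)); first exact: resB_proj.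
apply: extends_coind; apply: (ext10E S).
by apply: perp_oten_regB CX; apply: Gorenstein_fpd.
Qed.

Lemma T_perp V : (forall X, C X -> projective_mod (resB X)) ->
  (forall W : fdmod B, fpd W) ->
  perp (fun N : fdmod A => exists2 X, C X & N = Tmod V X) (regmod A).
Proof.
move=> pr fB _ [X CX ->]; have [Y CY [Q [u [p [pQ S]]]]] := sC.1 X CX.
apply: (ext10I (T_ses V S (pr X CX))); first exact: T_proj.
apply/(extends_T_oten _ (perfect_ldual V) (ses_hom1 S)); apply: (ext10E S).
by apply: perp_oten_regA CX; apply: fB.
Qed.

End Class.

Lemma Gproj_Tmod X V : MonIn (@Gproj k A) X -> Gproj (Tmod V X).
Proof.
move=> [_ /(_ V)]; have [f [g [hf hg fg gf _]]] := T_btens V X.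
exact: Gproj_iso hg hf gf.
Qed.

(** Projectivity over [B] is shown for all of [C] and not for [X] alone: only then does [V (x)_B -]
    preserve the sequences that link the members of [C]. *)
Lemma Gproj_MonIn X : Gorenstein A \/ Gorenstein B -> CMfree B ->
  Gproj X -> MonIn (@Gproj k A) X.
Proof.
move=> GAB cm /Gproj_stable[C [sC pC CX]].
have pr Y : C Y -> projective_mod (resB Y).
  move=> CY; apply/cm; apply: (stable_Gproj (resB_stable sC)); last by exists Y.
  case: GAB => [GA|/Gorenstein_fid GB]; first exact: resB_perp.
  (* Here [B] has finite injective dimension, and each restricted module is a syzygy of any
     order. *)
  exact: fid_perp (resB_stable sC).2 GB.
split; first by apply/Mon_proj/pr.
move=> V; have [f [g [hf hg fg gf _]]] := T_btens V X.
apply: (Gproj_iso hf hg fg).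
apply: (stable_Gproj (T_stable sC V pr)); last by exists X.
case: GAB => [/Gorenstein_fid GA|GB]; first exact: fid_perp (T_stable sC V pr).2 GA.
by apply: T_perp => //; apply: Gorenstein_CMfree_fpd.
Qed.

Lemma MonIn_Gproj X : MonIn (@Gproj k A) X -> Gproj X.
Proof.
pose C X := projective_mod (resB X) /\ forall V, Gproj (Tmod V X).
move=> mX; have {mX} : C X.
  by split=> [|V]; [apply/Mon_proj; case: mX | apply: Gproj_Tmod].
have ext_oten Y (W : fdmod B) : C Y -> ext10 Y (oten (regmod A) W).
  move=> [pY GY]; have [K [V [u [p S]]]] := free_ses Y.
  apply: (ext10I S); first exact: free_proj.
  apply/(extends_T_oten _ (perfect_dual W) (ses_hom1 S)).
  apply: ext10E (T_ses _ S pY) _; apply: Gproj_perp; exact: GY.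
have pC : perp C (regmod L).
  move=> Y CY; have [Z YZ] := syz_ex Y; have [Q [u [p [pQ S]]]] := YZ.
  apply: (ext10I S pQ); have [h1 h2] := regmod_oten A B.
  apply: (@extends_iso _ _ _ _ (oten (regmod A) (regmod B)) (regmod L) u _ _ h2 h1).
    by move=> x; rewrite !lfE.
  exact: (ext10E S (ext_oten _ _ CY)).
apply: stable_Gproj pC; split=> {}X CX.
  have [Y YX] := syz_ex X; exists Y => //; case: CX => pX GX; split.
    exact: resB_syz_proj YX pX.
  by move=> V; apply: Gproj_syz (T_syz V pX YX) (GX V).
have [U [f [hf fL]]] := left_approx X; pose F := free_mod L U.
have pF : projective_mod F by exact: free_proj.
(* A map from [X] to [A (x) D V] lifts to [A (x) free_mod B U'], the obstruction lying in
   [Ext^1(X, A (x) W') = 0]. This module is projective, so the lift extends along [f]. *)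
have fT V : extends (Tmap V f) (regmod A).
  apply/(extends_T_oten _ (perfect_ldual V) hf) => g hg.
  have [W' [U' [u [q S]]]] := free_ses (ldual V).
  have [h hh qh] := ext_oten _ W' CX _ _ _ _ _ (oten_ses_r (regmod A) S) hg.
  have pR : projective_mod (oten (regmod A) (free_mod B U')).
    by apply: oten_projB; exact: free_proj.
  have [l hl lE] := extends_proj fL pR hh.
  exists (tmap \1%VF q \o l)%VF.
    apply: (@hom_comp _ _ _ (oten (regmod A) (free_mod B U'))) hl.
    exact: tmap_r_hom (ses_hom2 S).
  by move=> y; rewrite comp_lfunE lE qh.
have Tinj V : injective (Tmap V f).
  have hT := @Tmap_hom _ _ _ V _ _ _ hf.
  have [] := torsionless_inj (Gproj_torsionless (CX.2 V)) hT (fT V).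
  by move=> _ /lker0_inj.
have [r hr rf] := mt_inj_retract (resB_hom hf) Tinj.
have jf : injective_hom f by split=> //; apply/lker0_inj; apply: can_inj rf.
have [Y [p S]] := cokernel_ses jf.
have XY : syz X Y by exists F, f, p.
have pY : projective_mod (resB Y).
  have SB := resB_ses S.
  (* [1 - f \o r] kills the image of [f], hence induces a section of [p] over [B]. *)
  have [||s hs sp] := ses_factor SB (f := \1%VF - (f \o r)%VF).
  - apply: hom_add (@hom_one _ _ _) (hom_opp _).
    exact: (@hom_comp _ _ (resB F) (resB X)) (resB_hom hf) hr.
  - by move=> x; rewrite !lfE rf subrr.
  apply: (@proj_retract _ _ (resB F) _ s p) => //; first exact: resB_proj.
    exact: ses_hom2 SB.
  by move=> y; have [z ->] := ses_sur SB y; rewrite sp !lfE linearB /= (ses0 SB) subr0.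
(* The premise [Ext_A^1(V (x)_B Y, A) = 0] left open here follows from [fT V]. *)
exists Y => //; split=> // V; apply: Gproj_cosyz (T_syz V pY XY) _ (CX.2 V).
by apply: (ext10I (T_ses V S pY)); first exact: T_proj.
Qed.

Lemma CMfree_of_MonIn :
  (forall X, Gproj X -> MonIn (@Gproj k A) X) -> CMfree B.
Proof.
move=> GM M; split=> [|/proj_Gproj//].
case/Gproj_stable=> C [sC pC CM].
pose D X := exists2 N, C N & X = oten (regmod A) N.
have syzA N N' : syz N N' -> syz (oten (regmod A) N) (oten (regmod A) N').
  move=> [Q [u [p [pQ S]]]]; exists (oten (regmod A) Q), (tmap \1%VF u), (tmap \1%VF p).
  by split; [exact: oten_projB | exact: oten_ses_r].
have sD : stable D.
  split=> _ [N CN ->].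
    have [N' CN' S] := sC.1 N CN; exists (oten (regmod A) N'); first by exists N'.
    exact: syzA.
  have [N' CN' S] := sC.2 N CN; exists (oten (regmod A) N'); first by exists N'.
  exact: syzA.
have pD : perp D (regmod L).
  move=> _ [N CN ->]; have [N' CN' [Q [u [p [pQ S]]]]] := sC.1 N CN.
  apply: (ext10I (oten_ses_r (regmod A) S)); first exact: oten_projB.
  (* [f] is determined by its restriction to [N'], which extends to [Q] because [A (x) B] is
     projective over [B]. *)
  move=> f hf; have hg := hom_comp (resB_hom hf) (@oten_inB_hom _ _ _ N').
  have pL : projective_mod (resB (regmod L)) by apply/resB_proj/regmod_proj.
  have [h hh hE] := ext10E S (ext10_projr (pC N CN) pL) hg.
  exists (oten_liftB h); first exact: oten_liftB_hom.
  move=> t; rewrite -comp_lfunE; move: t; apply/lfunP/tens_ext => a n.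
  rewrite comp_lfunE tmapE oten_liftBE hE comp_lfunE oten_inBE -hf otenE.
  by rewrite regmodE mulr1 mact1 !lfE.
have GX : Gproj (oten (regmod A) M) by apply: (stable_Gproj sD pD); exists M.
have /Mon_proj pAM := (GM _ GX).1.
(* Since [1] is nonzero in [A], some functional takes the value [1] there; applied to the first
   factor it gives a [B]-linear retraction of [m |-> 1 (x) m]. *)
have [la la1] : exists la : 'Hom(A, k^o), la 1 = 1.
  have [f /eqP f1] : exists f : 'Hom(A, k^o), f 1 <> 0.
    apply: NNPP => none; have /eqP := oner_neq0 A; apply.
    by apply: functional_sep => f; apply: NNPP => f1; apply: none; exists f.
  by exists ((f 1)^-1 *: f); rewrite lfE; apply: mulVf.
pose r : 'Hom(tensor A M, M) := tlift (fun (a : A) (m : M) => (la a : k) *: m).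
have rE a m : r (tens a m) = (la a : k) *: m.
  apply: tliftE; split=> [m' c a1 a2|a' c m1 m2].
    by rewrite linearP scalerDl scalerA.
  by rewrite scalerDr !scalerA mulrC.
apply: (@proj_retract _ _ (resB (oten (regmod A) M)) _ (oten_inB A M) r) => //.
- exact: oten_inB_hom.
- move=> b; suff /lfunP E : (r \o mact (resB (oten (regmod A) M)) b = mact M b \o r)%VF.
    by move=> t; have := E t; rewrite !comp_lfunE.
  apply: tens_ext => a m; rewrite [LHS]comp_lfunE [RHS]comp_lfunE.
  transitivity (r (mact (oten (regmod A) M) (atens 1 b) (tens a m))).
    by congr (r _); apply: (@resBE _ _ _ (oten (regmod A) M)).
  by rewrite otenE regmodE mul1r !rE linearZ.
by move=> m; rewrite oten_inBE rE la1 scale1r.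
Qed.

End MonomorphismCategory.

Theorem theoremA (k : fieldType) (A B : falgType k)
    (GorAB : Gorenstein A \/ Gorenstein B) :
  (forall X : fdmod (talg A B), Gproj X <-> MonIn (@Gproj k A) X) <-> CMfree B.
Proof.
split=> [GM|cm X]; first by apply: (@CMfree_of_MonIn k A B) => X /GM.
by split; [exact: Gproj_MonIn | exact: MonIn_Gproj].
Qed.
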